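(* Let $\Omega\subset\mathbb R^2$ be a bounded rational convex polygon. For every $N\ge1$ and every strongly generic configuration $P=\{p_1,\dots,p_N\}\subset\Omega^\circ$: (i) the completed cut graph $T_P$ is a finite tree; (ii) the minimal subtree $H_P\subset T_P$ containing all $2N$ marked ends $p_i^\pm$ is compactly contained in $\Omega^\circ$; (iii) identifying $p_i^+\sim p_i^-$ for every $i$ in $H_P$ produces a connected finite graph $\Gamma_P^{\mathrm{core}}$ (the core) with first Betti number $\beta_1(\Gamma_P^{\mathrm{core}})=N$; (iv) every cycle of $\Gamma_P$ lies in the core; (v) every component outside the core is an unmarked tree attached to the core at one point, and every other leaf of that tree lies on $\partial\Omega$.
   Context: A bounded rational convex polygon is a compact convex polygon $\Omega\subset\mathbb R^2$ with nonempty interior $\Omega^\circ$, of the form $\Omega=\bigcap_{r=1}^s\{x:\langle n_r,x\rangle+a_r\ge0\}$ with primitive $n_r\in\mathbb Z^2$, $a_r\in\mathbb R$. An $\Omega$-tropical series is a continuous function $F:\Omega\to\mathbb R_{\ge0}$ with $F=0$ on $\partial\Omega$ which near every point of $\Omega^\circ$ has the form $F(x)=\min_{m\in A}(c_m+\langle m,x\rangle)$ with $A\subset\mathbb Z^2$ finite and $c_m\in\mathbb R$; it is concave. Its corner locus $V(F)\subset\Omega^\circ$ is the set of points where the minimum is attained by at least two distinct affine functions. For nonempty finite $P\subset\Omega^\circ$, the tropical relaxation $F_P=G_P0_\Omega$ is the pointwise infimum of all $\Omega$-tropical series $G$ with $P\subset V(G)$; it is itself such a series. Put $\Gamma_P=V(F_P)$.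 The linearity cells of $F_P$ are the closures of the maximal connected open subsets of $\Omega^\circ$ on which $F_P$ is affine; each has a gradient in $\mathbb Z^2$. $\Gamma_P$ is a finite embedded polyhedral graph, whose vertices are the points $v\in\Omega^\circ$ whose superdifferential $\{p:F_P(y)\le F_P(v)+\langle p,y-v\rangle\ \forall y\in\Omega\}$ is two-dimensional (so transverse crossings are four-valent vertices) and whose edges are the straight segments into which the vertices divide it; an edge separating cells of gradients $m_0,m_1$ has weight $w\ge1$ where $m_1-m_0=wn$ with $n\in\mathbb Z^2$ primitive. An edge is terminal if its closure meets $\partial\Omega$. The gradient-labelled marked type of $P=(p_1,\dots,p_N)$ consists of the embedded face poset of this subdivision of $\Omega$ (cells, edges, vertices, incidences, cyclic orders), the gradient of each two-dimensional cell, all edge weights, all incidences with the sides and vertices of $\Omega$, and for each $i$ the face containing $p_i$ in its relative interior. $P$ (a set of $N$ distinct points of $\Omega^\circ$) is strongly generic if (i) every $p_i$ lies in the relative interior of an edge of $\Gamma_P$; (ii) distinct $p_i$ lie on distinct edges; (iii) the gradient-labelled marked type is unchanged under all sufficiently small independent perturbations of the points $p_i$. Completed cut graph. $T_P$ is the finite graph obtained from $\Gamma_P\setminus(P\cup\partial\Omega)$ by adjoining, at every marked point $p_i$, two distinct degree-one endpoints $p_i^+$ and $p_i^-$ (the marked ends, one for each of the two pieces into which $p_i$ cuts its edge), and one degree-one endpoint, regarded as lying on $\partial\Omega$, for every terminal edge (distinct terminal edges receive distinct endpoints). After the identifications $p_i^+\sim p_i^-$, the core is regarded as a subset of $\Gamma_P$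 (completed by its boundary endpoints), and ''component outside the core'' means a connected component of the complement of the core in that completed graph, together with its attachment point. *)

(* Defs.v *)
From Stdlib Require Import Relations.Relation_Operators.
From mathcomp Require Import all_boot all_order all_algebra finmap.
From mathcomp Require Import all_classical all_reals topology normedtype.

Set Implicit Arguments.
Unset Strict Implicit.
Unset Printing Implicit Defensive.

Import Order.TTheory GRing.Theory Num.Theory.
Import numFieldNormedType.Exports.

Local Open Scope classical_set_scope.
Local Open Scope ring_scope.

(* The edge [e] joins [gsrc e] to [gtgt e]; the orientation only serves to name
   the two ends of an edge and to write the boundary operator. *)
Record graph (T U : choiceType) := Graph {
  gnodes : set T;
  gedges : set U;
  gsrc : U -> T;
  gtgt : U -> T }.

Section Graphs.
Variables T U : choiceType.
Implicit Types (G H K : graph T U) (d : U * bool) (w : seq (U * bool)).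

Definition is_graph G :=
  forall e, gedges G e -> gnodes G (gsrc G e) /\ gnodes G (gtgt G e).

Definition finite_graph G :=
  [/\ is_graph G, finite_set (gnodes G) & finite_set (gedges G)].

(* A dart [(e, b)] is the edge [e] with a direction: from source to target if
   [b], backwards otherwise. *)
Definition dart_from G d := if d.2 then gsrc G d.1 else gtgt G d.1.
Definition dart_to G d := if d.2 then gtgt G d.1 else gsrc G d.1.

Fixpoint walk G (x : T) w (y : T) : Prop :=
  if w is d :: w' then
    [/\ gedges G d.1, dart_from G d = x & walk G (dart_to G d) w' y]
  else x = y.

Definition graph_connected G :=
  gnodes G !=set0 /\
  forall x y, gnodes G x -> gnodes G y -> exists w, walk G x w y.

(* Distinct edges and distinct nodes: loops are cycles of length 1, and pairs
   of parallel edges are cycles of length 2. *)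
Definition graph_cycle G w :=
  [/\ w != [::], uniq (map fst w), uniq (map (dart_from G) w)
    & exists x, walk G x w x].

Definition is_tree G :=
  [/\ is_graph G, graph_connected G & forall w, ~ graph_cycle G w].

Definition leaf G (x : T) :=
  gnodes G x /\ exists! d, gedges G d.1 /\ dart_from G d = x.

Definition subgraph H G :=
  [/\ is_graph H, gnodes H `<=` gnodes G, gedges H `<=` gedges G,
      gsrc H = gsrc G & gtgt H = gtgt G].

Definition minimal_subtree G (S : set T) H :=
  [/\ subgraph H G, is_tree H, S `<=` gnodes H
    & forall K, subgraph K G -> is_tree K -> S `<=` gnodes K -> subgraph H K].

Definition quotient_graph (f : T -> T) G : graph T U :=
  Graph (f @` gnodes G) (gedges G) (f \o gsrc G) (f \o gtgt G).

(* The boundary operator from 1-chains to 0-chains with rational coefficients,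
   acting on row vectors.  A graph has no 2-cells, so H_1 is its kernel.  Only
   meaningful for finite graphs. *)
Definition boundary_mx G :
    'M[rat]_(#|{: fset_set (gedges G)}|, #|{: fset_set (gnodes G)}|) :=
  \matrix_(i, j) ((gtgt G (val (enum_val i)) == val (enum_val j))%:R
                  - (gsrc G (val (enum_val i)) == val (enum_val j))%:R).

Definition betti1 G : nat := \rank (kermx (boundary_mx G)).

Definition incident G (n : T) (e : U) := n = gsrc G e \/ n = gtgt G e.

(* Points of the complement of [K] in the realisation of [G]: the nodes and
   the open edges of [G] that are not in [K]. *)
Definition in_complement G K (c : T + U) : Prop :=
  match c with
  | inl n => gnodes G n /\ ~ gnodes K n
  | inr e => gedges G e /\ ~ gedges K e
  end.

Definition complement_adj G K (a b : T + U) : Prop :=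
  [/\ in_complement G K a, in_complement G K b
    & match a, b with
      | inl n, inr e | inr e, inl n => incident G n e
      | _, _ => False
      end].

Definition complement_component G K (c : T + U) : set (T + U) :=
  [set d | clos_refl_trans (T + U)%type (complement_adj G K) c d].

(* [C] is a connected component of the complement of [K] in [G], together with
   the nodes of [K] at which it is attached. *)
Definition outside_component G K C :=
  exists2 c, in_complement G K c &
    C = Graph
      [set n | complement_component G K c (inl n) \/
               gnodes K n /\ exists2 e, complement_component G K c (inr e)
                                      & incident G n e]
      [set e | complement_component G K c (inr e)]
      (gsrc G) (gtgt G).

End Graphs.

Section Plane.
Variable R : realType.
Implicit Types (x y z v : R * R) (m n : int * int) (Om : set (R * R)).

Definition dot (p x : R * R) : R := p.1 * x.1 + p.2 * x.2.
Definition vecz (m : int * int) : R * R := (m.1%:~R, m.2%:~R).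
Definition cross (u v : R * R) : R := u.1 * v.2 - u.2 * v.1.

Definition primitive (n : int * int) : bool := coprimez n.1 n.2.

Definition open_segment x y : set (R * R) :=
  [set z | exists2 t : R, 0 < t < 1 &
    z = ((1 - t) * x.1 + t * y.1, (1 - t) * x.2 + t * y.2)].

Definition closed_segment x y : set (R * R) :=
  open_segment x y `|` [set x; y].

Definition midpoint x y : R * R := ((x.1 + y.1) / 2, (x.2 + y.2) / 2).

Definition lex_lt x y := x.1 < y.1 \/ x.1 = y.1 /\ x.2 < y.2.

(* Three pairwise distinct directions are met in this order when turning
   counterclockwise iff at least two of the three consecutive angles lie
   in (0, pi). *)
Definition ccw (u v w : R * R) : Prop :=
  [\/ 0 < cross u v /\ 0 < cross v w,
      0 < cross v w /\ 0 < cross w u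
    | 0 < cross w u /\ 0 < cross u v].

Definition rational_polygon Om :=
  [/\ compact Om, Om° !=set0 &
    exists2 s : seq ((int * int) * R),
      all (fun h => primitive h.1) s &
      Om = [set x | forall h, h \in s -> 0 <= dot (vecz h.1) x + h.2]].

Definition bd Om : set (R * R) := Om `\` Om°.

Definition polygon_side Om (S : set (R * R)) :=
  exists (n : int * int) (a : R),
    [/\ primitive n,
        forall x, Om x -> 0 <= dot (vecz n) x + a,
        S = [set x | Om x /\ dot (vecz n) x + a = 0]
      & exists x y, [/\ S x, S y & x <> y]].

Definition polygon_vertex Om x :=
  Om x /\ forall y z, Om y -> Om z -> y <> z -> ~ open_segment y z x.

Implicit Types F G : R * R -> R.

(* Near [x], F is the minimum of the functions [c m + <m, _>], m in A. *)
Definition local_min_form F x (A : set (int * int)) (c : int * int -> R) :=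
  finite_set A /\
  \forall y \near x,
    (forall m, A m -> F y <= c m + dot (vecz m) y) /\
    (exists2 m, A m & F y = c m + dot (vecz m) y).

(* Functions on Omega are represented by functions on the plane whose values
   outside Omega are irrelevant. *)
Definition tropical_series Om F :=
  [/\ {within Om, continuous F},
      forall x, Om x -> 0 <= F x,
      forall x, bd Om x -> F x = 0
    & forall x, Om° x -> exists A c, local_min_form F x A c].

Definition corner_locus Om F : set (R * R) :=
  [set x | Om° x /\ exists A c, local_min_form F x A c /\
    exists m m', [/\ A m, A m', m <> m', F x = c m + dot (vecz m) x
                                     & F x = c m' + dot (vecz m') x]].

Definition relaxation Om (P : set (R * R)) : R * R -> R :=
  fun x => inf [set y | exists G,
    [/\ tropical_series Om G, P `<=` corner_locus Om G & y = G x]].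

Definition affine_region Om F (W : set (R * R)) :=
  [/\ open W, connected W, W !=set0, W `<=` Om°
    & exists (p : R * R) (c : R), forall x, W x -> F x = c + dot p x].

(* [W] is the open region of a linearity cell; the cell is [closure W]. *)
Definition cell_region Om F (W : set (R * R)) :=
  affine_region Om F W /\
  forall W', affine_region Om F W' -> W `<=` W' -> W' = W.

Definition cell_gradient F (W : set (R * R)) (m : int * int) :=
  exists c : R, forall x, W x -> F x = c + dot (vecz m) x.

Definition superdifferential Om F v : set (R * R) :=
  [set p | forall y, Om y -> F y <= F v + dot p (y - v)].

Definition two_dimensional (A : set (R * R)) :=
  exists p q r, [/\ A p, A q, A r & cross (q - p) (r - p) != 0].

Definition graph_vertex Om F : set (R * R) :=
  [set v | Om° v /\ two_dimensional (superdifferential Om F v)].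

(* The open segments into which the points of [S] divide the corner locus,
   each listed once, as the lexicographically ordered pair of its endpoints. *)
Definition segments_cut_by Om F (S : set (R * R)) : set ((R * R) * (R * R)) :=
  [set e | [/\ lex_lt e.1 e.2,
               open_segment e.1 e.2 `<=` corner_locus Om F `\` S,
               (S `|` bd Om) e.1 & (S `|` bd Om) e.2]].

Definition graph_edge Om F := segments_cut_by Om F (graph_vertex Om F).

Definition edge_weight Om F (e : (R * R) * (R * R)) (w : nat) :=
  exists W0 W1 m0 m1 n,
    [/\ cell_region Om F W0 /\ cell_gradient F W0 m0,
        cell_region Om F W1 /\ cell_gradient F W1 m1,
        W0 <> W1,
        open_segment e.1 e.2 `<=` closure W0 `&` closure W1
      & [/\ (0 < w)%N, primitive n & m1 - m0 = n *+ w]].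

(* Meaningful only when [v] is an endpoint of [e]. *)
Definition edge_direction v (e : (R * R) * (R * R)) : R * R :=
  (if e.1 == v then e.2 else e.1) - v.

Definition edge_midpoint (e : (R * R) * (R * R)) := midpoint e.1 e.2.

Definition edge_in_cell (e : (R * R) * (R * R)) (W : set (R * R)) :=
  closed_segment e.1 e.2 `<=` closure W.

Definition vertex_in_edge v (e : (R * R) * (R * R)) := v = e.1 \/ v = e.2.

(* An isomorphism of gradient-labelled marked types acts on cells, edges and
   vertices by [f2], [f1], [f0]. *)
Record marked_type_iso Om N F (P : 'I_N -> R * R) F' (P' : 'I_N -> R * R)
    (f2 : set (R * R) -> set (R * R))
    (f1 : (R * R) * (R * R) -> (R * R) * (R * R)) (f0 : R * R -> R * R) : Prop :=
  MarkedTypeIso {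
  iso_cells : set_bij (cell_region Om F) (cell_region Om F') f2;
  iso_edges : set_bij (graph_edge Om F) (graph_edge Om F') f1;
  iso_vertices : set_bij (graph_vertex Om F) (graph_vertex Om F') f0;
  iso_edge_cell : forall e W, graph_edge Om F e -> cell_region Om F W ->
    edge_in_cell e W <-> edge_in_cell (f1 e) (f2 W);
  iso_vertex_cell : forall v W, graph_vertex Om F v -> cell_region Om F W ->
    closure W v <-> closure (f2 W) (f0 v);
  iso_vertex_edge : forall v e, graph_vertex Om F v -> graph_edge Om F e ->
    vertex_in_edge v e <-> vertex_in_edge (f0 v) (f1 e);
  iso_vertex_order : forall v e1 e2 e3, graph_vertex Om F v ->
    (forall e, e \in [:: e1; e2; e3] ->
       graph_edge Om F e /\ vertex_in_edge v e) ->
    uniq [:: e1; e2; e3] ->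
    ccw (edge_direction v e1) (edge_direction v e2) (edge_direction v e3) <->
    ccw (edge_direction (f0 v) (f1 e1)) (edge_direction (f0 v) (f1 e2))
        (edge_direction (f0 v) (f1 e3));
  (* Cells are convex, so the cyclic order of the edges along the boundary of a
     cell is the orientation of points chosen on these edges. *)
  iso_cell_order : forall W e1 e2 e3, cell_region Om F W ->
    (forall e, e \in [:: e1; e2; e3] -> graph_edge Om F e /\ edge_in_cell e W) ->
    uniq [:: e1; e2; e3] ->
    0 < cross (edge_midpoint e2 - edge_midpoint e1)
              (edge_midpoint e3 - edge_midpoint e1) <->
    0 < cross (edge_midpoint (f1 e2) - edge_midpoint (f1 e1))
              (edge_midpoint (f1 e3) - edge_midpoint (f1 e1));
  iso_gradient : forall W m, cell_region Om F W ->
    cell_gradient F W m <-> cell_gradient F' (f2 W) m;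
  iso_weight : forall e w, graph_edge Om F e ->
    edge_weight Om F e w <-> edge_weight Om F' (f1 e) w;
  (* Vertices of the graph are interior points, so only cells and edges meet
     the sides and vertices of Omega. *)
  iso_cell_side : forall W S, cell_region Om F W -> polygon_side Om S ->
    (closure W `&` S !=set0) <-> (closure (f2 W) `&` S !=set0);
  iso_cell_corner : forall W x, cell_region Om F W -> polygon_vertex Om x ->
    closure W x <-> closure (f2 W) x;
  iso_edge_side : forall e S, graph_edge Om F e -> polygon_side Om S ->
    (closed_segment e.1 e.2 `&` S !=set0) <->
    (closed_segment (f1 e).1 (f1 e).2 `&` S !=set0);
  iso_edge_corner : forall e x, graph_edge Om F e -> polygon_vertex Om x ->
    closed_segment e.1 e.2 x <-> closed_segment (f1 e).1 (f1 e).2 x;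
  iso_mark_cell : forall i W, cell_region Om F W -> W (P i) <-> f2 W (P' i);
  iso_mark_edge : forall i e, graph_edge Om F e ->
    open_segment e.1 e.2 (P i) <-> open_segment (f1 e).1 (f1 e).2 (P' i);
  iso_mark_vertex : forall i v, graph_vertex Om F v -> v = P i <-> f0 v = P' i }.

Definition relaxation_at Om N (P : 'I_N -> R * R) := relaxation Om (range P).

Definition same_marked_type Om N (P P' : 'I_N -> R * R) :=
  exists f2 f1 f0,
    marked_type_iso Om (relaxation_at Om P) P (relaxation_at Om P') P' f2 f1 f0.

Definition strongly_generic Om N (P : 'I_N -> R * R) :=
  let E := graph_edge Om (relaxation_at Om P) in
  [/\ forall i, exists2 e, E e & open_segment e.1 e.2 (P i),
      forall i j e, E e -> open_segment e.1 e.2 (P i) ->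
        open_segment e.1 e.2 (P j) -> i = j
    & exists2 eps : R, 0 < eps & forall P' : 'I_N -> R * R,
        (forall i, ball (P i) eps (P' i)) -> same_marked_type Om P P'].

(* Nodes are points of Omega with a tag: [(v, None)] is a vertex v, and
   [(x, Some e)] is the end at x of the piece e.  A marked point thus has one
   node for each of the pieces that it bounds, and edges that end at the same
   boundary point of Omega have distinct boundary nodes. *)
Definition node_type : choiceType :=
  ((R * R) * option ((R * R) * (R * R)))%type.
Definition piece_type : choiceType := ((R * R) * (R * R))%type.

Definition cut_node Om F x (e : piece_type) : node_type :=
  if `[< graph_vertex Om F x >] then (x, None) else (x, Some e).

Definition pieces Om F (P : set (R * R)) : set piece_type :=
  segments_cut_by Om F (graph_vertex Om F `|` P).

Definition cut_graph Om F (P : set (R * R)) : graph node_type piece_type :=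
  Graph
    [set nd : node_type |
       (exists2 v, graph_vertex Om F v & nd = (v, None)) \/
       (exists2 e, pieces Om F P e & exists x,
          [/\ x = e.1 \/ x = e.2, (P `|` bd Om) x & nd = (x, Some e)])]
    (pieces Om F P)
    (fun e => cut_node Om F e.1 e)
    (fun e => cut_node Om F e.2 e).

Definition marked_ends Om F (P : set (R * R)) : set node_type :=
  [set nd | gnodes (cut_graph Om F P) nd /\ P nd.1].

Definition glue_ends (P : set (R * R)) (nd : node_type) : node_type :=
  if `[< P nd.1 >] then (nd.1, None) else nd.

(* The image in Omega of a graph whose edges are pieces. *)
Definition realization (G : graph node_type piece_type) : set (R * R) :=
  [set x | (exists2 nd, gnodes G nd & x = nd.1) \/
           (exists2 e, gedges G e & open_segment e.1 e.2 x)].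

Definition compactly_contained (A B : set (R * R)) :=
  compact (closure A) /\ closure A `<=` B.

End Plane.

(* Main.v *)
Require Import Defs.
From Stdlib Require Import Relations.Relation_Operators Relations.Operators_Properties.
From mathcomp Require Import all_boot all_order all_algebra finmap.
From mathcomp Require Import lra ring zify.
From mathcomp Require Import all_classical all_reals topology normedtype derive.

(** The relaxation [F] of [P] is the minimum of finitely many affine functions
    with integral gradients. A series is concave: the gradients active at a point
    are supergradients on all of the polygon ([series_supergrad]). A sum of
    truncations of the distances to the sides is a series with corners at all the
    marks ([barrier]), and below it every gradient of a series is confined to a
    finite set ([slope_box]); by the pigeonhole principle the infimum [F] has
    supergradients in this set at every point, and two of them at every mark
    ([relaxation_poly]).

    The corner locus of such a minimum is cut by its vertices and by the marks
    into open segments, the pieces, each with one linearity cell on either side.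
    An oriented piece is called a dart. At a vertex, every cell is to the left of
    exactly one outgoing dart and to the right of exactly one ([star_ex],
    [star_uniq]); at a mark there are two opposite darts ([mark_darts]).

    The cut graph is acyclic because [F] is minimal. The winding number of a
    cycle of the cut graph is constant on every cell, zero at the boundary, and
    the same on the two sides of each mark, since the cycle avoids the marks.
    Subtracting a small constant from the affine functions of all the cells where
    it is nonzero gives a smaller series that still has corners at the marks, so
    there are no such cells ([no_lowering]); but the winding number jumps across
    the edges of the cycle ([winding_jump], [closed_walk_nil]).

    The cut graph is connected because the marks can be moved independently. Let
    [g] be a function on gradients that vanishes for the cells at the boundary,
    and let a dart carry the difference of [g] on its left and on its right. The
    flow out of a union of components of the cut graph cancels along the edges and
    at the vertices, which leaves a linear relation between the jumps of [g] at
    the marks ([marks_flow]). Moving a single mark, across its edge, does not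
    change the combinatorial type; taking for [g] the change of the constants of
    the affine functions, one obtains a jump at this mark alone
    ([marks_independent]). So the relation is trivial, which means that a component
    contains both or none of the two ends at each mark. From every cut point but
    the highest one some dart climbs ([increasing_dart]), so that every component
    reaches the highest cut point, and there is only one ([component_top]).

    The other statements hold for every finite tree with leaves glued in pairs.
    The hull of the glued leaves consists of the bridges that separate two of them
    ([steiner_minimal]); a boundary end is a leaf that is not glued, hence not in
    the hull. An edge outside the hull is still a bridge after the gluing, so no
    cycle crosses it ([cycle_in_core]). A tree has one node more than edges, and
    the gluing removes [N] of the nodes, whence the Betti number ([core_betti]). A
    component outside the hull has one gate to it ([outside_component_tree]). *)

Set Implicit Arguments.
Unset Strict Implicit.
Unset Printing Implicit Defensive.

Import Order.TTheory GRing.Theory Num.Theory.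
Import numFieldNormedType.Exports.

Local Open Scope classical_set_scope.
Local Open Scope ring_scope.

(** * Walks, bridges and hulls in graphs *)

Section GraphTheory.
Variables T U : choiceType.
Implicit Types (S : set T) (G H K : graph T U) (d : U * bool) (w : seq (U * bool)).

Definition reach G x y := exists w, walk G x w y.

Definition flip d : U * bool := (d.1, ~~ d.2).

Lemma dart_from_flip G d : dart_from G (flip d) = dart_to G d.
Proof. by case: d => e []. Qed.

Lemma dart_to_flip G d : dart_to G (flip d) = dart_from G d.
Proof. by case: d => e []. Qed.

Lemma walk_cat G x w1 w2 y :
  walk G x (w1 ++ w2) y <-> exists2 z, walk G x w1 z & walk G z w2 y.
Proof.
elim: w1 x => [|d w1 IH] x /=.
  by split=> [h|[z -> //]]; exists x.
split=> [[h1 h2 /IH[z h3 h4]]|[z [h1 h2 h3] h4]]; first by exists z.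
by split=> //; apply/IH; exists z.
Qed.

Lemma reach_refl G x : reach G x x.
Proof. by exists [::]. Qed.

Lemma reach_trans G x y z : reach G x y -> reach G y z -> reach G x z.
Proof. by move=> [w hw] [w' hw']; exists (w ++ w'); apply/walk_cat; exists y. Qed.

Lemma reach_dart G d : gedges G d.1 -> reach G (dart_from G d) (dart_to G d).
Proof. by move=> hd; exists [:: d]. Qed.

Lemma reach_edge G e : gedges G e -> reach G (gsrc G e) (gtgt G e).
Proof. exact: (@reach_dart G (e, true)). Qed.

Lemma reach_sym G x y : reach G x y -> reach G y x.
Proof.
move=> [w]; elim: w x => [|d w IH] x /=; first by move=> ->; apply: reach_refl.
move=> [hd <- /IH hw]; apply: (reach_trans hw).
by rewrite -(dart_from_flip G d) -(dart_to_flip G d); apply: reach_dart.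
Qed.

Lemma walk_edges G x w y d : walk G x w y -> d \in w -> gedges G d.1.
Proof.
elim: w x => [|d' w IH] x //= [h1 _ h3]; rewrite inE => /orP[/eqP -> //|].
exact: IH h3.
Qed.

Lemma walk_sub G K x w y :
  gsrc K = gsrc G -> gtgt K = gtgt G ->
  (forall d, d \in w -> gedges K d.1) -> walk G x w y -> walk K x w y.
Proof.
move=> hs ht; elim: w x => [|d w IH] x //= hK [_ <- h3].
have eqf d' : dart_from K d' = dart_from G d' by rewrite /dart_from hs ht.
have eqt d' : dart_to K d' = dart_to G d' by rewrite /dart_to hs ht.
split=> //; first by apply: hK; rewrite inE eqxx.
by rewrite eqt; apply: IH h3 => d' hd'; apply: hK; rewrite inE hd' orbT.
Qed.

Lemma walk_subgraph H G x w y : subgraph H G -> walk H x w y -> walk G x w y.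
Proof.
move=> [_ _ he hs ht] hw; apply: (walk_sub _ _ _ hw) => // d hd.
exact/he/(walk_edges hw).
Qed.

Lemma reach_visits G x w y d : walk G x w y -> d \in w ->
  reach G x (dart_from G d) /\ reach G x (dart_to G d).
Proof.
elim: w x => [|d' w IH] x //= [h1 h2 h3].
have hx : reach G x (dart_to G d') by rewrite -h2; apply: reach_dart.
rewrite inE => /orP[/eqP ->|hd].
  by split=> //; rewrite h2; apply: reach_refl.
by have [h4 h5] := IH _ h3 hd; split; apply: reach_trans hx _.
Qed.

Lemma walk_telescope G (V : zmodType) (psi : T -> V) x w y :
  walk G x w y -> \sum_(d <- w) (psi (dart_to G d) - psi (dart_from G d)) = psi y - psi x.
Proof.
elim: w x => [|d w IH] x /=; first by move=> ->; rewrite big_nil subrr.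
by move=> [_ <- /IH h]; rewrite big_cons h addrC addrA subrK.
Qed.

Lemma walk_pred G x w y d : walk G x w y -> d \in w ->
  dart_from G d = x \/ exists2 d', d' \in w & dart_to G d' = dart_from G d.
Proof.
elim: w x => [//|d1 w IH] x /= [h1 h2 h3]; rewrite inE => /orP[/eqP ->|hd]; first by left.
right; have [e|[d' hd' e]] := IH _ h3 hd; first by exists d1; rewrite ?mem_head.
by exists d' => //; rewrite inE hd' orbT.
Qed.

Lemma walk_last G x w y : walk G x w y -> w != [::] ->
  exists2 d, d \in w & dart_to G d = y.
Proof.
elim: w x => [//|d1 w IH] x /= [h1 h2 h3] _; have [e|ne] := eqVneq w [::].
  by exists d1; [rewrite mem_head|move: h3; rewrite e].
by have [d hd e] := IH _ h3 ne; exists d => //; rewrite inE hd orbT.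
Qed.

Lemma closed_pred G x w d : walk G x w x -> d \in w ->
  exists2 d', d' \in w & dart_to G d' = dart_from G d.
Proof.
move=> hw hd; have [->|//] := walk_pred hw hd; apply: walk_last hw _.
by apply: contraTneq hd => ->.
Qed.

Lemma walk_succ G x w y d : walk G x w y -> d \in w ->
  dart_to G d = y \/ exists2 d', d' \in w & dart_from G d' = dart_to G d.
Proof.
elim: w x => [//|d1 w IH] x /= [h1 h2 h3]; rewrite inE => /orP[/eqP ->|hd].
  case: w h3 {IH} => [|d2 w] /=; first by left.
  by move=> [_ e _]; right; exists d2 => //; rewrite !inE eqxx orbT.
have [e|[d' hd' e]] := IH _ h3 hd; [by left|right].
by exists d' => //; rewrite inE hd' orbT.
Qed.

Lemma closed_succ G x w d : walk G x w x -> d \in w ->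
  exists2 d', d' \in w & dart_from G d' = dart_to G d.
Proof.
move=> hw hd; have [->|//] := walk_succ hw hd.
by case: w hw hd => [//|d1 w] /= [_ e _] _; exists d1; rewrite ?mem_head.
Qed.

Lemma simple_walk G x y : reach G x y ->
  exists2 w, walk G x w y & uniq (rcons (map (dart_from G) w) y).
Proof.
move=> [w]; elim: w x => [|d w IH] x /=; first by move=> <-; exists [::].
move=> [hd hx /IH[w' hw' uw']].
have [hin|hnin] := boolP (x \in rcons (map (dart_from G) w') y); last first.
  by exists (d :: w') => //=; rewrite hx hnin.
have [exy|xy] := eqVneq x y; first by rewrite exy; exists [::].
move: hin; rewrite mem_rcons inE (negbTE xy) /= => /mapP[d' hd' ex].
have [w1 [w2 ew]] : exists w1 w2, w' = w1 ++ d' :: w2.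
  by case/splitPr: hd' => w1 w2; exists w1, w2.
move: hw' uw'; rewrite ew => /walk_cat[z _ hz].
rewrite map_cat rcons_cat cat_uniq => /and3P[_ _ u2].
exists (d' :: w2) => //.
by move: hz => /= [h1 h2 h3]; split.
Qed.

Lemma walk_to_mem G x w y d : walk G x w y -> d \in w ->
  dart_to G d \in rcons (map (dart_from G) w) y.
Proof.
elim: w x => [|d' w IH] x //= [h1 h2 h3].
rewrite inE => /orP[/eqP ->|hd]; last by rewrite inE (IH _ h3 hd) orbT.
rewrite inE; apply/orP; right.
by case: w h3 {IH} => [|d2 w] /=; [move=> ->; rewrite inE|case=> _ -> _; rewrite inE eqxx].
Qed.

Lemma simple_walk_edges G x w y :
  walk G x w y -> uniq (rcons (map (dart_from G) w) y) -> uniq (map fst w).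
Proof.
elim: w x => [|d w IH] x //= [h1 h2 h3] /andP[hn hu].
rewrite (IH _ h3 hu) andbT; apply/negP => /mapP[d' hd' ed].
have hto := walk_to_mem h3 hd'.
have hfr : dart_from G d' \in rcons (map (dart_from G) w) y.
  by rewrite mem_rcons inE; apply/orP; right; apply: map_f.
move/negP: hn; apply; move: hto hfr; rewrite /dart_to /dart_from ed.
by case: (d.2); case: (d'.2).
Qed.

(** A two-colouring that changes exactly across [e] counts the passages of a
    walk through [e] modulo 2; this is how bridges are exploited below. *)
Lemma walk_parity G (s : T -> bool) e x w y :
  (forall d, gedges G d.1 -> s (dart_from G d) (+) s (dart_to G d) = (d.1 == e)) ->
  walk G x w y -> s x (+) s y = odd (count_mem e (map fst w)).
Proof.
move=> hs; elim: w x => [|d w IH] x /=; first by move=> ->; rewrite addbb.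
move=> [h1 h2 /IH h3]; rewrite oddD -h3 oddb -(hs d h1) h2.
by case: (s x); case: (s y); case: (s (dart_to G d)).
Qed.

Lemma uniq_walk_parity G (s : T -> bool) e x w y :
  (forall d, gedges G d.1 -> s (dart_from G d) (+) s (dart_to G d) = (d.1 == e)) ->
  walk G x w y -> uniq (map fst w) -> s x (+) s y = (e \in map fst w).
Proof. by move=> hs hw hu; rewrite (walk_parity hs hw) count_uniq_mem // oddb. Qed.

Definition del_edge G e := Graph (gnodes G) (gedges G `\ e) (gsrc G) (gtgt G).

Definition acyclic G := forall w, ~ graph_cycle G w.

(** A simple walk avoiding [e] between the ends of [e] would close up to a cycle. *)
Lemma acyclic_bridge G e : acyclic G -> gedges G e ->
  ~ reach (del_edge G e) (gsrc G e) (gtgt G e).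
Proof.
move=> aG he /simple_walk[w hw uw].
have hw' : walk G (gsrc G e) w (gtgt G e).
  by apply: (walk_sub _ _ _ hw) => // d hd; have [] := walk_edges hw hd.
apply: (aG ((e, false) :: w)); split=> //=.
- rewrite (simple_walk_edges hw uw) andbT; apply/negP => /mapP[d hd ed].
  by have [_] := walk_edges hw hd; apply.
- by move: uw; rewrite rcons_uniq.
- by exists (gtgt G e).
Qed.

Definition bridge_side G e x : bool := `[< reach (del_edge G e) (gsrc G e) x >].

Lemma bridge_sideP G e d : acyclic G -> gedges G e -> gedges G d.1 ->
  bridge_side G e (dart_from G d) (+) bridge_side G e (dart_to G d) = (d.1 == e).
Proof.
move=> aG he; have hsrc : bridge_side G e (gsrc G e).
  by apply/asboolP; apply: reach_refl.
have htgt : bridge_side G e (gtgt G e) = false.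
  by apply/asboolPn; apply: acyclic_bridge.
have [ed _|ne hd] := eqVneq d.1 e.
  by move: d ed => [e' b] /= ->; case: b; rewrite /dart_from /dart_to /= hsrc htgt.
have hst : reach (del_edge G e) (dart_from G d) (dart_to G d).
  by apply: (@reach_dart (del_edge G e)); split=> //=; apply/eqP.
apply/eqP; rewrite eqbF_neg negb_add; apply/eqP; apply/asboolP/asboolP => h.
  exact: reach_trans h hst.
exact: reach_trans h (reach_sym hst).
Qed.

(** The union of the paths joining nodes of [S]: an edge lies on one of them
    iff it separates two nodes of [S]. *)
Definition steiner_edge G (S : set T) e :=
  gedges G e /\ exists s s', [/\ S s, S s' & bridge_side G e s != bridge_side G e s'].

Definition steiner G (S : set T) : graph T U :=
  Graph [set x | S x \/ exists2 e, steiner_edge G S e & incident G x e]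
        (steiner_edge G S) (gsrc G) (gtgt G).

(** A walk between nodes on different sides of a bridge crosses it an odd number
    of times. *)
Lemma separating_edge_mem G e s s' w : acyclic G -> gedges G e ->
  bridge_side G e s != bridge_side G e s' -> walk G s w s' -> e \in map fst w.
Proof.
move=> aG he hss hw.
have := walk_parity (fun d => @bridge_sideP G e d aG he) hw.
rewrite (_ : _ (+) _ = true); last by case: bridge_side hss; case: bridge_side.
by move/esym/odd_gt0; rewrite -has_count has_pred1.
Qed.

Lemma steiner_walk G S s s' : acyclic G -> graph_connected G ->
  S `<=` gnodes G -> S s -> S s' ->
  exists2 w, walk (steiner G S) s w s' & forall e, steiner_edge G S e ->
    bridge_side G e s != bridge_side G e s' -> e \in map fst w.
Proof.
move=> aG [_ cG] SG hs hs'.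
have [w hw uw] := simple_walk (cG _ _ (SG _ hs) (SG _ hs')).
have ue := simple_walk_edges hw uw.
exists w; last by move=> e [he _] hss; apply: separating_edge_mem hw.
apply: (walk_sub _ _ _ hw) => // d hd; have hdG := walk_edges hw hd.
split=> //; exists s, s'; split=> //.
have := uniq_walk_parity (fun d' => @bridge_sideP G d.1 d' aG hdG) hw ue.
by rewrite map_f // => h; apply/eqP => e; move: h; rewrite e addbb.
Qed.

Lemma subgraph_acyclic H G : subgraph H G -> acyclic G -> acyclic H.
Proof.
move=> sHG aG w [h1 h2 h3 [x h4]]; apply: (aG w); split=> //.
  suff -> : dart_from G = dart_from H by [].
  by case: sHG => _ _ _; rewrite /dart_from => -> ->.
by exists x; apply: walk_subgraph h4.
Qed.

Lemma steiner_subgraph G S : is_graph G -> S `<=` gnodes G ->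
  subgraph (steiner G S) G.
Proof.
move=> gG SG; split=> //; last by move=> e [].
  by move=> e he; split; right; exists e => //; [left|right].
by move=> x [/SG //|[e [he _] [] ->]]; have [] := gG e he.
Qed.

Lemma steiner_connected G S : is_tree G -> S `<=` gnodes G -> S !=set0 ->
  graph_connected (steiner G S).
Proof.
move=> [gG cG aG] SG [s0 hs0].
suff hr x : gnodes (steiner G S) x -> reach (steiner G S) s0 x.
  split; first by exists s0; left.
  by move=> x y /hr hx /hr hy; apply: reach_trans hy; apply: reach_sym.
have hS s : S s -> reach (steiner G S) s0 s.
  by move=> hs; have [w hw _] := steiner_walk aG cG SG hs0 hs; exists w.
move=> [/hS //|[e he hx]].
have [_ [s [s' [hs hs' hss]]]] := he.
have [w hw hm] := steiner_walk aG cG SG hs hs'.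
have /mapP[d hd ed] := hm _ he hss.
have [r1 r2] := reach_visits hw hd.
have := reach_trans (hS _ hs) r1; have := reach_trans (hS _ hs) r2.
by case: hx => ->; rewrite /dart_from /dart_to ed /=; case: (d.2).
Qed.

Lemma steiner_tree G S : is_tree G -> S `<=` gnodes G -> S !=set0 ->
  is_tree (steiner G S).
Proof.
move=> tG SG S0; have [gG cG aG] := tG.
have sH := steiner_subgraph gG SG; split; first by case: sH.
  exact: steiner_connected.
exact: subgraph_acyclic sH aG.
Qed.

(** A connected subgraph containing [S] has a walk between any two nodes of [S],
    and this walk passes through every bridge that separates them. *)
Lemma steiner_minimal G S : is_tree G -> S `<=` gnodes G -> S !=set0 ->
  minimal_subtree G S (steiner G S).
Proof.
move=> tG SG S0; have [gG cG aG] := tG.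
have sH := steiner_subgraph gG SG.
split=> //; [exact: steiner_tree|by move=> s hs; left|].
move=> K sK [gK [_ cK] aK] SK.
have eK e : steiner_edge G S e -> gedges K e.
  move=> [he [s [s' [hs hs' hss]]]].
  have [w hw] := cK _ _ (SK _ hs) (SK _ hs').
  have /mapP[d hd ->] := separating_edge_mem aG he hss (walk_subgraph sK hw).
  exact: walk_edges hw hd.
have [_ _ _ sE tE] := sK.
split=> //; first by case: sH.
move=> x [/SK //|[e /eK /gK[h1 h2]]].
by rewrite /incident -sE -tE => -[] ->.
Qed.

End GraphTheory.

(** * The first Betti number *)

Section BettiNumber.
Variables T U : choiceType.
Implicit Types G : graph T U.

Let nd G (j : 'I_#|{: fset_set (gnodes G)}|) : T := val (enum_val j).
Let ed G (i : 'I_#|{: fset_set (gedges G)}|) : U := val (enum_val i).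

Lemma nd_inj G : injective (@nd G).
Proof. by move=> i j /val_inj/enum_val_inj. Qed.

Lemma nd_surj G x : finite_set (gnodes G) -> gnodes G x -> exists j, x = @nd G j.
Proof.
move=> fG hx; have hx' : x \in fset_set (gnodes G) by rewrite in_fset_set // inE.
by exists (enum_rank [` hx']%fset); rewrite /nd enum_rankK.
Qed.

Lemma ed_edge G i : finite_set (gedges G) -> gedges G (@ed G i).
Proof.
by move=> fG; have := valP (enum_val i); rewrite in_fset_set // inE.
Qed.

Lemma sum_nd G (phi : T -> rat) x : finite_set (gnodes G) -> gnodes G x ->
  \sum_j (x == @nd G j)%:R * phi (@nd G j) = phi x.
Proof.
move=> fG /(nd_surj fG)[j ->]; rewrite (bigD1 j) //= eqxx mul1r big1 ?addr0 // => k nk.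
by rewrite (inj_eq (@nd_inj G)) eq_sym (negbTE nk) mul0r.
Qed.

Lemma boundary_col G (phi : T -> rat) i : finite_graph G ->
  (boundary_mx G *m \col_j phi (@nd G j)) i 0 =
  phi (gtgt G (@ed G i)) - phi (gsrc G (@ed G i)).
Proof.
move=> [gG fN fE]; have [hs ht] := gG _ (ed_edge i fE).
rewrite mxE -(sum_nd phi fN hs) -(sum_nd phi fN ht) -sumrB.
by apply: eq_bigr => j _; rewrite !mxE mulrBl.
Qed.

(** A row vector killed by the transposed boundary operator is a potential on the
    nodes with equal values at the two ends of every edge, hence constant. *)
Lemma rank_boundary_connected G : finite_graph G -> graph_connected G ->
  (\rank (boundary_mx G)).+1 = #|` fset_set (gnodes G)|.
Proof.
move=> fG [[x0 hx0] cG]; have [gG fN fE] := fG.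
set V := #|{: fset_set (gnodes G)}|.
pose one : 'rV[rat]_V := const_mx 1.
have eqk : (kermx (boundary_mx G)^T :=: one)%MS.
  apply/eqmxP/andP; split; last first.
    apply/sub_kermxP/rowP => i; rewrite !mxE.
    have := boundary_col (fun=> 1) i fG; rewrite subrr mxE => {2}<-.
    by apply: eq_bigr => j _; rewrite !mxE mulrC.
  apply/rV_subP => u /sub_kermxP hu.
  pose phi x : rat := \sum_j (x == @nd G j)%:R * u 0 j.
  have phi_nd j : phi (nd j) = u 0 j.
    rewrite /phi (bigD1 j) //= eqxx mul1r big1 ?addr0 // => k nk.
    by rewrite (inj_eq (@nd_inj G)) eq_sym (negbTE nk) mul0r.
  have phi_edge e : gedges G e -> phi (gsrc G e) = phi (gtgt G e).
    move=> he; have he' : e \in fset_set (gedges G) by rewrite in_fset_set // inE.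
    have /rowP/(_ (enum_rank [` he']%fset)) := hu.
    rewrite !mxE => h; apply/eqP; rewrite eq_sym -subr_eq0 /phi -sumrB.
    rewrite -[X in _ == X]h; apply/eqP/eq_bigr => j _.
    by rewrite !mxE enum_rankK /= mulrC mulrBr ![u 0 j * _]mulrC.
  have phi_reach x w y : walk G x w y -> phi x = phi y.
    elim: w x => [|d w IH] x /=; first by move=> ->.
    move=> [hd <- /IH <-]; have := phi_edge _ hd.
    by rewrite /dart_from /dart_to; case: (d.2).
  have -> : u = phi x0 *: one.
    apply/rowP => j; rewrite !mxE mulr1 -phi_nd.
    have hj : gnodes G (nd j) by have := valP (enum_val j); rewrite in_fset_set // inE.
    by have [w hw] := cG x0 (nd j) hx0 hj; apply/esym/(phi_reach _ w).
  exact: scalemx_sub.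
have [j0 _] := nd_surj fN hx0.
have one0 : one != 0.
  by apply/eqP => /rowP/(_ j0); rewrite !mxE => /eqP; rewrite oner_eq0.
have := mxrank_ker (boundary_mx G)^T; rewrite eqk rank_rV one0 mxrank_tr /=.
have := rank_leq_col (boundary_mx G) => h1 h2.
suff h : (\rank (boundary_mx G)).+1 = V by rewrite h /V cardfE.
by rewrite -[RHS](subnK h1) -h2 add1n.
Qed.

(** The indicator function of one side of a bridge has a coboundary supported on
    that bridge: paired with a 1-cycle, it extracts the coefficient of the bridge,
    which therefore vanishes. *)
Lemma rank_boundary_acyclic G : finite_graph G -> acyclic G ->
  \rank (boundary_mx G) = #|` fset_set (gedges G)|.
Proof.
move=> fG aG; have [gG fN fE] := fG.
suff : row_free (boundary_mx G) by move/eqP ->; rewrite cardfE.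
rewrite -kermx_eq0; apply/eqP/row_matrixP => k.
rewrite row0; have : row k (kermx (boundary_mx G)) *m boundary_mx G = 0.
  by apply/sub_kermxP; apply: row_sub.
move: (row k _) => z hz; apply/rowP => i; rewrite [RHS]mxE.
have hi := ed_edge i fE.
pose phi x : rat := (bridge_side G (ed i) x)%:R.
have /rowP/(_ 0) : z *m (boundary_mx G *m \col_j phi (@nd G j)) = 0.
  by rewrite mulmxA hz mul0mx.
rewrite !mxE (bigD1 i) //= boundary_col // big1 ?addr0 => [|i' ne].
  have := bridge_sideP aG hi (d := (ed i, true)) hi; rewrite /phi /= eqxx.
  case: bridge_side; case: bridge_side => //= _ /eqP.
    by rewrite sub0r mulrN mulr1 oppr_eq0 => /eqP.
  by rewrite subr0 mulr1 => /eqP.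
rewrite boundary_col //.
have := bridge_sideP aG hi (d := (ed i', true)) (ed_edge i' fE).
rewrite /phi /= (_ : (ed i' == ed i) = false); last first.
  by apply/negbTE; apply: contra ne => /eqP/val_inj/enum_val_inj ->.
by case: bridge_side; case: bridge_side => //= _; rewrite subrr mulr0.
Qed.

Lemma betti1_connected G : finite_graph G -> graph_connected G ->
  betti1 G = (#|` fset_set (gedges G)|.+1 - #|` fset_set (gnodes G)|)%N.
Proof.
move=> fG cG; rewrite /betti1 mxrank_ker -(rank_boundary_connected fG cG).
by rewrite subSS cardfE.
Qed.

Lemma tree_card G : finite_graph G -> is_tree G ->
  #|` fset_set (gnodes G)| = #|` fset_set (gedges G)|.+1.
Proof.
move=> fG [_ cG aG]; rewrite -(rank_boundary_connected fG cG).
by rewrite (rank_boundary_acyclic fG aG).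
Qed.

End BettiNumber.

(** * Gluing leaves of a tree *)

(** The map [f] glues a finite tree [G] along some of its leaves, the terminals
    in [S]; the core is the image of the hull [H] of the terminals. *)
Section Core.
Variables T U : choiceType.
Variables (G : graph T U) (S : set T) (f : T -> T).
Hypothesis tG : is_tree G.
Hypothesis SG : S `<=` gnodes G.
Hypothesis leafS : forall s, S s -> leaf G s.
Variables s0 s1 : T.
Hypotheses (hs0 : S s0) (hs1 : S s1) (s01 : s0 <> s1).
Hypothesis f_glue : forall x y, gnodes G x -> gnodes G y -> f x = f y ->
  x = y \/ S x /\ S y.

Let H := steiner G S.
Let core := quotient_graph f H.
Let Gam := quotient_graph f G.

Let gG : is_graph G. Proof. by case: tG. Qed.
Let aG : acyclic G. Proof. by case: tG. Qed.
Let sH : subgraph H G. Proof. exact: steiner_subgraph. Qed.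
Let HG x : gnodes H x -> gnodes G x. Proof. by case: sH => _ h _ _ _; apply: h. Qed.
Let cH : graph_connected H. Proof. by apply: steiner_connected => //; exists s0. Qed.
Let gH : is_graph H. Proof. by case: sH. Qed.

Let dartG d : gedges G d.1 -> gnodes G (dart_from G d) /\ gnodes G (dart_to G d).
Proof. by move=> /gG[]; rewrite /dart_from /dart_to; case: (d.2). Qed.

Let dartH d : gedges H d.1 -> gnodes H (dart_from G d) /\ gnodes H (dart_to G d).
Proof. by move=> /gH[]; rewrite /dart_from /dart_to /=; case: (d.2). Qed.

(** The hull joins [s] to another terminal, and can leave the leaf [s] only by its
    one edge. *)
Lemma edge_at_terminal s e : S s -> gedges G e -> incident G s e -> gedges H e.
Proof.
move=> hs he hi; have [_ [d0 [[hd0 ed0] ud0]]] := leafS hs.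
have [s' hs' ss'] : exists2 s', S s' & s <> s'.
  have [e0|ne] := eqVneq s s0; first by exists s1 => //; rewrite e0.
  by exists s0 => //; apply/eqP.
have hns t : S t -> gnodes H t by move=> ht; left.
have [_ /(_ s s' (hns _ hs) (hns _ hs'))[[//|d w] /= [hd ed _]]] := cH.
have ded : d0 = d by apply: ud0; split=> //; case: hd.
case: hi => es.
  by have := ud0 (e, true) (conj he (esym es)); rewrite ded => ede; move: hd; rewrite ede.
by have := ud0 (e, false) (conj he (esym es)); rewrite ded => ede; move: hd; rewrite ede.
Qed.

(** Being the leaf [x] is a colouring that changes exactly across the only edge
    at [x]; compared with the sides of that bridge, it shows that no two other
    nodes are separated by it. *)
Lemma leaf_outside_steiner x : leaf G x -> ~ S x -> ~ gnodes H x.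
Proof.
move=> [hx [d0 [[hd0 ed0] ud0]]] nSx [//|[e he hi]].
have [heG [s [s' [hs hs' hss]]]] := he.
have at_x d : gedges G d.1 -> dart_from G d = x -> d = d0 by move=> h1 h2; rewrite -(ud0 d).
have at_x' d : gedges G d.1 -> dart_to G d = x -> d = flip d0.
  move=> h1 h2; have := at_x (flip d) h1; rewrite dart_from_flip => /(_ h2) <-.
  by case: (d) => ? b; rewrite /flip /= negbK.
have ee : e = d0.1.
  by case: hi => ex; [rewrite -(at_x (e, true))|rewrite -(at_x (e, false))].
have to0 : (dart_to G d0 == x) = false.
  apply/negP => /eqP /(at_x' _ hd0) /(congr1 snd) /=.
  by case: (d0.2).
have col d : gedges G d.1 -> (dart_from G d == x) (+) (dart_to G d == x) = (d.1 == e).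
  move=> hd; rewrite ee; have [h1|/eqP h1] := eqVneq (dart_from G d) x.
    by rewrite (at_x d) // to0 eqxx.
  have [h2|/eqP h2] := eqVneq (dart_to G d) x; first by rewrite (at_x' d) // eqxx.
  apply/esym/eqP => e0; have [ed|ed] : d = d0 \/ d = flip d0.
  - by move: (d) (d0) e0 => [e1 []] [e2 []] /= ->; rewrite /flip; auto.
  - by apply: h1; rewrite ed.
  - by apply: h2; rewrite ed dart_to_flip.
have [w hw] := (let: conj _ cG := (let: And3 _ c _ := tG in c) in cG) _ _ (SG hs) (SG hs').
have ne t : S t -> (t == x) = false.
  by move=> ht; apply/negP => /eqP ex; apply: nSx; rewrite -ex.
have := walk_parity (s := fun y => y == x) col hw; rewrite !ne // addbb.
rewrite -(walk_parity (fun d => @bridge_sideP _ _ G e d aG heG) hw).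
by case: bridge_side hss; case: bridge_side.
Qed.

Let bs e x := bridge_side G e x.

(** A walk inside [H] does not meet the edge [e]. *)
Let bs_glue e x y : gedges G e -> ~ gedges H e -> gnodes H x -> gnodes H y -> bs e x = bs e y.
Proof.
move=> he nhe hx hy; have [_ /(_ _ _ hx hy)[w hw]] := cH.
have := walk_parity (fun d => @bridge_sideP _ _ G e d aG he) (walk_subgraph sH hw).
rewrite (_ : count_mem _ _ = 0)%N; first by rewrite /bs; do 2!case: bridge_side.
apply/eqP; rewrite -leqn0 leqNgt -has_count has_pred1; apply/negP => /mapP[d hd ed].
by apply: nhe; rewrite ed; apply: walk_edges hw hd.
Qed.

(** An edge outside the core is still a bridge after the gluing, since the
    glued nodes all lie on the same side of it; a cycle cannot cross a bridge
    exactly once. *)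
Lemma cycle_in_core w d : graph_cycle Gam w -> d \in w -> gedges core d.1.
Proof.
move=> [_ uw _ [n hw]] hd; have hdG : gedges G d.1 := walk_edges hw hd.
apply: contrapT => nhd.
pose sg n := `[< exists x, [/\ gnodes G x, f x = n & bs d.1 x] >].
have sgE x : gnodes G x -> sg (f x) = bs d.1 x.
  move=> hx; apply/asboolP/idP => [[y [hy efy hb]]|hb]; last by exists x.
  have [<- //|[hSy hSx]] := f_glue hy hx efy.
  by rewrite -(@bs_glue _ y x hdG nhd) //; left.
have col d' : gedges Gam d'.1 ->
    sg (dart_from Gam d') (+) sg (dart_to Gam d') = (d'.1 == d.1).
  move=> hd'; have [h1 h2] := dartG hd'.
  have -> : dart_from Gam d' = f (dart_from G d') by rewrite /dart_from; case: (d'.2).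
  have -> : dart_to Gam d' = f (dart_to G d') by rewrite /dart_to; case: (d'.2).
  by rewrite !sgE // /bs bridge_sideP.
have := uniq_walk_parity col hw uw; rewrite addbb map_f //.
Qed.

Let out := Graph (gnodes G) (gedges G `\` steiner_edge G S) (gsrc G) (gtgt G).

(** Two nodes of [H] joined outside [H] are also joined by a simple walk inside
    [H], and its first edge is a bridge that the outer walk does not cross. *)
Let gate_uniq a b : gnodes H a -> gnodes H b -> reach out a b -> a = b.
Proof.
move=> ha hb [w hw]; apply/eqP/negPn/negP => /eqP nab.
have [_ /(_ _ _ ha hb)/simple_walk[w' hw' uw']] := cH.
have ue := simple_walk_edges hw' uw'.
have hwG : walk G a w b.
  by apply: (walk_sub _ _ _ hw) => // d hd; have [] := walk_edges hw hd.
case: w' hw' uw' ue => [//|d w'] hw' uw' ue.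
have hd := walk_edges hw' (mem_head _ _); have [hdG _] := hd.
have col d' : gedges G d'.1 -> _ := @bridge_sideP _ _ G d.1 d' aG hdG.
have := uniq_walk_parity col (walk_subgraph sH hw') ue; rewrite map_f ?mem_head //.
rewrite (walk_parity col hwG) => /odd_gt0; rewrite -has_count has_pred1.
by move=> /mapP[d' hd' ed]; have [_] := walk_edges hw hd'; rewrite -ed; apply.
Qed.

(** Follow a walk to a terminal until it first enters [H]. *)
Let gate_ex x : gnodes G x -> exists2 a, gnodes H a & reach out x a.
Proof.
move=> hx; have [_ [_ cG] _] := tG.
have [w] := cG _ _ hx (SG hs0); elim: w x {hx} => [|d w IH] x /=.
  by move=> ->; exists s0; [left|apply: reach_refl].
move=> [hd <- /IH[a ha hr]].
have [hdH|hdH] := pselect (gedges H d.1).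
  by have [h1 _] := dartH hdH; exists (dart_from G d); last exact: reach_refl.
exists a => //; apply: reach_trans hr.
by apply: (@reach_dart _ _ out d).
Qed.

Section Outside.
Variable c : T + U.
Hypothesis hc : in_complement Gam core c.
Let comp := complement_component Gam core c.
Let C := Graph
      [set n | comp (inl n) \/
               gnodes core n /\ exists2 e, comp (inr e) & incident Gam n e]
      [set e | comp (inr e)] (gsrc Gam) (gtgt Gam).

Let coreH x : gnodes G x -> gnodes core (f x) -> gnodes H x.
Proof.
move=> hx [y hy eyx]; have [<- //|[_ hSx]] := f_glue (HG hy) hx eyx.
by left.
Qed.

Let comp_ind (Q : T + U -> Prop) : Q c ->
  (forall a b, comp a -> Q a -> complement_adj Gam core a b -> Q b) ->
  forall a, comp a -> Q a.
Proof.
move=> Qc QS a /clos_rt_rtn1_iff; elim=> [//|b d hbd hcb Qb].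
by apply: QS hbd => //; apply/clos_rt_rtn1_iff.
Qed.

Let comp_step a b : comp a -> complement_adj Gam core a b -> comp b.
Proof. by move=> h1 h2; apply: rt_trans h1 _; apply: rt_step. Qed.

Let comp_in a : comp a -> in_complement Gam core a.
Proof. by apply: comp_ind => // a' b _ _ []. Qed.

Let node_rep n : comp (inl n) -> exists x, [/\ n = f x, gnodes G x & ~ gnodes H x].
Proof.
move=> /comp_in[[x hx <-] nn]; exists x; split=> // hxH.
by apply: nn; exists x.
Qed.

Let f_out x y : gnodes G x -> gnodes G y -> ~ gnodes H x -> f x = f y -> x = y.
Proof. by move=> hx hy nx /(f_glue hx hy)[//|[hSx _]]; case: nx; left. Qed.

Let incG x e : gnodes G x -> gedges G e -> ~ gnodes H x -> incident Gam (f x) e ->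
  incident G x e.
Proof.
move=> hx he nx; have [h1 h2] := gG he.
by move=> [] /(f_out hx _ nx) ->; rewrite //; [left|right].
Qed.

Let comp_edge x e : gnodes G x -> ~ gnodes H x -> comp (inl (f x)) -> gedges G e ->
  incident G x e -> comp (inr e).
Proof.
move=> hx nx hcx he hi; apply: comp_step hcx _; split.
- by split; [exists x|move=> /(coreH hx)].
- split=> // heH; have [h1 h2] := gH heH.
  by apply: nx; case: hi => ->.
- by case: hi => ->; [left|right].
Qed.

Let edge_comp x e : gnodes G x -> ~ gnodes H x -> comp (inr e) -> incident G x e ->
  comp (inl (f x)).
Proof.
move=> hx nx hce hi; apply: (comp_step hce); split.
- exact: (comp_in hce).
- by split; [exists x|move=> /(coreH hx)].
- by case: hi => ->; [left|right].
Qed.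

Let inc_out x y e : gedges out e -> incident G x e -> incident G y e -> reach out x y.
Proof.
move=> he; have h := reach_edge he; rewrite /= in h.
by move=> [] -> [] ->; [exact: reach_refl|exact: h|exact: reach_sym|exact: reach_refl].
Qed.

Let edge_out e : comp (inr e) -> gedges out e.
Proof. by move=> /comp_in[]. Qed.

(** A component outside the core never passes through a node of the core, so the
    gate is the same for all its members. *)
Let has_gate : exists2 a, gnodes H a &
  forall d, comp d -> match d with
    | inl n => exists x, [/\ n = f x, gnodes G x & reach out x a]
    | inr e => reach out (gsrc G e) a end.
Proof.
have [a ha hca] : exists2 a, gnodes H a & match c with
    | inl n => exists x, [/\ n = f x, gnodes G x & reach out x a]
    | inr e => reach out (gsrc G e) a end.
  case: (c) hc => [n [[x hx <-] _]|e [he _]].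
    by have [a ha hr] := gate_ex hx; exists a => //; exists x.
  by have [h1 _] := gG he; apply: gate_ex.
exists a => //; apply: comp_ind => // d b hcd hd had.
have hb := comp_step hcd had; have [_ _] := had.
case: d hcd hd {had} => [n|e] hcd hd; case: b hb => [n'|e'] hb //= hi.
  have [x [en hx nx]] := node_rep hcd; move: hd => [y [en' hy hr]].
  have exy : x = y by apply: f_out; rewrite -?en.
  have heo := edge_out hb; have [heG _] := heo.
  have hi' : incident G y e' by apply: incG => //; rewrite -?exy // -en.
  by apply: (reach_trans _ hr); apply: (inc_out heo) => //; left.
have [x [en hx nx]] := node_rep hb; exists x; split=> //.
have heo := edge_out hcd; have [heG _] := heo.
rewrite en in hi; apply: reach_trans hd.
by apply: (inc_out heo); [apply: incG|left].
Qed.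

(** Following walks towards the gate [a0] keeps inside the component, which is
    therefore connected and attached at [f a0] only. It contains no cycle, since
    all cycles lie in the core, and its nodes other than [f a0] keep all their
    edges, so that its other leaves are leaves of [G]. *)
Lemma outside_component_tree : exists a0,
  [/\ gnodes core `&` gnodes C = [set f a0], is_tree C,
      forall n, gnodes C n -> exists x, [/\ n = f x, gnodes G x & ~ S x]
    & forall n, leaf C n -> n <> f a0 ->
        exists x, [/\ n = f x, leaf G x & ~ S x]].
Proof.
have [a0 ha0 gate] := has_gate.
have gate_node x : gnodes G x -> ~ gnodes H x -> comp (inl (f x)) -> reach out x a0.
  by move=> hx nx /gate[y [exy hy hr]]; rewrite (f_out hx hy nx exy).
have gate_edge x e : comp (inr e) -> gnodes H x -> incident G x e -> x = a0.
  move=> hce hx hi; apply: gate_uniq => //; apply: reach_trans (gate _ hce).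
  by apply: (inc_out (edge_out hce)) => //; left.
have isC : is_graph C.
  move=> e hce; have [heG _] := edge_out hce; have [h1 h2] := gG heG.
  have aux x : gnodes G x -> incident G x e -> gnodes C (f x).
    move=> hx hi; have [hxH|nx] := pselect (gnodes H x).
      right; split; first by exists x.
      by exists e => //; case: hi => ->; [left|right].
    by left; apply: edge_comp hi.
  by split; apply: aux => //; [left|right].
have toC x : gnodes G x -> ~ gnodes H x -> comp (inl (f x)) ->
    reach C (f x) (f a0) /\ exists2 e, comp (inr e) & incident G a0 e.
  move=> hx nx hcx; have [w hw] := gate_node _ hx nx hcx.
  elim: w x hx nx hcx hw => [|d w IH] x hx nx hcx /=; first by move=> e; case: nx; rewrite e.
  move=> [hd dx hw]; have [hdG ndH] := hd; have [h1 h2] := dartG hdG.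
  have hce : comp (inr d.1).
    apply: (comp_edge hx nx) => //. rewrite -dx /incident /dart_from /=.
    by case: (d.2); auto.
  have hst : reach C (f x) (f (dart_to G d)).
    rewrite -dx; exists [:: d]; split=> //; rewrite /dart_from /dart_to /=; by case: (d.2).
  have inc2 : incident G (dart_to G d) d.1.
    by rewrite /incident /dart_to; case: (d.2); auto.
  have [hto|nto] := pselect (gnodes H (dart_to G d)).
    by rewrite -(gate_edge _ _ hce hto inc2); split=> //; exists d.1.
  have hcto := edge_comp h2 nto hce inc2.
  by have [r1 r2] := IH _ h2 nto hcto hw; split=> //; apply: reach_trans r1.
have toC' n : comp (inl n) -> reach C n (f a0).
  by move=> hn; have [x [en hx nx]] := node_rep hn; move: hn; rewrite en => /(toC _ hx nx)[].
have [e0 he0 hi0] : exists2 e, comp (inr e) & incident G a0 e.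
  have hcc : comp c by apply: rt_refl.
  case: (c) hc hcc => [n _ hn|e _ hce].
    by have [x [en hx nx]] := node_rep hn; move: hn; rewrite en => /(toC _ hx nx)[].
  have [heG _] := edge_out hce; have [h1 _] := gG heG.
  have [hs|ns] := pselect (gnodes H (gsrc G e)).
    by exists e => //; rewrite -(gate_edge _ _ hce hs) //; left.
  have hcs : comp (inl (f (gsrc G e))) by apply: edge_comp hce _ => //; left.
  by have [_] := toC _ h1 ns hcs.
have attached n : gnodes core n -> (exists2 e, comp (inr e) & incident Gam n e) -> n = f a0.
  move=> hn [e hce hi]; have [heG _] := edge_out hce; have [h1 h2] := gG heG.
  case: hi hn => -> hn.
    by rewrite -(gate_edge (gsrc G e) e) //; [apply: coreH|left].
  by rewrite -(gate_edge (gtgt G e) e) //; [apply: coreH|right].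
have core_a0 : gnodes core (f a0) by exists a0.
have C_a0 : gnodes C (f a0).
  by right; split=> //; exists e0 => //; case: hi0 => ->; [left|right].
have toC2 n : gnodes C n -> reach C n (f a0).
  by move=> [/toC' //|[h1 h2]]; rewrite (attached _ h1 h2); apply: reach_refl.
have nSa0 : ~ S a0.
  move=> hS; have [heG nhe] := edge_out he0.
  by apply: nhe; apply: edge_at_terminal hS heG hi0.
exists a0; split.
- apply/seteqP; split=> [n [hn [/comp_in[_ //]|[_ h]]]|n ->]; last by split.
  exact: attached.
- split=> //.
    split; first by exists (f a0).
    by move=> x y /toC2 hx /toC2 hy; apply: reach_trans hx (reach_sym hy).
  move=> w [wn uw un [x hw]].
  have hGw : graph_cycle Gam w.
    split=> //; exists x; apply: (walk_sub _ _ _ hw) => // d hd.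
    by have [] := edge_out (walk_edges hw hd).
  case: w wn uw un hw hGw => [//|d w] _ _ _ hw hGw.
  have [_] := edge_out (walk_edges hw (mem_head _ _)); apply.
  exact: cycle_in_core hGw (mem_head _ _).
- move=> n [hn|[h1 h2]]; last by exists a0; split=> //; [apply: attached|apply: HG].
  have [x [en hx nx]] := node_rep hn; exists x; split=> // hS.
  by apply: nx; left.
- move=> n [hn [d0 [[hd0 ed0] ud0]]] na0.
  have {}hn : comp (inl n) by case: hn => // -[h1 h2]; case: na0; apply: attached.
  have [x [en hx nx]] := node_rep hn; exists x; split=> //; last by move=> hS; apply: nx; left.
  have dC d : dart_from C d = f (dart_from G d) by rewrite /dart_from; case: (d.2).
  split=> //; exists d0; split.
    have [hdG _] := edge_out hd0; split=> //.
    by apply/esym; apply: (f_out hx _ nx); [have [] := dartG hdG|rewrite -dC ed0].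
  move=> d [hd ed]; apply: ud0; split; last by rewrite dC ed.
  apply: (comp_edge hx nx) => //; first by rewrite -en.
  by rewrite -ed /incident /dart_from; case: (d.2); auto.
Qed.

End Outside.

Lemma core_connected : graph_connected core.
Proof.
have [[x0 hx0] cH'] := cH; split; first by exists (f x0); exists x0.
have dC d : (dart_from core d = f (dart_from H d)) * (dart_to core d = f (dart_to H d)).
  by rewrite /dart_from /dart_to; case: (d.2).
move=> _ _ [x hx <-] [y hy <-]; have [w hw] := cH' _ _ hx hy; exists w.
elim: w x hw {hx} => [|d w IH] x /=; first by move=> ->.
by move=> [h1 <- /IH h3]; split=> //; rewrite dC.
Qed.

Lemma steiner_finite : finite_graph G -> finite_graph H.
Proof.
move=> [_ fN fE]; have [_ h1 h2 _ _] := sH.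
by split=> //; [exact: sub_finite_set fN|exact: sub_finite_set fE].
Qed.

Lemma core_finite : finite_graph G -> finite_graph core.
Proof.
move=> /steiner_finite[_ fN fE]; split=> //; last exact: finite_image.
by move=> e /gH[h1 h2]; split; [exists (gsrc H e)|exists (gtgt H e)].
Qed.

(** A tree has one node more than edges; the gluing keeps the edges and merges
    the [N + N] terminals into [N] nodes. *)
Lemma core_betti N : finite_graph G ->
  #|` fset_set S| = (N + N)%N -> #|` fset_set (f @` S)| = N -> betti1 core = N.
Proof.
move=> fG cS cfS; have fH := steiner_finite fG; have fC := core_finite fG.
rewrite (betti1_connected fC core_connected).
have := tree_card fH (steiner_tree tG SG (ex_intro _ s0 hs0)).
have [_ fN fE] := fH.
pose Rest := gnodes H `\` S.
have fS : finite_set S by apply: sub_finite_set fN => x; left.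
have fR : finite_set Rest by apply: sub_finite_set fN => x [].
have eN : gnodes H = S `|` Rest.
  by apply/seteqP; split=> x; [have [] := pselect (S x); [left|right]|move=> [?|[]] //; left].
have -> : #|` fset_set (gnodes H)| = (N + N + #|` fset_set Rest|)%N.
  rewrite eN fset_setU // cardfsU cS -fset_setI // (_ : S `&` Rest = set0).
    by rewrite fset_set0 cardfs0 subn0.
  by apply/seteqP; split=> // x [hS []].
have -> : #|` fset_set (gnodes core)| = (N + #|` fset_set Rest|)%N.
  have -> : gnodes core = (f @` S) `|` (f @` Rest) by rewrite -[gnodes core]/(f @` gnodes H) eN image_setU.
  have fI : finite_set (f @` S) by apply: finite_image.
  have fI' : finite_set (f @` Rest) by apply: finite_image.
  rewrite fset_setU // cardfsU cfS -fset_setI // (_ : _ `&` _ = set0).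
    rewrite fset_set0 cardfs0 subn0 fset_set_image //; congr (_ + _)%N.
    apply/eqP/card_in_imfsetP => x y; rewrite !in_fset_set // !inE.
    by move=> [hx nx] [hy ny] /(f_glue (HG hx) (HG hy))[//|[]].
  apply/seteqP; split=> // z [[x hx <-] [y [hy ny] exy]].
  by case: (f_glue (HG hy) (SG hx) exy) => [e|[]//]; apply: ny; rewrite e.
rewrite -addnA addnA => /(congr1 (subn^~ (N + #|` fset_set Rest|)%N)).
by rewrite -addnA addnK => <-.
Qed.

End Core.

(** * Sequences, rays and polygons *)

Section SeqLemmas.
Variables (R : realType).

Lemma seq_argmin (I : eqType) (s : seq I) (phi : I -> R) : s != [::] ->
  exists2 k, k \in s & forall k', k' \in s -> phi k <= phi k'.
Proof.
elim: s => [//|a s IH] _; have [->|/IH[k hk hm]] := eqVneq s [::].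
  by exists a; rewrite ?mem_head // => k'; rewrite inE => /eqP ->.
have [h|/ltW h] := leP (phi a) (phi k).
  exists a; rewrite ?mem_head // => k'; rewrite inE => /orP[/eqP -> //|/hm].
  exact: le_trans.
exists k; first by rewrite inE hk orbT.
by move=> k'; rewrite inE => /orP[/eqP -> //|/hm].
Qed.

Lemma seq_eps (I : eqType) (s : seq I) (Q : I -> R -> Prop) :
  (forall i, i \in s -> exists2 e, 0 < e & forall e', 0 < e' <= e -> Q i e') ->
  exists2 e, 0 < e & forall i e', i \in s -> 0 < e' <= e -> Q i e'.
Proof.
elim: s => [|a s IH] h; first by exists 1.
have [e1 e1p h1] := h a (mem_head _ _).
have [i hi|e2 e2p h2] := IH; first by apply: h; rewrite inE hi orbT.
exists (Num.min e1 e2); first by rewrite lt_min e1p.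
move=> i e'; rewrite inE le_min => /orP[/eqP ->|hi] /and3P[p le1 le2].
  by apply: h1; rewrite p.
by apply: h2; rewrite ?p.
Qed.

(** Along a ray, the affine functions [a.1 + t * a.2] are positive at first;
    this is the first time at which one of them vanishes. *)
Lemma first_zero (s : seq (R * R)) :
  (forall a, a \in s -> 0 < a.1 \/ a.1 = 0 /\ 0 < a.2) ->
  (exists2 a, a \in s & a.2 < 0) ->
  exists2 t0, 0 < t0 &
    [/\ forall t a, 0 < t < t0 -> a \in s -> 0 < a.1 + t * a.2,
        forall a, a \in s -> 0 <= a.1 + t0 * a.2
      & exists2 a, a \in s & a.1 + t0 * a.2 = 0].
Proof.
move=> hs [b hb b2].
have [|a ha am] := @seq_argmin _ [seq a <- s | a.2 < 0] (fun a => a.1 / - a.2).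
  by apply/eqP => e; have := mem_filter (fun a => a.2 < 0) b s; rewrite e b2 hb.
move: ha; rewrite mem_filter => /andP[a2 ha].
have a1 : 0 < a.1 by case: (hs a ha) => // -[_]; lra.
exists (a.1 / - a.2); first by rewrite divr_gt0 // oppr_gt0.
have key t c : 0 < t -> c \in s -> (c.2 < 0 -> t < c.1 / - c.2) -> 0 < c.1 + t * c.2.
  move=> t0 hc; have [c2 /(_ isT)|c2 _] := ltP c.2 0.
    by rewrite ltr_pdivlMr ?oppr_gt0 // mulrN; lra.
  case: (hs c hc) => [c1|[-> c2']]; last by rewrite add0r mulr_gt0.
  by rewrite ltr_wpDr // mulr_ge0 // ltW.
have am' c : c \in s -> c.2 < 0 -> a.1 / - a.2 <= c.1 / - c.2.
  by move=> hc c2; apply: am; rewrite mem_filter c2.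
split; last by exists a => //; field; lra.
- move=> t c /andP[t0 tlt] hc; apply: key => // c2.
  exact: lt_le_trans tlt (am' c hc c2).
- move=> c hc; have [c2|c2] := ltP c.2 0.
    by have := am' c hc c2; rewrite ler_pdivlMr ?oppr_gt0 // mulrN; lra.
  have t0 : 0 < a.1 / - a.2 by rewrite divr_gt0 // oppr_gt0.
  by apply/ltW/key => // c2'; lra.
Qed.

Lemma seq_bound (I : eqType) (l : seq I) (phi : I -> R) :
  exists2 D, 0 <= D & forall i, i \in l -> phi i <= D.
Proof.
elim: l => [|a l [D D0 hD]]; first by exists 0.
exists (Num.max (phi a) D); first by rewrite le_max D0 orbT.
by move=> i; rewrite inE le_max => /orP[/eqP -> |/hD ->]; rewrite ?lexx ?orbT.
Qed.

Lemma pos_near (a b : R) : 0 < a -> exists2 e, 0 < e & forall q, 0 < q <= e -> 0 < a + q * b.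
Proof.
move=> a0; have [b0|b0] := leP 0 b.
  by exists 1 => // q /andP[q0 _]; rewrite ltr_wpDr // mulr_ge0 // ltW.
exists (a / - b / 2); first by rewrite !divr_gt0 // oppr_gt0.
move=> q /andP[q0 q1].
have : q * - b <= a / 2.
  have := ler_wpM2r (_ : 0 <= - b) q1; rewrite mulrAC divfK; last by rewrite oppr_eq0 lt_eqF.
  by apply; lra.
by rewrite mulrN; lra.
Qed.

Lemma affine_limit (a b : R) : (forall t, 0 < t < 1 -> 0 <= a + t * b) -> 0 <= a + b.
Proof.
move=> h; rewrite leNgt; apply/negP => hn.
have h1 := h (1 / 2) ltac:(by apply/andP; lra).
have b0 : b < 0 by lra.
pose q := - (a + b) / - b; have q0 : 0 < q by rewrite divr_gt0; lra.
have qb : q * b = a + b.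
  by rewrite /q; field; rewrite lt_eqF.
have q1 : q < 1 by rewrite /q ltr_pdivrMr; lra.
by have := h (1 - q / 2) ltac:(by apply/andP; lra); lra.
Qed.

(** Connectedness of the unit interval, through the supremum of the points up to
    which [f] is constant. *)
Lemma locally_constant (f : R -> R) :
  (forall t, 0 <= t <= 1 -> exists2 q, 0 < q & forall t', `|t' - t| < q -> f t' = f t) ->
  f 0 = f 1.
Proof.
move=> hloc; pose A := [set t | 0 <= t <= 1 /\ forall r, 0 <= r <= t -> f r = f 0].
have A0 : A 0 by split=> [|r /andP[r0 r1]]; [apply/andP; lra|congr f; lra].
have supA : has_sup A by split; [exists 0|exists 1 => t [/andP[]]].
pose t := sup A.
have t0 : 0 <= t by apply: ub_le_sup A0; case: supA.
have t1 : t <= 1 by apply: ge_sup; [exists 0|move=> r [/andP[]]].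
have [q q0 hq] := hloc t ltac:(by rewrite t0).
have [r [/andP[r0 r1] hr] rt] := sup_adherent q0 supA; rewrite -/t in rt.
have rlet : r <= t by apply: ub_le_sup; [case: supA|split=> //; apply/andP].
have ft : f t = f 0.
  by rewrite -(hq r) ?hr ?r0 ?lexx // ltr_norml; apply/andP; lra.
have inA t' : 0 <= t' <= 1 -> t' < t + q -> A t'.
  move=> ht' h; split=> // x /andP[x0 x1]; have [xr|xr] := leP x r; first by rewrite hr // x0.
  by rewrite hq // ltr_norml; apply/andP; lra.
have [h|h] := ltP 1 (t + q).
  have [_ /(_ 1)] := inA 1 ltac:(by apply/andP; lra) h; rewrite ler01 lexx => /(_ isT).
  by move=> ->.
have hq2 : t + q / 2 < t + q by lra.
have := ub_le_sup (proj2 supA) (inA (t + q / 2) ltac:(by apply/andP; lra) hq2).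
by rewrite -/t; lra.
Qed.

Lemma sum_fibres (I J : eqType) (l : seq I) (ks : seq J) (o : I -> J) (X : I -> R) :
  uniq ks -> \sum_(k <- ks) \sum_(i <- l | o i == k) X i = \sum_(i <- l | o i \in ks) X i.
Proof.
move=> uk; elim: l => [|i l IH]; first by rewrite big_nil big1 // => k _; rewrite big_nil.
rewrite big_cons -IH.
transitivity (\sum_(k <- ks) ((if o i == k then X i else 0) + \sum_(i <- l | o i == k) X i)).
  by apply: eq_bigr => k _; rewrite big_cons; case: ifP => _; rewrite ?add0r.
rewrite big_split /=; case: ifP => hi.
  rewrite (bigD1_seq (o i)) //= eqxx big1 ?addr0 // => k.
  by rewrite eq_sym => /negbTE ->.
rewrite big1_seq ?add0r // => k /andP[_ hk]; case: eqP => // e.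
by move: hi; rewrite e hk.
Qed.

End SeqLemmas.

Lemma finite_by_code (T : Type) (I : eqType) (A : set T) (l : seq I) (code : T -> I -> Prop) :
  (forall a, A a -> exists2 i, i \in l & code a i) ->
  (forall a a' i, A a -> A a' -> code a i -> code a' i -> a = a') -> finite_set A.
Proof.
move=> hex hinj; have [[a0 _]|/set0P/negP/negPn/eqP ->] := pselect (A !=set0); last by [].
have /choice[g hg] : forall i, exists a, (exists a', A a' /\ code a' i) -> A a /\ code a i.
  by move=> i; have [[a' h]|n] := pselect (exists a', A a' /\ code a' i); [exists a'|exists a0].
apply: (@sub_finite_set _ _ (g @` [set` l])); last exact/finite_image/finite_seq.
move=> a ha; have [i hi hc] := hex a ha; exists i => //.
by have [|h1 h2] := hg i; [exists a|apply: hinj h1 ha h2 hc].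
Qed.

Lemma card_seq (K : choiceType) (l : seq K) (A : set K) : uniq l -> A = [set` l] ->
  #|` fset_set A| = size l.
Proof.
move=> ul ->; apply: perm_size; apply: uniq_perm => // k.
rewrite in_fset_set; last exact: finite_seq.
by apply/idP/idP => [/set_mem|h]; last exact/mem_set.
Qed.

Lemma uniq_map_inj (I J : eqType) (f : I -> J) (l : seq I) i j :
  uniq (map f l) -> i \in l -> j \in l -> f i = f j -> i = j.
Proof.
elim: l => [//|k l IH] /= /andP[nk ul]; rewrite !inE => /orP[/eqP ->|hi] /orP[/eqP ->|hj] //.
- by move=> e; move: nk; rewrite e map_f.
- by move=> e; move: nk; rewrite -e map_f.
- exact: IH.
Qed.

Section Planar.
Variables (R : realType).
Local Notation vz := (@vecz R).
Implicit Types (x y u v w p q : R * R) (t : R) (m k : int * int).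

Definition ray x u (t : R) : R * R := (x.1 + t * u.1, x.2 + t * u.2).
Definition perp u : R * R := (- u.2, u.1).

Lemma ray0 x u : ray x u 0 = x.
Proof. by rewrite /ray !mul0r !addr0; case: x. Qed.

Lemma ray1 x y : ray x (y - x) 1 = y.
Proof. by case: x y => [x1 x2] [y1 y2]; rewrite /ray /= !mul1r !subrKC. Qed.

Lemma dot_ray p x u t : dot p (ray x u t) = dot p x + t * dot p u.
Proof. rewrite /dot /ray /=; ring. Qed.

Lemma dot_sub p x y : dot p (x - y) = dot p x - dot p y.
Proof. rewrite /dot /=; ring. Qed.

Lemma open_segmentP x y z : open_segment x y z <->
  exists2 t, 0 < t < 1 & z = ray x (y - x) t.
Proof.
have e t : ((1 - t) * x.1 + t * y.1, (1 - t) * x.2 + t * y.2) = ray x (y - x) t.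
  by rewrite /ray /=; congr pair; ring.
by split=> -[t ht ->]; exists t.
Qed.

Lemma near_seq (I : eqType) (s : seq I) (Q : I -> R * R -> Prop) x :
  (forall i, i \in s -> \forall y \near x, Q i y) ->
  \forall y \near x, forall i, i \in s -> Q i y.
Proof.
elim: s => [|a s IH] h; first by apply: filterE.
have h1 := h a (mem_head _ _).
have h2 : \forall y \near x, forall i, i \in s -> Q i y.
  by apply: IH => i hi; apply: h; rewrite inE hi orbT.
near=> y => i; rewrite inE => /orP[/eqP ->|]; first by near: y.
by move: i; near: y.
Unshelve. all: by end_near. Qed.

Lemma continuous_aff p (a : R) : continuous (fun y : R * R => a + dot p y).
Proof.
move=> y; apply: cvgD; first exact: cvg_cst.
apply: cvgD; (apply: cvgM; first exact: cvg_cst).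
  exact: (@cvg_fst _ _ (nbhs y.1) (nbhs y.2) _).
exact: (@cvg_snd _ _ (nbhs y.1) (nbhs y.2) _).
Qed.

Lemma near_aff p (a : R) x : 0 < a + dot p x -> \forall y \near x, 0 < a + dot p y.
Proof. by move=> h; have /cvgr_gt := @continuous_aff p a x; apply. Qed.

Lemma continuous_ray x u : continuous (ray x u).
Proof.
move=> t.
apply: (@cvg_pair _ _ _ _ (nbhs (x.1 + t * u.1)) (nbhs (x.2 + t * u.2)) _ _ _
  (fun t => x.1 + t * u.1) (fun t => x.2 + t * u.2)).
all: by apply: cvgD; [exact: cvg_cst|apply: cvgM; [exact: cvg_id|exact: cvg_cst]].
Qed.

Lemma near_ray (Q : R * R -> Prop) x u : (\forall y \near x, Q y) ->
  exists2 e, 0 < e & forall t, `|t| <= e -> Q (ray x u t).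
Proof.
move=> h; have : \forall t \near (0 : R), Q (ray x u t).
  by have := @continuous_ray x u 0; rewrite /continuous_at ray0 => /(_ _ h).
move=> /nbhs_ballP[e /= e0 he]; exists (e / 2); first by rewrite divr_gt0.
move=> t ht; apply: he; rewrite /ball /= sub0r normrN.
by apply: le_lt_trans ht _; lra.
Qed.

Lemma near_ray2 (Q : R * R -> Prop) x u : (\forall y \near x, Q y) ->
  exists2 q, 0 < q & Q (ray x u q) /\ Q (ray x u (- q)).
Proof.
move=> /(near_ray u)[q q0 h]; exists q => //.
by split; apply: h; rewrite ?normrN gtr0_norm.
Qed.

Lemma pmul_eq0 (a b : R) : 0 < a -> a * b = 0 -> b = 0.
Proof. by move=> a0 /eqP; rewrite mulf_eq0 gt_eqF //= => /eqP. Qed.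

Lemma ray_ray x u t t' : ray (ray x u t) u t' = ray x u (t + t').
Proof. by rewrite /ray /=; congr pair; ring. Qed.

Lemma dot_opp p u : dot p (- u) = - dot p u.
Proof. by rewrite /dot /=; ring. Qed.

Lemma dot_gt0 u : u != 0 -> 0 < dot u u.
Proof.
move=> u0; rewrite /dot -!expr2 lt0r addr_ge0 ?sqr_ge0 // andbT.
rewrite paddr_eq0 ?sqr_ge0 // !sqrf_eq0; apply: contra u0 => /andP[/eqP h1 /eqP h2].
by case: u h1 h2 => ? ? /= -> ->.
Qed.

Lemma perp_neq0 u : u != 0 -> perp u != 0.
Proof.
case: u => a b; apply: contraNneq; rewrite /perp /= => -[/eqP].
by rewrite oppr_eq0 => /eqP -> ->; rewrite eqxx.
Qed.

Lemma dot_perp u v : dot v (perp u) = cross u v.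
Proof. by rewrite /dot /cross /perp /=; ring. Qed.

Lemma dot_cross p u v : dot p p * dot u v = dot p u * dot p v + cross p u * cross p v.
Proof. by rewrite /dot /cross; ring. Qed.

Lemma cross_dot0 p q u : p != 0 -> dot p u = 0 -> cross p q = 0 -> dot q u = 0.
Proof.
move=> /dot_gt0 p0 h1 h2; apply: (pmul_eq0 p0).
by rewrite dot_cross h1 h2 mulr0 mul0r addr0.
Qed.

Lemma dot0_cross p q u : u != 0 -> dot p u = 0 -> dot q u = 0 -> cross p q = 0.
Proof.
move=> /dot_gt0 u0 h1 h2; apply: (pmul_eq0 u0).
transitivity (dot p u * cross u q - dot q u * cross u p); first by rewrite /dot /cross; ring.
by rewrite h1 h2 !mul0r subrr.
Qed.

Lemma dot_perp0 p u : u != 0 -> dot p u = 0 -> dot p (perp u) = 0 -> p = 0.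
Proof.
rewrite dot_perp => /dot_gt0 u0 h1 h2; apply/eqP; apply: contraT => /dot_gt0.
rewrite -(pmulr_rgt0 _ u0) dot_cross h2 (_ : dot u p = 0); first by rewrite !mul0r addr0 ltxx.
by rewrite -h1 /dot; ring.
Qed.

Lemma cross0_colinear u w : u != 0 -> cross u w = 0 -> exists a, w = (a * u.1, a * u.2).
Proof.
move=> /dot_gt0 uu cr; exists (dot u w / dot u u); have nz : dot u u != 0 by rewrite gt_eqF.
rewrite [LHS]surjective_pairing; congr pair; apply: (mulIf nz); rewrite mulrAC divfK //.
  transitivity (dot u w * u.1 - u.2 * cross u w); first by rewrite /dot /cross; ring.
  by rewrite cr mulr0 subr0.
transitivity (dot u w * u.2 + u.1 * cross u w); first by rewrite /dot /cross; ring.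
by rewrite cr mulr0 addr0.
Qed.

Lemma colinear p u w : p != 0 -> u != 0 -> dot p u = 0 -> dot p w = 0 ->
  exists a, w = (a * u.1, a * u.2).
Proof.
move=> p0 u0 h1 h2; apply: cross0_colinear => //; apply: (dot0_cross p0).
  by rewrite -h1 /dot; ring.
by rewrite -h2 /dot; ring.
Qed.

Lemma ray_inj x u : u != 0 -> injective (ray x u).
Proof.
move=> /dot_gt0 u0 t t' e; have : dot u (ray x u t) = dot u (ray x u t') by rewrite e.
by rewrite !dot_ray => /addrI/mulIf; apply; rewrite gt_eqF.
Qed.

Lemma open_segmentC x y : open_segment x y `<=` open_segment y x.
Proof.
move=> z /open_segmentP[t /andP[t0 t1] ->]; apply/open_segmentP; exists (1 - t).
  by apply/andP; lra.
by rewrite /ray /=; congr pair; ring.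
Qed.

Lemma lex_ltP x y : x != y -> lex_lt x y \/ lex_lt y x.
Proof.
case: x y => [x1 x2] [y1 y2] ne; rewrite /lex_lt /=.
case: (ltgtP x1 y1) => [h|h|e]; [by left; left|by right; left|].
case: (ltgtP x2 y2) => [h|h|e2]; [by left; right|by right; right|].
by move: ne; rewrite e e2 eqxx.
Qed.

Lemma lex_lt_neq x y : lex_lt x y -> x != y.
Proof. by case=> [|[_]] h; apply/eqP => e; move: h; rewrite e ltxx. Qed.

Lemma lex_lt_scale x y x' y' (a : R) : lex_lt x y -> lex_lt x' y' ->
  y.1 - x.1 = a * (y'.1 - x'.1) -> y.2 - x.2 = a * (y'.2 - x'.2) -> 0 < a.
Proof.
rewrite /lex_lt => h h' e1 e2; rewrite ltNge; apply/negP => a0.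
case: h h' => [h|[h h2]] [h'|[h' h2']].
- have := mulr_le0_ge0 a0 (_ : 0 <= y'.1 - x'.1); rewrite -e1; lra.
- by move: e1; rewrite h' subrr mulr0; lra.
- have := mulr_le0_ge0 a0 (_ : 0 <= y'.1 - x'.1); rewrite -e1 => /(_ ltac:(lra)).
  have a1 : a = 0.
    have : a * (y'.1 - x'.1) = 0 by rewrite -e1 h subrr.
    by move/eqP; rewrite mulf_eq0 => /orP[/eqP //|/eqP]; lra.
  by move: e2; rewrite a1 mul0r; lra.
- have := mulr_le0_ge0 a0 (_ : 0 <= y'.2 - x'.2); rewrite -e2; lra.
Qed.

Lemma vz_add m k x : dot (vz (m + k)) x = dot (vz m) x + dot (vz k) x.
Proof. by rewrite /dot /vecz /= !intrD; ring. Qed.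

Lemma vz_sub m k x : dot (vz (m - k)) x = dot (vz m) x - dot (vz k) x.
Proof. by rewrite /dot /vecz /= !intrD !intrN; ring. Qed.

Lemma vzB m k : vz (m - k) = vz m - vz k.
Proof. by rewrite /vecz /= !intrD !intrN. Qed.

Lemma vz_neq0 m : m != 0 -> vz m != 0.
Proof.
by case: m => a b; apply: contraNneq => -[/eqP + /eqP]; rewrite !intr_eq0 => /eqP -> /eqP ->.
Qed.

Lemma vz_eq0 m : (forall u, dot (vz m) u = 0) -> m = 0.
Proof.
move=> h; apply/eqP; apply: contraT => /vz_neq0/dot_gt0.
by rewrite h ltxx.
Qed.

Lemma int_box (M : R) : exists l : seq (int * int), forall m,
  `|m.1%:~R| <= M -> `|m.2%:~R| <= M -> m \in l.
Proof.
pose n := Num.bound M; pose ints : seq int := [seq (i%:Z - n%:Z)%R | i <- iota 0 (n + n).+1].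
have hi (i : int) : `|i%:~R| <= M -> i \in ints.
  move=> hiM; have M0 : 0 <= M by apply: le_trans hiM.
  have : `|i%:~R| < n%:~R :> R by apply: le_lt_trans hiM _; apply: archi_boundP.
  rewrite -intr_norm ltr_int => hin; apply/mapP; exists `|(i + n%:Z)%R|%N; last by lia.
  by rewrite mem_iota; lia.
exists [seq (i, j) | i <- ints, j <- ints] => -[i j] h1 h2.
by apply: (allpairs_f pair); apply: hi.
Qed.

End Planar.

Section Polygon.
Variable R : realType.
Local Notation vz := (@vecz R).
Variables (s : seq ((int * int) * R)) (Om : set (R * R)).
Hypothesis prim_s : all (fun h => primitive h.1) s.
Hypothesis OmE : Om = [set x | forall h, h \in s -> 0 <= dot (vz h.1) x + h.2].
Hypothesis cOm : compact Om.
Implicit Types (x y u v p : R * R).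

(** The affine function that defines a half-plane; the same encoding, a gradient
    with a constant, serves for the affine functions of tropical polynomials. *)
Definition hp (h : (int * int) * R) x : R := dot (vz h.1) x + h.2.

Lemma hp_ray h x u t : hp h (ray x u t) = hp h x + t * dot (vz h.1) u.
Proof. rewrite /hp dot_ray; ring. Qed.

Lemma hp_normal h : h \in s -> 0 < dot (vz h.1) (vz h.1) :> R.
Proof.
move=> hh; apply/dot_gt0/vz_neq0; have := allP prim_s h hh.
by apply: contraL => /eqP ->.
Qed.

Lemma OmP x : Om x <-> forall h, h \in s -> 0 <= hp h x.
Proof. by rewrite OmE. Qed.

(** On the line of a half-plane, moving against the normal leaves [Om]; this needs
    the normal to be nonzero. *)
Lemma OmiP x : Om° x <-> forall h, h \in s -> 0 < hp h x.
Proof.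
split=> [hx h hh|hx].
  have [e e0 he] := near_ray (- (vz h.1).1, - (vz h.1).2) hx.
  have := he e; rewrite ger0_norm ?(ltW e0) // => /(_ (lexx _))/OmP/(_ h hh).
  rewrite hp_ray.
  have -> : dot (vz h.1) (- (vz h.1).1, - (vz h.1).2) = - dot (vz h.1) (vz h.1) :> R.
    by rewrite /dot /=; ring.
  by have := mulr_gt0 e0 (hp_normal hh); lra.
suff : \forall y \near x, forall h, h \in s -> 0 <= hp h y.
  by apply: filterS => y /OmP.
apply: near_seq => h hh.
have : 0 < h.2 + dot (vz h.1) x by rewrite addrC; apply: hx.
by move/near_aff; apply: filterS => y /ltW; rewrite addrC.
Qed.

Lemma Omi_sub x : Om° x -> Om x.
Proof. exact: interior_subset. Qed.

Lemma bdP x : bd Om x <-> Om x /\ exists2 h, h \in s & hp h x = 0.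
Proof.
split=> [[hx nx]|[hx [h hh h0]]]; split=> //.
  apply: contrapT => hn; apply: nx; apply/OmiP => h hh.
  rewrite lt_neqAle; move/OmP: hx => ->//; rewrite andbT eq_sym.
  by apply/eqP => h0; apply: hn; exists h.
by move/OmiP/(_ h hh); rewrite h0 ltxx.
Qed.

Lemma Om_bounded : exists2 M : R, 0 < M & forall x, Om x -> `|x.1| <= M /\ `|x.2| <= M.
Proof.
have [M [_ hM]] := compact_bounded cOm.
exists (`|M| + 1); first by rewrite ltr_wpDl.
move=> x hx; have /hM/(_ x hx) : M < `|M| + 1 by have := ler_norm M; lra.
by rewrite /= /Num.norm /= ge_max => /andP[].
Qed.

(** Otherwise the ray from [x] would stay in [Om], which is bounded. *)
Lemma exit_side x u : Om x -> u != 0 -> exists2 h, h \in s & dot (vz h.1) u < 0.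
Proof.
move=> hx u0; apply: contrapT => hn.
have hr t : 0 <= t -> Om (ray x u t).
  move=> t0; apply/OmP => h hh; rewrite hp_ray addr_ge0 //; first by move/OmP: hx; apply.
  by rewrite mulr_ge0 // leNgt; apply/negP => h'; apply: hn; exists h.
have [M M0 hM] := Om_bounded.
have h1 (i : R * R -> R) : (forall y, Om y -> `|i y| <= M) ->
    (forall t, i (ray x u t) = i x + t * i u) -> i u = 0.
  move=> hi hir; apply/eqP/negPn/negP => iu.
  have iu0 : 0 < `|i u| by rewrite normr_gt0.
  pose t := (2 * M + 1) / `|i u|; have t0 : 0 <= t by rewrite divr_ge0 //; lra.
  have := hi _ (hr t t0); have := hi _ hx; rewrite hir.
  have e : `|t * i u| = 2 * M + 1.
    by rewrite normrM (ger0_norm t0) /t divfK ?gt_eqF.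
  have := ler_normB (i x + t * i u) (i x); rewrite [i x + _ - i x]addrAC subrr add0r e.
  lra.
move/eqP: u0; apply; case: u h1 {hr hn} => u1 u2 h1.
have := h1 fst; have := h1 snd => /= -> //; last by move=> y /hM[].
by move=> -> // y /hM[].
Qed.

Lemma Om_convex x y t : Om x -> Om y -> 0 <= t <= 1 -> Om (ray x (y - x) t).
Proof.
move=> /OmP hx /OmP hy /andP[t0 t1]; apply/OmP => h hh.
have := hx h hh; have := hy h hh; rewrite hp_ray dot_sub /hp => a b.
have := mulr_ge0 t0 a; have : 0 <= 1 - t by lra.
move/mulr_ge0 => /(_ _ b); lra.
Qed.

Lemma Omi_convex x y t : Om° x -> Om y -> 0 <= t < 1 -> Om° (ray x (y - x) t).
Proof.
move=> /OmiP hx /OmP hy /andP[t0 t1]; apply/OmiP => h hh.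
have := hx h hh; have := hy h hh; rewrite hp_ray dot_sub /hp => a b.
have := mulr_ge0 t0 a; have : 0 < 1 - t by lra.
move/mulr_gt0 => /(_ _ b); lra.
Qed.

End Polygon.

(** * The relaxation as a tropical polynomial *)

Section Series.
Variable R : realType.
Local Notation vz := (@vecz R).
Variables (s : seq ((int * int) * R)) (Om : set (R * R)).
Hypothesis prim_s : all (fun h => primitive h.1) s.
Hypothesis OmE : Om = [set x | forall h, h \in s -> 0 <= dot (vz h.1) x + h.2].
Hypothesis cOm : compact Om.
Hypothesis Om0 : Om° !=set0.
Implicit Types (x y u v p : R * R) (m : int * int) (F G : R * R -> R).

Let OmiP := OmiP prim_s OmE.
Let Omi_convex := Omi_convex prim_s OmE.
Let Om_convex := Om_convex OmE.
Let exit_side := exit_side OmE cOm.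
Let OmP := OmP OmE.
Let bdP := bdP prim_s OmE.

Definition supergrad G x m := forall y, Om y -> G y <= G x + dot (vz m) (y - x).

(** A series is concave along segments: were [G] above its tangent at the far end of
    a segment, [G] minus its chord plus a strictly concave correction would have a
    negative minimum inside the segment; but near that point it is the sum of a
    minimum of affine functions and a strictly concave function. *)
Lemma series_supergrad G x A c m : tropical_series Om G -> Om° x ->
  local_min_form G x A c -> A m -> G x = c m + dot (vz m) x -> supergrad G x m.
Proof.
move=> [cG _ _ lG] hx [_ hA] Am Gx y hy; rewrite leNgt; apply/negP => hlt.
have hxO : Om x := Omi_sub hx.
set u := y - x in hlt; pose eta := G y - G x - dot (vz m) u.
have eta0 : 0 < eta by rewrite /eta; lra.
have uu0 : 0 < dot u u.
  apply/dot_gt0; rewrite subr_eq0; apply/eqP => e.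
  by move: hlt; rewrite /u e subrr /dot /=; lra.
pose T z := - (dot u x / dot u u) + dot (u.1 / dot u u, u.2 / dot u u) z.
have TE t : T (ray x u t) = t.
  have -> : T (ray x u t) = t * (dot u u / dot u u) by rewrite /T /dot /ray /=; ring.
  by rewrite divff ?mulr1 // gt_eqF.
pose K z := G z + (- G x + dot (vz m) x + dot (- (vz m).1, - (vz m).2) z)
  - eta * T z + eta / 2 * (T z - T z * T z).
have KE t : K (ray x u t) = G (ray x u t) - G x - t * dot (vz m) u
    - eta * t + eta / 2 * (t - t * t).
  by rewrite /K TE /dot /ray /=; ring.
pose seg : set (R * R) := ray x u @` `[0, 1].
have segO : seg `<=` Om.
  by move=> _ [t /= ht <-]; apply: Om_convex => //; rewrite in_itv in ht.
have cseg : compact seg.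
  by apply: continuous_compact (@segment_compact R 0 1); apply: continuous_subspaceT;
     apply: continuous_ray.
have cK : {within seg, continuous K}.
  have cT : {within seg, continuous T} by apply: continuous_subspaceT; apply: continuous_aff.
  have cA : {within seg, continuous (fun z => - G x + dot (vz m) x + dot (- (vz m).1, - (vz m).2) z)}.
    by apply: continuous_subspaceT; apply: continuous_aff.
  have cGs : {within seg, continuous G} := continuous_subspaceW segO cG.
  move=> z; apply: cvgD.
    apply: cvgB; first by apply: cvgD; [exact: cGs|exact: cA].
    by apply: cvgM; [exact: cvg_cst|exact: cT].
  apply: cvgM; first exact: cvg_cst.
  by apply: cvgB; [exact: cT|apply: cvgM; exact: cT].
have seg0 : seg !=set0 by exists (ray x u 0), 0 => //=; rewrite in_itv /= lexx ler01.
have [z /set_mem[t /= ht <-] hmin] := compact_EVT_min seg0 cseg cK.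
rewrite in_itv /= in ht; case/andP: ht => t0 t1.
have {}hmin t' : 0 <= t' <= 1 -> K (ray x u t) <= K (ray x u t').
  by move=> ht'; apply: hmin; apply/mem_set; exists t' => //=; rewrite in_itv.
have Kneg : K (ray x u t) < 0.
  have [e e0 he] := near_ray u hA.
  pose t' := Num.min e (1 / 2).
  have t'0 : 0 < t' by rewrite lt_min e0 /=; lra.
  have t'e : t' <= e by rewrite ge_min lexx.
  have t'2 : t' <= 1 / 2 by rewrite ge_min lexx orbT.
  have : K (ray x u t) <= K (ray x u t') by apply: hmin; apply/andP; lra.
  have [|h1 _] := he t'; first by rewrite gtr0_norm.
  have := h1 m Am; rewrite [K (ray x u t')]KE dot_ray.
  have : 0 < t' * (1 - t') by apply: mulr_gt0; lra.
  have := mulr_gt0 eta0 t'0; have := mulr_gt0 eta0 (mulr_gt0 t'0 t'0); nra.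
have tn0 : t != 0.
  by apply/eqP => e; move: Kneg; rewrite e KE ray0; lra.
have tn1 : t != 1.
  by apply/eqP => e; move: Kneg; rewrite e KE /u ray1 -/u /eta; lra.
have {tn0} tp : 0 < t by rewrite lt0r tn0.
have {tn1} tl : t < 1 by rewrite lt_neqAle tn1.
have hz : Om° (ray x u t) by apply: Omi_convex => //; rewrite (ltW tp).
have [A' [c' [_ hA']]] := lG _ hz.
have [_ [m' Am' Gz]] := nbhs_singleton hA'.
have [e e0 he] := near_ray u hA'.
pose d := Num.min e (Num.min t (1 - t)).
have d0 : 0 < d by rewrite !lt_min e0 tp; lra.
have de : d <= e by rewrite ge_min lexx.
have dt : d <= t by rewrite !ge_min lexx orbT.
have dt1 : d <= 1 - t by rewrite !ge_min lexx !orbT.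
have [|h1 _] := he d; first by rewrite gtr0_norm.
have [|h2 _] := he (- d); first by rewrite normrN gtr0_norm.
have := h1 m' Am'; have := h2 m' Am'; rewrite !ray_ray.
have := hmin (t + d); have := hmin (t - d).
rewrite !KE Gz !dot_ray => /(_ ltac:(apply/andP; lra)) + /(_ ltac:(apply/andP; lra)).
have := mulr_gt0 eta0 (mulr_gt0 d0 d0); nra.
Qed.

Definition lmin (K : seq ((int * int) * R)) G :=
  forall x, (forall k, k \in K -> G x <= hp k x) /\ exists2 k, k \in K & G x = hp k x.

Lemma lmin_ex K : K != [::] -> exists G, lmin K G.
Proof.
move=> K0.
have /choice[G hG] : forall x, exists r : R,
    (forall k, k \in K -> r <= hp k x) /\ exists2 k, k \in K & r = hp k x.
  by move=> x; have [k hk hm] := seq_argmin (fun k => hp k x) K0; exists (hp k x); split=> //; exists k.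
by exists G.
Qed.

Lemma lmin_continuous K G : lmin K G -> continuous G.
Proof.
move=> hG x; apply/cvgrPdist_lt => e e0.
have : \forall y \near x, forall k, k \in K -> `|hp k x - hp k y| < e.
  apply: near_seq => k hk.
  have h1 : 0 < e - hp k x + hp k x by lra.
  have /near_aff h2 : 0 < (e - hp k x + k.2) + dot (vz k.1) x by rewrite /hp; lra.
  have /near_aff h3 : 0 < (e + hp k x - k.2) + dot (- (vz k.1).1, - (vz k.1).2) x.
    have -> : dot (- (vz k.1).1, - (vz k.1).2) x = - dot (vz k.1) x by rewrite /dot /=; ring.
    by rewrite /hp; lra.
  apply: filterS2 h2 h3 => y.
  have -> : dot (- (vz k.1).1, - (vz k.1).2) y = - dot (vz k.1) y by rewrite /dot /=; ring.
  by rewrite ltr_norml [hp k y]/hp => ? ?; apply/andP; lra.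
apply: filterS => y hy; have [hx [k hk ex]] := hG x; have [hy' [k' hk' ey]] := hG y.
have := hx k' hk'; have := hy' k hk; have := hy _ hk; have := hy _ hk'.
by rewrite !ltr_norml => /andP[? ?] /andP[? ?] ? ?; apply/andP; lra.
Qed.

(** Several functions of [K] may share a gradient; the smallest constant wins. *)
Lemma lmin_local K G x : lmin K G -> exists A c, local_min_form G x A c /\
  forall k, k \in K -> G x = hp k x -> A k.1 /\ G x = c k.1 + dot (vz k.1) x.
Proof.
move=> hG; pose A : set (int * int) := [set k.1 | k in [set` K]].
have /choice[c hc] : forall m, exists c, A m ->
    (exists2 k, k \in K & k = (m, c)) /\ forall k, k \in K -> k.1 = m -> c <= k.2.
  move=> m; have [[k hk km]|nA] := pselect (A m); last by exists 0.
  have [|k' hk' hm] := @seq_argmin R _ [seq k <- K | k.1 == m] snd.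
    by apply/eqP => e; have := mem_filter (fun k => k.1 == m) k K; rewrite e km eqxx hk.
  move: hk'; rewrite mem_filter => /andP[/eqP e hk'].
  exists k'.2 => _; split; first by exists k' => //; case: (k') e => ? ? /= ->.
  by move=> k2 h2 e2; apply: hm; rewrite mem_filter e2 eqxx.
have cA k : k \in K -> A k.1 by move=> hk; exists k.
exists A, c; split; last first.
  move=> k hk ex; split; first exact: cA.
  have [[k' hk' e'] hmn] := hc _ (cA _ hk); have := hmn _ hk erefl.
  have [/(_ _ hk') + _] := hG x; rewrite e' ex /hp /= => h1 h2.
  by apply/eqP; rewrite eq_le; apply/andP; lra.
split; first by apply: finite_image; apply: finite_seq.
apply: filterE => y; have [h1 [k hk ey]] := hG y; split.
  move=> m /hc[[k' hk' e'] _]; have := h1 _ hk'; rewrite e' /hp /=; lra.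
exists k.1; first exact: cA.
have [[k' hk' e'] hmn] := hc _ (cA _ hk); have := hmn _ hk erefl.
have := h1 _ hk'; rewrite e' ey /hp /= => ? ?.
by apply/eqP; rewrite eq_le; apply/andP; lra.
Qed.

Lemma lmin_series K G : lmin K G -> (forall x, Om x -> 0 <= G x) ->
  (forall x, bd Om x -> G x = 0) -> tropical_series Om G.
Proof.
move=> hG h0 hb; split=> //.
  by apply: continuous_subspaceT; apply: lmin_continuous hG.
by move=> x _; have [A [c [h _]]] := lmin_local x hG; exists A, c.
Qed.

Definition two_active (K : seq ((int * int) * R)) G x :=
  exists k k', [/\ k \in K, k' \in K, k.1 != k'.1, G x = hp k x & G x = hp k' x].

Lemma lmin_corner K G x : lmin K G -> Om° x -> two_active K G x -> corner_locus Om G x.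
Proof.
move=> hG hx [k [k' [hk hk' ne e e']]]; split=> //.
have [A [c [hA h]]] := lmin_local x hG; exists A, c; split=> //.
have [h1 h2] := h _ hk e; have [h3 h4] := h _ hk' e'.
by exists k.1, k'.1; split=> //; apply/eqP.
Qed.

Lemma sides_neq0 : s != [::].
Proof.
have [x /Omi_sub hx] := Om0; have [|h hh _] := @exit_side x (1, 0) hx.
  by apply/eqP => -[/eqP]; rewrite oner_eq0.
by apply: contraTneq hh => ->.
Qed.

Lemma primitive_neq0 h : h \in s -> h.1 != 0.
Proof. by move=> hh; have := allP prim_s h hh; apply: contraL => /eqP ->. Qed.

(** Truncating the distance-like function [min (hp h)] at its value at [p]
    bends it at [p]; the sum over the marked points bends at all of them. *)
Lemma barrier (ps : seq (R * R)) : (forall p, p \in ps -> Om° p) ->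
  exists G K C, [/\ lmin K G, tropical_series Om G,
    forall p, p \in ps -> two_active K G p, 0 <= C
  & forall h x, h \in s -> Om x -> G x <= C * hp h x].
Proof.
suff H : (forall p, p \in ps -> Om° p) -> exists G K C, [/\ lmin K G,
    forall x, Om x -> 0 <= G x, forall p, p \in ps -> two_active K G p, 0 <= C
  & forall h x, h \in s -> Om x -> G x <= C * hp h x].
  move=> /H[G [K [C [hG G0 h2 C0 hC]]]]; exists G, K, C; split=> //.
  apply: (lmin_series hG G0) => x /bdP[hx [h hh h0]].
  by apply/eqP; rewrite eq_le G0 // andbT; have := hC _ _ hh hx; rewrite h0 mulr0.
elim: ps => [_|p ps IH hps].
  exists (fun=> 0), [:: (0, 0)], 0; split=> //; last by move=> *; rewrite mul0r.
  have e x : hp (0, 0) x = 0 :> R by rewrite /hp /dot /vecz /=; ring.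
  move=> x; split; first by move=> k; rewrite inE => /eqP ->; rewrite e.
  by exists (0, 0); rewrite ?mem_head.
have [q hq|G [K [C [hG G0 h2 C0 hC]]]] := IH; first by apply: hps; rewrite inE hq orbT.
have hp0 : Om° p by apply: hps; rewrite mem_head.
have [h0 hh0 hmin] := seq_argmin (fun k => hp k p) sides_neq0.
pose v := hp h0 p; pose k0 : (int * int) * R := (0, v).
have k0E x : hp k0 x = v by rewrite /hp /k0 /dot /vecz /=; ring.
have v0 : 0 < v by have /OmiP := hp0; apply.
have [//|g hg] := @lmin_ex (k0 :: s).
have g0 x : Om x -> 0 <= g x.
  move=> hx; have [_ [k]] := hg x; rewrite inE => /orP[/eqP ->|hk] ->; first by rewrite k0E ltW.
  by move/OmP: hx; apply.
have gp : g p = v.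
  have [h1 [k hk e]] := hg p; apply/eqP; rewrite eq_le; apply/andP; split.
    by rewrite -(k0E p); apply: h1; rewrite mem_head.
  by move: hk; rewrite e inE => /orP[/eqP ->|/hmin //]; rewrite k0E.
pose K' := [seq (k.1 + k'.1, k.2 + k'.2) | k <- K, k' <- k0 :: s].
have K'E k k' x : hp (k.1 + k'.1, k.2 + k'.2) x = hp k x + hp k' x.
  by rewrite /hp /= vz_add; ring.
have inK' k k' : k \in K -> k' \in k0 :: s -> (k.1 + k'.1, k.2 + k'.2) \in K'.
  by move=> hk hk'; apply/allpairsP; exists (k, k').
exists (fun x => G x + g x), K', (C + 1); split.
- move=> x; have [h1 [k hk e]] := hG x; have [h1' [k' hk' e']] := hg x.
  split; last by exists (k.1 + k'.1, k.2 + k'.2); [apply: inK'|rewrite K'E -e -e'].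
  move=> _ /allpairsP[[k1 k2] [/= hk1 hk2 ->]]; rewrite K'E.
  by apply: lerD; [apply: h1|apply: h1'].
- by move=> x hx; rewrite addr_ge0 ?G0 ?g0.
- move=> q; rewrite inE => /orP[/eqP ->|/h2[k [k' [hk hk' ne e e']]]].
    have [_ [k hk e]] := hG p.
    have h0in : h0 \in k0 :: s by rewrite inE hh0 orbT.
    have i1 := inK' k k0 hk (mem_head _ _); have i2 := inK' k h0 hk h0in.
    exists (k.1 + k0.1, k.2 + k0.2), (k.1 + h0.1, k.2 + h0.2).
    rewrite i1 i2 !K'E !k0E -e gp; split=> //.
    by rewrite (inj_eq (addrI _)) eq_sym primitive_neq0.
  have [_ [l hl el]] := hg q.
  have i1 := inK' k l hk hl; have i2 := inK' k' l hk' hl.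
  exists (k.1 + l.1, k.2 + l.2), (k'.1 + l.1, k'.2 + l.2).
  by rewrite i1 i2 !K'E -e -e' -el; split=> //; rewrite (inj_eq (addIr _)).
- by rewrite addr_ge0.
- move=> h x hh hx; rewrite mulrDl mul1r lerD ?hC //.
  by have [h1 _] := hg x; apply: h1; rewrite inE hh orbT.
Qed.

(** At an interior point the supergradient pulls [G] down to zero at the latest
    on the boundary, where [C * hp h] vanishes too: this bounds it. *)
Lemma slope_bound G x m C : Om° x -> supergrad G x m ->
  (forall y, Om y -> 0 <= G y) -> (forall h, h \in s -> G x <= C * hp h x) -> m != 0 ->
  exists2 h, h \in s & dot (vz m) (vz m) <= C * dot (vz h.1) (vz m).
Proof.
move=> hx sm G0 hC m0; pose u := (- (vz m).1, - (vz m).2).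
have dotu p : dot p u = - dot p (vz m) := dot_opp p (vz m).
have mm := dot_gt0 (vz_neq0 R m0).
have u0 : u != 0 by rewrite -[u]/(- vz m) oppr_eq0 vz_neq0.
have [h hh hu] := exit_side (Omi_sub hx) u0.
have [||t0 tp [_ hge [b hb hb0]]] := @first_zero R [seq (hp h x, dot (vz h.1) u) | h <- s].
- by move=> _ /mapP[h' hh' ->] /=; left; move/OmiP: hx; apply.
- by exists (hp h x, dot (vz h.1) u) => //; apply/mapP; exists h.
have hy : Om (ray x u t0).
  apply/OmP => h' hh'; rewrite hp_ray.
  by apply: (hge (hp h' x, dot (vz h'.1) u)); apply/mapP; exists h'.
move/mapP: hb hb0 => [h' hh' ->] /= h0.
exists h' => //; have := sm _ hy; have := G0 _ hy; have := hC _ hh'.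
have -> : dot (vz m) (ray x u t0 - x) = t0 * dot (vz m) u by rewrite dot_sub dot_ray; ring.
rewrite dotu => h1 h2 h3; move: h0; rewrite dotu => h0.
have h4 : hp h' x = t0 * dot (vz h'.1) (vz m) by lra.
have : 0 <= t0 * (C * dot (vz h'.1) (vz m) - dot (vz m) (vz m)).
  by rewrite mulrBr mulrCA -h4; lra.
by rewrite pmulr_rge0 // subr_ge0.
Qed.

(** The slope bound confines the gradients below the barrier to a finite set. *)
Lemma slope_box C : 0 <= C -> exists l : seq (int * int), forall G x m,
  Om° x -> supergrad G x m -> (forall y, Om y -> 0 <= G y) ->
  (forall h, h \in s -> G x <= C * hp h x) -> m \in l.
Proof.
move=> C0; have [D D0 hD] := seq_bound s (fun h => `|h.1.1%:~R| + `|h.1.2%:~R| : R).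
have [l hl] := int_box (C * D); exists l => G x m hx sm G0 hC.
have CD0 : 0 <= C * D by rewrite mulr_ge0.
have [->|m0] := eqVneq m 0; first by apply: hl; rewrite normr0.
have key (n1 n2 a b : R) : `|n1| + `|n2| <= D -> `|b| <= `|a| ->
    a * a + b * b <= C * (n1 * a + n2 * b) -> `|a| <= C * D.
  move=> hn hba h1; have [a0|an0] := eqVneq a 0; first by rewrite a0 normr0.
  have ap : 0 < `|a| by rewrite normr_gt0.
  rewrite -(ler_pM2r ap) -normrM ger0_norm -?expr2 ?sqr_ge0 // expr2.
  apply: (@le_trans _ _ (C * (n1 * a + n2 * b))).
    by apply: le_trans h1; rewrite lerDl -expr2 sqr_ge0.
  rewrite -mulrA ler_wpM2l //.
  have := ler_norm (n1 * a); have := ler_norm (n2 * b); rewrite !normrM => e1 e2.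
  have := ler_wpM2l (normr_ge0 n2) hba; have := ler_wpM2r (normr_ge0 a) hn.
  by rewrite mulrDl; lra.
have [h hh] := slope_bound hx sm G0 hC m0; have := hD _ hh.
rewrite /dot /vecz /= => hn h1; have [hba|/ltW hab] := leP `|m.2%:~R : R| `|m.1%:~R|.
  by have h2 := key _ _ _ _ hn hba h1; apply: hl => //; apply: le_trans h2.
rewrite addrC in hn; rewrite addrC [X in C * X]addrC in h1.
have h2 := key _ _ _ _ hn hab h1.
by apply: hl => //; apply: le_trans h2.
Qed.

Section Relaxation.
Variables (N : nat) (P : 'I_N -> R * R).
Hypothesis hP : forall i, Om° (P i).
Let F := relaxation_at Om P.
Let cand G := tropical_series Om G /\ range P `<=` corner_locus Om G.
Let vals x := [set y | exists G,
  [/\ tropical_series Om G, range P `<=` corner_locus Om G & y = G x]].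

(** The relaxation of a finite set of interior points is a minimum of finitely
    many affine functions with integral gradients: all series below the barrier
    have their gradients in one finite set, so that a supergradient of the
    infimum is found by the pigeonhole principle. *)
Theorem relaxation_poly : exists (B : seq (int * int)) (c : int * int -> R),
  [/\ forall x m, Om x -> m \in B -> F x <= c m + dot (vz m) x,
      forall x, Om x -> exists2 m, m \in B & F x = c m + dot (vz m) x,
      (forall x, bd Om x -> F x = 0) /\ (forall x, Om x -> 0 <= F x),
      forall i, exists m m', [/\ m \in B, m' \in B, m != m',
        F (P i) = c m + dot (vz m) (P i) & F (P i) = c m' + dot (vz m') (P i)]
    & forall G, tropical_series Om G -> range P `<=` corner_locus Om G ->
        forall x, Om x -> F x <= G x].
Proof.
have [|G0 [K0 [C [hG0 sG0 tG0 C0 hC]]]] := @barrier (map P (enum 'I_N)).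
  by move=> p /mapP[i _ ->].
have cG0 : cand G0.
  split=> // _ [i _ <-]; apply: (lmin_corner hG0) => //; apply: tG0.
  by apply: map_f; rewrite mem_enum.
have G_ge0 G : cand G -> forall y, Om y -> 0 <= G y by move=> [[_ h _ _] _].
have val0 x : Om x -> has_inf (vals x).
  move=> hx; split; first by exists (G0 x), G0; case: cG0.
  by exists 0 => _ [G [h1 h2 ->]]; apply: G_ge0.
have FleG G x : cand G -> Om x -> F x <= G x.
  by move=> [h1 h2] hx; apply: ge_inf; [case: (val0 x hx)|exists G].
have F_ge0 x : Om x -> 0 <= F x.
  move=> hx; apply: lb_le_inf; first by case: (val0 x hx).
  by move=> _ [G [h1 h2 ->]]; apply: G_ge0.
have F_adh x e : Om x -> 0 < e -> exists2 G, cand G & G x < F x + e.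
  move=> hx e0; have [_ [G [h1 h2 ->] h3]] := inf_adherent e0 (val0 x hx).
  by exists G.
have F_bd x : bd Om x -> F x = 0.
  move=> hx; have [hxO _] := hx; apply/eqP; rewrite eq_le F_ge0 // andbT.
  by have [[_ _ h0 _] _] := cG0; rewrite -(h0 _ hx) FleG.
have [box hbox] := slope_box C0.
(* [two] asks for the second supergradient that is present at a marked point. *)
have super (two : bool) x : Om° x -> (two -> exists i, x = P i) ->
    exists m m', [/\ m \in box, m' \in box, two ==> (m != m'),
                    supergrad F x m & supergrad F x m'].
  move=> hx htwo; have hxO := Omi_sub hx.
  have one G : cand G -> G x <= G0 x -> exists m m',
      [/\ m \in box, m' \in box, two ==> (m != m'), supergrad G x m & supergrad G x m'].
    move=> cG hle; have [[_ _ _ lG] hPG] := cG.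
    have inbox m : supergrad G x m -> m \in box.
      move=> sm; apply: (hbox G x) => //; first exact: G_ge0.
      by move=> h hh; apply: le_trans hle _; apply: hC.
    have sG := cG.1.
    case: two htwo => [/(_ isT)[i ex]|_].
      have [|_ [A [c [hA [m [m' [Am Am' ne e e']]]]]]] := hPG x; first by exists i.
      have h1 := series_supergrad sG hx hA Am e; have h2 := series_supergrad sG hx hA Am' e'.
      by exists m, m'; split=> //=; [apply: inbox|apply: inbox|apply/eqP].
    have [A [c hA]] := lG _ hx; have [_ hA'] := hA.
    have [_ [m Am e]] := nbhs_singleton hA'.
    have h1 := series_supergrad sG hx hA Am e.
    by exists m, m; split=> //; apply: inbox.
  (* Otherwise every pair of gradients of the box violates the supergradient
     inequality for [F] by a positive margin, and a candidate that is closer to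
     [F] at [x] than all these margins has no supergradients there. *)
  apply: contrapT => hn; pose L := [seq (m, m') | m <- box, m' <- box].
  have [[m m'] hmm|e e0 he] := @seq_eps R _ L (fun q e' => ~~ (two ==> (q.1 != q.2)) \/
     exists y, Om y /\ (F x + e' + dot (vz q.1) (y - x) < F y \/
                        F x + e' + dot (vz q.2) (y - x) < F y)).
    have /allpairsP[[m1 m2] /= [h1 h2 [e1 e2]]] := hmm; rewrite -e1 -e2 in h1 h2.
    have [h3|h3] := boolP (two ==> (m != m')); last by exists 1 => // *; left.
    have [n1|n1] := pselect (supergrad F x m); last first.
      move/existsNP: n1 => [y /not_implyP[hy /negP]]; rewrite -ltNge => hlt.
      exists ((F y - (F x + dot (vz m) (y - x))) / 2); first by lra.
      by move=> e' /andP[p0 p1]; right; exists y; split=> //; left; rewrite /=; lra.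
    have [n2|n2] := pselect (supergrad F x m'); last first.
      move/existsNP: n2 => [y /not_implyP[hy /negP]]; rewrite -ltNge => hlt.
      exists ((F y - (F x + dot (vz m') (y - x))) / 2); first by lra.
      by move=> e' /andP[p0 p1]; right; exists y; split=> //; right; rewrite /=; lra.
    by case: hn; exists m, m'.
  have [G cG hlt] := F_adh x e hxO e0.
  suff [G' [cG' hle hlt']] : exists G', [/\ cand G', G' x <= G0 x & G' x < F x + e].
    have [m [m' [i1 i2 tw s1 s2]]] := one _ cG' hle.
    have i3 : (m, m') \in L by apply: (allpairs_f pair).
    have e3 : 0 < e <= e by rewrite e0 lexx.
    have [|[y [hy /= h]]] := he _ _ i3 e3; first by rewrite /= tw.
    have := FleG _ _ cG' hy; have := s1 y hy; have := s2 y hy.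
    by case: h => h; lra.
  by have [h|/ltW h] := leP (G x) (G0 x); [exists G|exists G0; split=> //; apply: le_lt_trans hlt].
pose B := [seq m <- box | `[< exists2 x, Om° x & supergrad F x m >]].
have /choice[c hc] : forall m, exists r : R, m \in B ->
    exists x, [/\ Om° x, supergrad F x m & r = F x - dot (vz m) x].
  move=> m; have [|_] := boolP (m \in B); last by exists 0.
  by rewrite mem_filter => /andP[/asboolP[x hx sx] _]; exists (F x - dot (vz m) x) => _; exists x.
have upper x m : Om x -> m \in B -> F x <= c m + dot (vz m) x.
  by move=> hx /hc[x0 [hx0 /(_ x hx) + ->]]; rewrite dot_sub; lra.
have inB x m : Om° x -> m \in box -> supergrad F x m ->
    m \in B /\ F x = c m + dot (vz m) x.
  move=> hx hm sm; have hB : m \in B by rewrite mem_filter hm andbT; apply/asboolP; exists x.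
  split=> //; apply/eqP; rewrite eq_le (upper _ _ (Omi_sub hx) hB) /=.
  by have [x0 [/Omi_sub/sm + _ ->]] := hc _ hB; rewrite dot_sub; lra.
have attained y0 : Om° y0 -> exists2 m, m \in B & F y0 = c m + dot (vz m) y0.
  by move=> hx; have [//|m [_ [hm _ _ sm _]]] := super false y0 hx; have [h1 h2] := inB _ _ hx hm sm; exists m.
exists B, c; split=> //.
- move=> x hx; have [/attained //|nx] := pselect (Om° x).
  have bx : bd Om x by []; rewrite (F_bd _ bx).
  (* If no function of [B] vanished at [x], all of them, and hence [F], would exceed
     the barrier at interior points near [x], where it is at most [C * hp h]. *)
  apply: contrapT => hn.
  have pos m : m \in B -> 0 < c m + dot (vz m) x.
    move=> hm; rewrite lt0r -{2}(F_bd _ bx) upper // andbT.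
    by apply/eqP => e; apply: hn; exists m.
  have [w hw] := Om0; have [_ [h hh h0]] := (bdP x).1 bx.
  have hw' : 0 < hp h w by move/OmiP: hw; apply.
  have [m hm|e e0 he] := @seq_eps R _ B (fun m e => e <= 1 /\
      0 < c m + dot (vz m) (ray x (w - x) e) - C * (e * hp h w)).
    have := pos m hm; set a := c m + _ => a0.
    set b := dot (vz m) (w - x) - C * hp h w.
    exists (Num.min 1 (a / (1 + `|b|) / 2)).
      by rewrite lt_min ltr01 /= !divr_gt0 // ltr_pwDl.
    move=> e' /andP[e0']; rewrite le_min => /andP[e1 e2]; split=> //.
    rewrite dot_ray addrA -/a (_ : _ - _ = a + e' * b); last by rewrite /b; ring.
    have hb : 0 < 1 + `|b| by rewrite ltr_pwDl.
    have h3 : e' * (1 + `|b|) <= a / 2.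
      by have := ler_wpM2r (ltW hb) e2; rewrite mulrAC divfK ?gt_eqF.
    have h4 : - (e' * `|b|) <= e' * b.
      by rewrite -mulrN ler_wpM2l ?(ltW e0') // lerNl ler_normr lexx orbT.
    rewrite mulrDr mulr1 in h3; lra.
  have [m0 hm0 _] := attained w hw.
  have [e1 _] := he m0 e hm0 ltac:(by rewrite e0 lexx).
  pose y := ray w (x - w) (1 - e).
  have hy : Om° y by apply: Omi_convex => //; apply/andP; lra.
  have ey : y = ray x (w - x) e by rewrite /y /ray /=; congr pair; ring.
  have [m hm em] := attained _ hy.
  have [_] := he m e hm ltac:(by rewrite e0 lexx).
  have := FleG _ _ cG0 (Omi_sub hy); have := hC h y hh (Omi_sub hy).
  rewrite em ey (_ : hp h (ray x (w - x) e) = e * hp h w); last first.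
    by rewrite hp_ray h0 add0r dot_sub; congr (_ * _); move: h0; rewrite /hp; lra.
  lra.
- move=> i; have [_|m [m' [hm hm' ne sm sm']]] := super true (P i) (hP i); first by exists i.
  have [h1 h2] := inB _ _ (hP i) hm sm; have [h3 h4] := inB _ _ (hP i) hm' sm'.
  by exists m, m'.
- by move=> G h1 h2 x hx; apply: FleG.
Qed.

End Relaxation.

End Series.

(** * Active gradients and the corner locus *)

(** On [Om], the function [F] is the minimum of the affine functions [mono m] with
    [m] in [B]. It is kept abstract because the genericity argument compares the
    relaxations of two configurations. *)
Section TropicalPolynomial.
Variable R : realType.
Local Notation vz := (@vecz R).
Variables (s : seq ((int * int) * R)) (Om : set (R * R)).
Hypothesis prim_s : all (fun h => primitive h.1) s.
Hypothesis OmE : Om = [set x | forall h, h \in s -> 0 <= dot (vz h.1) x + h.2].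
Hypothesis cOm : compact Om.
Variables (B : seq (int * int)) (c : int * int -> R) (F : R * R -> R).

Definition mono m x : R := c m + dot (vz m) x.

Hypothesis F_le : forall x m, Om x -> m \in B -> F x <= mono m x.
Hypothesis F_at : forall x, Om x -> exists2 m, m \in B & F x = mono m x.
Variable ps : seq (R * R).
Implicit Types (x y z u v p : R * R) (m k : int * int) (e : piece_type R) (sg b : bool).

Let OmiP := OmiP prim_s OmE.
Let Omi_convex := Omi_convex prim_s OmE.
Let Om_convex := Om_convex OmE.
Let exit_side := exit_side OmE cOm.
Let OmP := OmP OmE.
Let bdP := bdP prim_s OmE.
Let vz_neq0 := @vz_neq0 R.

Definition act x m : bool := (m \in B) && (F x == mono m x).

Lemma mono_ray m x u t : mono m (ray x u t) = mono m x + t * dot (vz m) u.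
Proof. by rewrite /mono dot_ray; ring. Qed.

Lemma actE x m : act x m -> F x = mono m x.
Proof. by case/andP => _ /eqP. Qed.

Lemma actB x m : act x m -> m \in B.
Proof. by case/andP. Qed.

Lemma act_le x m k : Om x -> act x m -> k \in B -> mono m x <= mono k x.
Proof. by move=> hx /actE <-; apply: F_le. Qed.

Lemma act_ex x : Om x -> exists m, act x m.
Proof. by move=> /F_at[m hm e]; exists m; rewrite /act hm e eqxx. Qed.

Lemma act_of_le x m : Om x -> m \in B -> (forall k, k \in B -> mono m x <= mono k x) -> act x m.
Proof.
move=> hx hm h; rewrite /act hm /=; have [k hk e] := F_at hx.
by rewrite eq_le F_le //= e h.
Qed.

Lemma act_eq x m k : Om x -> act x m -> k \in B -> mono k x = mono m x -> act x k.
Proof. by move=> hx hm hk e; rewrite /act hk (actE hm) e eqxx. Qed.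

Lemma mono_sub m k x y : mono m x = mono k x -> mono m y = mono k y ->
  dot (vz (m - k)) (y - x) = 0.
Proof. by rewrite /mono vz_sub !dot_sub => h1 h2; lra. Qed.

Lemma near_act x : Om° x ->
  \forall y \near x, Om° y /\ forall m, act y m -> act x m.
Proof.
move=> hx; have [m0 hm0] := act_ex (Omi_sub hx).
have h1 : \forall y \near x, Om° y by apply: open_nbhs_nbhs; split; [exact: open_interior|].
have h2 : \forall y \near x, forall k, k \in [seq k <- B | ~~ act x k] -> mono m0 y < mono k y.
  apply: near_seq => k; rewrite mem_filter => /andP[nk hk].
  have : 0 < (c k - c m0) + dot (vz (k - m0)) x.
    have h : mono m0 x < mono k x.
      rewrite lt_neqAle (act_le (Omi_sub hx) hm0 hk) andbT.
      by apply: contra nk => /eqP e; apply: act_eq hm0 hk _ => //; apply: Omi_sub.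
    by move: h; rewrite /mono vz_sub; lra.
  by move/near_aff; apply: filterS => y; rewrite /mono vz_sub; lra.
apply: filterS2 h1 h2 => y hy h; split=> // m hm; apply: contraT => nm.
have := h m; rewrite mem_filter nm (actB hm) => /(_ isT).
by rewrite ltNge (act_le (Omi_sub hy) hm) // (actB hm0).
Qed.

(** Where one affine function is active, [F] has no other supergradient. *)
Lemma local_form_unique x A c' m : Om° x -> local_min_form F x A c' -> A m ->
  F x = c' m + dot (vz m) x -> exists k, act x k /\
  ((forall k', act x k' -> k' = k) -> m = k).
Proof.
move=> hx [_ hA] Am e; have [k hk] := act_ex (Omi_sub hx); exists k; split=> // hu.
have h : \forall y \near x, mono k y <= c' m + dot (vz m) y.
  apply: filterS2 (near_act hx) hA => y [hy hact] [/(_ m Am) h1 _].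
  have [k' hk'] := act_ex (Omi_sub hy).
  by rewrite -(hu k' (hact _ hk')) -(actE hk').
apply/eqP; rewrite -subr_eq0; apply/eqP/vz_eq0 => u.
have [d d0 []] := near_ray2 u h; rewrite !mono_ray !dot_ray -(actE hk) e => h1 h2.
by apply: (pmul_eq0 d0); rewrite vz_sub; lra.
Qed.

Lemma cornerP x : corner_locus Om F x <->
  Om° x /\ exists m m', [/\ act x m, act x m' & m != m'].
Proof.
split=> [[hx [A [c' [hA [m [m' [Am Am' ne e e']]]]]]]|[hx [m [m' [hm hm' ne]]]]]; split=> //.
  apply: contrapT => hn.
  have [k [hk hu]] := local_form_unique hx hA Am e.
  have [k' [hk' hu']] := local_form_unique hx hA Am' e'.
  have all1 l l' : act x l -> act x l' -> l = l'.
    by move=> h1 h2; apply/eqP; apply: contraT => h3; case: hn; exists l, l'.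
  apply: ne; rewrite hu ?hu'; first exact: all1.
    by move=> l hl; apply: all1.
  by move=> l hl; apply: all1.
exists [set` B], c; split; last first.
  exists m, m'; split; [exact: actB hm|exact: actB hm'|exact/eqP|exact: actE|exact: actE].
split; first exact: finite_seq.
have h1 : \forall y \near x, Om° y by apply: open_nbhs_nbhs; split; [exact: open_interior|].
apply: filterS h1 => y /Omi_sub hy; split=> [k hk|]; first exact: F_le.
exact: F_at.
Qed.

(** The superdifferential is two-dimensional iff the active gradients are not
    collinear; otherwise [F] is affine along the normal of their line. *)
Lemma vertexP x : graph_vertex Om F x <->
  Om° x /\ exists m0 m1 m2, [/\ act x m0, act x m1, act x m2 &
             cross (vz (m1 - m0)) (vz (m2 - m0)) != 0].
Proof.
split=> [[hx [p [q [r [hp hq hr ne]]]]]|[hx [m0 [m1 [m2 [h0 h1 h2 ne]]]]]]; split=> //; last first.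
  have sup m : act x m -> superdifferential Om F x (vz m).
    by move=> hm y hy; have := F_le hy (actB hm); rewrite (actE hm) /mono dot_sub; lra.
  by exists (vz m0), (vz m1), (vz m2); split; [exact: sup|exact: sup|exact: sup|rewrite -!vzB].
apply: contrapT => hn; have hxO := Omi_sub hx; have [m0 hm0] := act_ex hxO.
have [u u0 hu] : exists2 u, u != 0 & forall m, act x m -> dot (vz m) u = dot (vz m0) u.
  have [[m1 [hm1 ne1]]|nm] := pselect (exists m1, act x m1 /\ m1 != m0).
    have p0 : vz (m1 - m0) != 0 by rewrite vz_neq0 // subr_eq0.
    exists (perp (vz (m1 - m0))).
      exact: perp_neq0.
    move=> m2 hm2; apply/eqP; rewrite -subr_eq0 -vz_sub; apply/eqP.
    apply: (cross_dot0 p0); first by rewrite /dot /perp /=; ring.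
    by apply/eqP; apply: contraT => h; case: hn; exists m0, m1, m2.
  exists (1, 0); first by apply/eqP => -[/eqP]; rewrite oner_eq0.
  move=> m hm; congr (dot (vz _) _); apply/eqP; apply: contraT => h.
  by case: nm; exists m.
have [d d0 hd] := near_ray u (near_act hx).
have lin t : `|t| <= d -> Om (ray x u t) /\ F (ray x u t) = F x + t * dot (vz m0) u.
  move=> /hd[/Omi_sub hy hact]; split=> //; have [m hm] := act_ex hy.
  by rewrite (actE hm) mono_ray (hu _ (hact _ hm)) -(actE (hact _ hm)).
have sup a : superdifferential Om F x a -> dot a u = dot (vz m0) u.
  move=> ha; have [|h1 e1] := lin d; first by rewrite gtr0_norm.
  have [|h2 e2] := lin (- d); first by rewrite normrN gtr0_norm.
  have := ha _ h1; have := ha _ h2; rewrite e1 e2 !dot_sub !dot_ray => h3 h4.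
  have : d * dot a u = d * dot (vz m0) u by apply/eqP; rewrite eq_le; apply/andP; lra.
  by move/mulfI; apply; rewrite gt_eqF.
move/eqP: ne; apply; apply: (dot0_cross u0).
  by rewrite /dot /= !mulrBl addrACA -opprD -/(dot q u) -/(dot p u) !sup // subrr.
by rewrite /dot /= !mulrBl addrACA -opprD -/(dot r u) -/(dot p u) !sup // subrr.
Qed.

Definition cutpt x := graph_vertex Om F x \/ x \in ps.

(** Going from [x] in a direction [u] in which two active gradients are minimal,
    exactly the minimal ones stay active until another affine function comes down
    to them, which makes a vertex, or a mark or the boundary is met: the corner
    locus contains a segment from [x] to this point. *)
Lemma ray_end x u m m' : Om° x -> u != 0 -> act x m -> act x m' -> m != m' ->
  dot (vz m') u = dot (vz m) u -> (forall k, act x k -> dot (vz m) u <= dot (vz k) u) ->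
  exists2 t0, 0 < t0 & [/\ Om (ray x u t0), cutpt (ray x u t0) \/ bd Om (ray x u t0) &
    forall t, 0 < t < t0 -> [/\ Om° (ray x u t), ~ cutpt (ray x u t) &
      forall k, act (ray x u t) k = act x k && (dot (vz k) u == dot (vz m) u)]].
Proof.
move=> hx u0 hm hm' ne em' hmin; have hxO := Omi_sub hx; have uu := dot_gt0 u0.
pose A k := act x k && (dot (vz k) u == dot (vz m) u).
pose T p := dot u (p - x) / dot u u.
have TE t : T (ray x u t) = t.
  by rewrite /T dot_sub dot_ray addrAC subrr add0r mulfK // gt_eqF.
pose L1 := [seq (hp h x, dot (vz h.1) u) | h <- s].
pose L2 := [seq (mono k x - mono m x, dot (vz k) u - dot (vz m) u) | k <- B & ~~ A k].
pose L3 : seq (R * R) := [seq (T p, - 1) | p <- ps & (p == ray x u (T p)) && (0 < T p)].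
have [| |t0 t0p [hlt hle [a ha a0]]] := @first_zero R (L1 ++ L2 ++ L3).
- move=> a; rewrite !mem_cat => /or3P[] /mapP.
  + by move=> [h hh ->] /=; left; move/OmiP: hx; apply.
  + move=> [k + ->] /=; rewrite mem_filter => /andP[nA hk].
    have := act_le hxO hm hk; rewrite le_eqVlt => /orP[/eqP e|]; last by left; lra.
    have ak : act x k by apply: act_eq hm hk _.
    right; split; first lra.
    rewrite subr_gt0 lt_neqAle hmin // andbT.
    by apply: contra nA => /eqP e'; rewrite /A ak e' eqxx.
  + by move=> [p + ->] /=; rewrite mem_filter => /andP[/andP[_ h] _]; left.
- have [h hh hu] := exit_side hxO u0; exists (hp h x, dot (vz h.1) u) => //.
  by rewrite mem_cat; apply/orP; left; apply/mapP; exists h.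
have in1 h : h \in s -> (hp h x, dot (vz h.1) u) \in L1 ++ L2 ++ L3.
  by move=> hh; rewrite mem_cat; apply/orP; left; apply/mapP; exists h.
have in2 k : k \in B -> ~~ A k ->
    (mono k x - mono m x, dot (vz k) u - dot (vz m) u) \in L1 ++ L2 ++ L3.
  move=> hk nA; rewrite !mem_cat; apply/or3P/Or32/mapP; exists k => //.
  by rewrite mem_filter nA.
have monoA k t : A k -> mono k (ray x u t) = mono m (ray x u t).
  by move=> /andP[hk /eqP e]; rewrite !mono_ray e -(actE hk) -(actE hm).
have actm t : Om (ray x u t) ->
    (forall k, k \in B -> ~~ A k -> 0 <= mono k x - mono m x + t * (dot (vz k) u - dot (vz m) u)) ->
    act (ray x u t) m.
  move=> hO h; apply: act_of_le => //; first exact: actB hm.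
  move=> k hk; have [Ak|nA] := boolP (A k); first by rewrite monoA.
  by have := h k hk nA; rewrite !mono_ray; lra.
have hz : Om (ray x u t0).
  by apply/OmP => h hh; rewrite hp_ray; apply: (hle _ (in1 h hh)).
have inside t : 0 < t < t0 -> Om° (ray x u t).
  by move=> ht; apply/OmiP => h hh; rewrite hp_ray; apply: (hlt _ _ ht (in1 h hh)).
have act_in t : 0 < t < t0 -> forall k, act (ray x u t) k = A k.
  move=> ht k; have hO := Omi_sub (inside t ht).
  have hmt : act (ray x u t) m.
    by apply: actm => // k' hk' nA; apply/ltW/(hlt _ _ ht (in2 _ hk' nA)).
  have [Ak|nA] := boolP (A k).
    by apply: act_eq hmt _ _ => //; [case/andP: Ak => /actB|apply: monoA].
  apply/negP => hk; have := hlt _ _ ht (in2 _ (actB hk) nA) => /=.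
  by have := act_le hO hk (actB hmt); rewrite !mono_ray; lra.
exists t0 => //; split=> //; last first.
  move=> t ht; split; [exact: inside| |exact: act_in].
  move=> [/vertexP[_ [m0 [m1 [m2 []]]]]|hp].
    rewrite !act_in // => /andP[_ /eqP e0] /andP[_ /eqP e1] /andP[_ /eqP e2] /eqP; apply.
    by apply: (dot0_cross u0); rewrite vz_sub ?e0 ?e1 ?e2 subrr.
  have := hlt _ (t, - 1) ht; rewrite !mem_cat => /(_ _)/=.
  have -> : (t, - 1) \in L3.
    apply/mapP; exists (ray x u t); last by rewrite TE.
    by rewrite mem_filter TE eqxx hp andbT; case/andP: ht.
  by rewrite !orbT mulrN mulr1 subrr ltxx => /(_ isT).
have [hzi|nzi] := pselect (Om° (ray x u t0)); last by right.
left; move: ha a0; rewrite !mem_cat => /or3P[] /mapP.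
- move=> [h hh ->] /= h0; move/OmiP: hzi => /(_ h hh).
  by rewrite hp_ray h0 ltxx.
- move=> [k + ->] /=; rewrite mem_filter => /andP[nA hk] h0; left; apply/vertexP; split=> //.
  have hmt : act (ray x u t0) m.
    by apply: actm => // k' hk' nA'; apply: (hle _ (in2 _ hk' nA')).
  have hmt' : act (ray x u t0) m'.
    by apply: act_eq hmt (actB hm') (monoA _ _ _) => //; rewrite /A hm' em' eqxx.
  have hkt : act (ray x u t0) k.
    by apply: act_eq hmt hk _ => //; rewrite !mono_ray; lra.
  exists m, m', k; split=> //; apply/eqP => cr.
  have ku : dot (vz k) u = dot (vz m) u.
    apply/eqP; rewrite -subr_eq0 -vz_sub; apply/eqP; apply: (cross_dot0 _ _ cr).
      by rewrite vz_neq0 // subr_eq0 eq_sym.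
    by rewrite vz_sub em' subrr.
  case/negP: nA; rewrite /A ku eqxx andbT; apply: act_eq hm hk _ => //.
  by move: h0; rewrite ku; lra.
- move=> [p + ->] /=; rewrite mem_filter => /andP[/andP[/eqP ep _] hp] h0; right.
  by have <- : T p = t0; [lra|rewrite -ep].
Qed.

(** * Pieces of the cut corner locus *)

Definition piece := segments_cut_by Om F (graph_vertex Om F `|` [set` ps]).

Lemma pieceP e : piece e <-> [/\ lex_lt e.1 e.2,
  forall x, open_segment e.1 e.2 x -> corner_locus Om F x /\ ~ cutpt x,
  cutpt e.1 \/ bd Om e.1 & cutpt e.2 \/ bd Om e.2].
Proof. by split=> -[h1 h2 h3 h4]; split=> // x /h2. Qed.

Definition opens e := open_segment e.1 e.2.

Lemma piece_interior e x : piece e -> opens e x -> Om° x.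
Proof. by move=> /pieceP[_ h _ _] /h[[]]. Qed.

Lemma piece_end e x : piece e -> x = e.1 \/ x = e.2 -> cutpt x \/ bd Om x.
Proof. by move=> /pieceP[_ _ h1 h2] [] ->. Qed.

Lemma piece_neq e : piece e -> e.1 != e.2.
Proof. by move=> /pieceP[/lex_lt_neq]. Qed.

Lemma mk_piece x y : x != y -> cutpt x \/ bd Om x -> cutpt y \/ bd Om y ->
  (forall z, open_segment x y z -> corner_locus Om F z /\ ~ cutpt z) ->
  exists2 e, piece e & (e = (x, y) \/ e = (y, x)) /\
    (forall z, opens e z <-> open_segment x y z).
Proof.
move=> ne hx hy h; case: (lex_ltP ne) => hl.
  by exists (x, y); [apply/pieceP|split=> //; left].
exists (y, x); first by apply/pieceP; split=> // z /open_segmentC; apply: h.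
by split; [right|move=> z; split; apply: open_segmentC].
Qed.

(** Away from the vertices the active gradients are collinear, and the corner locus
    runs along the normal of their line. *)
Lemma regular_dir x : corner_locus Om F x -> ~ graph_vertex Om F x ->
  exists u m m', [/\ u != 0, act x m, act x m', m != m' &
    forall k, act x k -> dot (vz k) u = dot (vz m) u].
Proof.
move=> /cornerP[hx [m [m' [hm hm' ne]]]] nv.
have p0 : vz (m' - m) != 0 by rewrite vz_neq0 // subr_eq0 eq_sym.
exists (perp (vz (m' - m))), m, m'; split=> //; first exact: perp_neq0.
move=> k hk; apply/eqP; rewrite -subr_eq0 -vz_sub; apply/eqP.
apply: (cross_dot0 p0); first by rewrite /dot /perp /=; ring.
apply/eqP; apply: contraT => h; case: nv; apply/vertexP; split=> //.
by exists m, m', k.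
Qed.

(** Extend from [x] both ways along the corner locus, up to the first cut point or
    the boundary. *)
Lemma piece_through x : corner_locus Om F x -> ~ cutpt x ->
  exists2 e, piece e & opens e x /\ forall y, opens e y -> forall k, act y k = act x k.
Proof.
move=> hV nS; have [hx _] := (cornerP x).1 hV.
have nv : ~ graph_vertex Om F x by move=> h; apply: nS; left.
have [u [m [m' [u0 hm hm' ne hu]]]] := regular_dir hV nv.
have [||t1 t1p [_ hz1 in1]] := ray_end hx u0 hm hm' ne; first exact: hu.
  by move=> k /hu ->.
have nu0 : - u != 0 by rewrite oppr_eq0.
have [||t2 t2p [_ hz2 in2]] := ray_end hx nu0 hm hm' ne.
- by rewrite !dot_opp hu.
- by move=> k /hu; rewrite !dot_opp => ->.
have rN t : ray x (- u) t = ray x u (- t) by rewrite /ray /=; congr pair; ring.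
have hin t : - t2 < t < t1 -> corner_locus Om F (ray x u t) /\ ~ cutpt (ray x u t) /\
    forall k, act (ray x u t) k = act x k.
  move=> /andP[h1 h2].
  suff [h3 h4 h5] : [/\ Om° (ray x u t), ~ cutpt (ray x u t) &
      forall k, act (ray x u t) k = act x k].
    by split=> //; apply/cornerP; split=> //; exists m, m'; rewrite !h5.
  case: (ltgtP 0 t) => [tp|tn|<-]; last by rewrite ray0.
    have [|h3 h4 h5] := in1 t; first by apply/andP.
    by split=> // k; rewrite h5; case: (boolP (act x k)) => //= /hu ->; rewrite eqxx.
  have [|] := in2 (- t); first by apply/andP; lra.
  rewrite rN opprK => h3 h4 h5; split=> // k; rewrite h5 !dot_opp eqr_opp.
  by case: (boolP (act x k)) => //= /hu ->; rewrite eqxx.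
have zne : ray x u (- t2) != ray x u t1 by apply/eqP => /(ray_inj u0); lra.
have zin y : open_segment (ray x u (- t2)) (ray x u t1) y ->
    exists2 t, - t2 < t < t1 & y = ray x u t.
  move=> /open_segmentP[t /andP[h1 h2] ->]; exists (- t2 + t * (t1 + t2)).
    have := mulr_gt0 h1 (addr_gt0 t1p t2p); have h3 : 0 < 1 - t by lra.
    by have := mulr_gt0 h3 (addr_gt0 t1p t2p) => h4 h5; apply/andP; lra.
  by rewrite /ray /=; congr pair; ring.
have hz2' : cutpt (ray x u (- t2)) \/ bd Om (ray x u (- t2)) by rewrite -rN.
have [|e pe [_ oe]] := mk_piece zne hz2' hz1.
  by move=> y /zin[t /hin[h1 [h2 _]] ->].
exists e => //; split.
  apply/oe/open_segmentP; exists (t2 / (t1 + t2)).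
    by rewrite divr_gt0 ?addr_gt0 //= ltr_pdivrMr ?addr_gt0 //; lra.
  have tt : t1 + t2 != 0 by rewrite gt_eqF // addr_gt0.
  by rewrite /ray /=; case: (x) => ? ? /=; congr pair; field.
by move=> y /oe/zin[t /hin[_ [_ h]] ->].
Qed.

(** The piece through a point is unique, because its direction is forced by the
    active gradients and its ends are the first cut points met. *)
Lemma piece_through_uniq x e e0 : piece e0 -> opens e0 x ->
  (forall y, opens e0 y -> forall k, act y k = act x k) ->
  piece e -> opens e x -> e = e0.
Proof.
move=> pe0 ox0 act0 pe ox.
have [l0 in0 b01 b02] := (pieceP e0).1 pe0; have [l1 in1 b11 b12] := (pieceP e).1 pe.
have hx := piece_interior pe ox.
have [t /andP[tp t1] ext] := (open_segmentP _ _ _).1 ox.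
have [r /andP[rp r1] exr] := (open_segmentP _ _ _).1 ox0.
have d00 : e0.2 - e0.1 != 0 by rewrite subr_eq0 eq_sym piece_neq.
have [d dE] : exists d, d = e.2 - e.1 by exists (e.2 - e.1).
have [d0 d0E] : exists d0, d0 = e0.2 - e0.1 by exists (e0.2 - e0.1).
rewrite -dE in ext; rewrite -d0E in exr d00.
have near_in (a : R * R) w q : 0 < q < 1 -> exists2 h, 0 < h & 0 < q + h < 1 /\
    ray (ray a w q) w h = ray a w (q + h).
  move=> /andP[q0 q1]; exists ((1 - q) / 2); first by lra.
  by split; [apply/andP; lra|rewrite ray_ray].
have [h hp [hh eh]] := near_in e.1 d t ltac:(by rewrite tp).
have [h' hp' [hh' eh']] := near_in e0.1 d0 r ltac:(by rewrite rp).
have [dl dl0 hd] := near_ray d (near_act hx).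
pose g := Num.min h dl.
have gp : 0 < g by rewrite lt_min hp.
have gh : g <= h by rewrite ge_min lexx.
have gd : `|g| <= dl by rewrite gtr0_norm // ge_min lexx orbT.
have oy : opens e (ray x d g).
  apply/open_segmentP; exists (t + g); first by apply/andP; lra.
  by rewrite -dE ext /ray /=; congr pair; ring.
have [/cornerP[hyi [m [m' [hm hm' ne]]]] _] := in1 _ oy.
have [_ hact] := hd g gd; have hmx := hact _ hm; have hmx' := hact _ hm'.
have p0 : vz (m - m') != 0 by rewrite vz_neq0 // subr_eq0.
have pd : dot (vz (m - m')) d = 0.
  have := mono_sub (etrans (esym (actE hmx)) (actE hmx')) (etrans (esym (actE hm)) (actE hm')).
  by rewrite dot_sub dot_ray addrAC subrr add0r; apply: pmul_eq0.
have pd0 : dot (vz (m - m')) d0 = 0.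
  have oy0 : opens e0 (ray x d0 h').
    by apply/open_segmentP; exists (r + h') => //; rewrite -d0E exr eh'.
  have hm0 := act0 _ oy0 m; rewrite hmx in hm0; have hm0' := act0 _ oy0 m'; rewrite hmx' in hm0'.
  have := mono_sub (etrans (esym (actE hmx)) (actE hmx')) (etrans (esym (actE hm0)) (actE hm0')).
  by rewrite dot_sub dot_ray addrAC subrr add0r; apply: pmul_eq0.
have [a ead] := colinear p0 d00 pd0 pd.
have eda : d.1 = a * d0.1 /\ d.2 = a * d0.2 by rewrite ead.
have ap : 0 < a by apply: (lex_lt_scale l1 l0); have [] := eda; rewrite dE d0E.
have ends : [/\ e.1 = ray x d0 (- (t * a)), e.2 = ray x d0 ((1 - t) * a),
              e0.1 = ray x d0 (- r) & e0.2 = ray x d0 (1 - r)].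
  have [h1 h2] := eda; split.
  - rewrite ext /ray /= h1 h2; case: (e.1) => ? ? /=; congr pair; ring.
  - have -> : e.2 = ray e.1 d 1 by rewrite dE ray1.
    by rewrite ext /ray /= h1 h2; congr pair; ring.
  - rewrite exr /ray /=; case: (e0.1) => ? ? /=; congr pair; ring.
  - have -> : e0.2 = ray e0.1 d0 1 by rewrite d0E ray1.
    by rewrite exr /ray /=; congr pair; ring.
have [E1 E2 E3 E4] := ends.
have bdV (w : R * R) : cutpt w \/ bd Om w -> ~ (corner_locus Om F w /\ ~ cutpt w).
  by move=> [h1 [_ /(_ h1)]//|[_ h1] [[/h1]]].
have in_e0 q : - r < q < 1 - r -> opens e0 (ray x d0 q).
  move=> /andP[q1 q2]; apply/open_segmentP; exists (r + q); first by apply/andP; lra.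
  by rewrite -d0E exr /ray /=; congr pair; ring.
have in_e q : - (t * a) < q < (1 - t) * a -> opens e (ray x d0 q).
  move=> /andP[q1 q2]; apply/open_segmentP; exists (t + q / a).
    have : - t < q / a by rewrite ltr_pdivlMr //; lra.
    have : q / a < 1 - t by rewrite ltr_pdivrMr.
    by move=> *; apply/andP; lra.
  have [h1 h2] := eda; have a0 : a != 0 by rewrite gt_eqF.
  by rewrite -dE ext /ray /= h1 h2; congr pair; field.
have ta : 0 < t * a by apply: mulr_gt0.
have ta' : 0 < (1 - t) * a by apply: mulr_gt0 => //; lra.
have c1 : t * a = r.
  case: (ltgtP (t * a) r) => // hc.
    by case: (bdV _ b11); apply: in0; rewrite -/(opens _ _) E1; apply: in_e0; apply/andP; lra.
  by case: (bdV _ b01); apply: in1; rewrite -/(opens _ _) E3; apply: in_e; apply/andP; lra.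
have c2 : (1 - t) * a = 1 - r.
  case: (ltgtP ((1 - t) * a) (1 - r)) => // hc.
    by case: (bdV _ b12); apply: in0; rewrite -/(opens _ _) E2; apply: in_e0; apply/andP; lra.
  by case: (bdV _ b02); apply: in1; rewrite -/(opens _ _) E4; apply: in_e; apply/andP; lra.
by rewrite [LHS]surjective_pairing [RHS]surjective_pairing E1 E2 E3 E4 c1 c2.
Qed.

Lemma piece_uniq x e e' : piece e -> piece e' -> opens e x -> opens e' x -> e = e'.
Proof.
move=> pe pe' ox ox'; have [_ h _ _] := (pieceP e).1 pe; have [hV hS] := h _ ox.
have [e0 pe0 [o0 a0]] := piece_through hV hS.
by rewrite (piece_through_uniq pe0 o0 a0 pe ox) (piece_through_uniq pe0 o0 a0 pe' ox').
Qed.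

Lemma piece_act e x y k : piece e -> opens e x -> opens e y -> act x k = act y k.
Proof.
move=> pe ox oy; have [_ h _ _] := (pieceP e).1 pe; have [hV hS] := h _ ox.
have [e0 pe0 [o0 a0]] := piece_through hV hS.
by rewrite (a0 y) // -(piece_through_uniq pe0 o0 a0 pe ox).
Qed.

(** * Darts and the cells beside them *)

Hypothesis ps_in : forall p, p \in ps -> Om° p.
Implicit Type d : piece_type R * bool.

Lemma cutpt_in x : cutpt x -> Om° x.
Proof. by move=> [[]|/ps_in]. Qed.

Definition org d : R * R := if d.2 then d.1.1 else d.1.2.
Definition dst d : R * R := if d.2 then d.1.2 else d.1.1.
Definition dir d : R * R := dst d - org d.

Lemma org_flip d : org (flip d) = dst d.
Proof. by case: d => e []. Qed.

Lemma dst_flip d : dst (flip d) = org d.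
Proof. by case: d => e []. Qed.

Lemma dart_end d : piece d.1 -> cutpt (dst d) \/ bd Om (dst d).
Proof. by move=> /piece_end; apply; rewrite /dst; case: (d.2); auto. Qed.

Lemma dart_start d : piece d.1 -> cutpt (org d) \/ bd Om (org d).
Proof. by rewrite -dst_flip; apply: (@dart_end (flip d)). Qed.

Lemma dst_in d : piece d.1 -> Om (dst d).
Proof. by move=> /dart_end[/cutpt_in/Omi_sub|[]]. Qed.

Lemma org_in d : piece d.1 -> Om (org d).
Proof. by rewrite -dst_flip; apply: (@dst_in (flip d)). Qed.

Lemma dart_neq d : piece d.1 -> org d != dst d.
Proof. by move=> /piece_neq; rewrite /org /dst; case: (d.2) => //; rewrite eq_sym. Qed.

Lemma dir_neq0 d : piece d.1 -> dir d != 0.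
Proof. by move=> /dart_neq; rewrite /dir subr_eq0 eq_sym. Qed.

Lemma dart_opens d y : opens d.1 y <-> exists2 t, 0 < t < 1 & y = ray (org d) (dir d) t.
Proof.
rewrite /dir /org /dst /opens; case: (d.2); first exact: open_segmentP.
by split=> [/open_segmentC/open_segmentP//|h]; apply/open_segmentC/open_segmentP.
Qed.

Lemma dart_mid d : opens d.1 (ray (org d) (dir d) (1 / 2)).
Proof. by apply/dart_opens; exists (1 / 2) => //; apply/andP; lra. Qed.

Lemma act_dst d y m : piece d.1 -> opens d.1 y -> act y m -> act (dst d) m.
Proof.
move=> pe oy hm; apply: act_of_le; [exact: dst_in|exact: actB hm|move=> k hk].
have -> : dst d = ray (org d) (dir d) 1 by rewrite /dir ray1.
rewrite !mono_ray !mul1r -subr_ge0.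
have -> : mono k (org d) + dot (vz k) (dir d) - (mono m (org d) + dot (vz m) (dir d)) =
  (mono k (org d) - mono m (org d)) + (dot (vz k) (dir d) - dot (vz m) (dir d)) by ring.
apply: affine_limit => t ht.
have ot : opens d.1 (ray (org d) (dir d) t) by apply/dart_opens; exists t.
have hm' : act (ray (org d) (dir d) t) m by rewrite (piece_act m pe ot oy).
by have := act_le (Omi_sub (piece_interior pe ot)) hm' hk; rewrite !mono_ray; lra.
Qed.

Lemma act_org d y m : piece d.1 -> opens d.1 y -> act y m -> act (org d) m.
Proof. by rewrite -dst_flip; apply: (@act_dst (flip d)). Qed.

Lemma act_along d y m k : piece d.1 -> opens d.1 y -> act y m -> act y k ->
  dot (vz (k - m)) (dir d) = 0.
Proof.
move=> pe oy hm hk; have h1 := act_org pe oy; have h2 := act_dst pe oy.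
exact: mono_sub (etrans (esym (actE (h1 _ hk))) (actE (h1 _ hm)))
                (etrans (esym (actE (h2 _ hk))) (actE (h2 _ hm))).
Qed.

Definition sgn sg : R := if sg then 1 else - 1.

Lemma sgnN sg : sgn (~~ sg) = - sgn sg.
Proof. by case: sg => /=; rewrite /sgn ?opprK. Qed.

(** [m] is the gradient next to the dart [d], on its left if [sg], on its right
    otherwise: the one that is minimal on that side. *)
Definition is_side sg d m := forall y, opens d.1 y -> act y m /\
  forall k, act y k -> k != m -> 0 < sgn sg * dot (vz (k - m)) (perp (dir d)).

Lemma side_ex sg d : piece d.1 -> exists m, is_side sg d m.
Proof.
move=> pe; pose y0 := ray (org d) (dir d) (1 / 2); have o0 := dart_mid d.
have [k0 hk0] := act_ex (Omi_sub (piece_interior pe o0)).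
have [|m] := @seq_argmin R _ [seq k <- B | act y0 k]
    (fun k => sgn sg * dot (vz k) (perp (dir d))).
  by apply/eqP => e; have := mem_filter (act y0) k0 B; rewrite e hk0 (actB hk0).
rewrite mem_filter => /andP[hm _] hmin; exists m => y oy.
split=> [|k]; rewrite (piece_act _ pe oy o0) // => hk ne.
have := hmin k; rewrite mem_filter hk (actB hk) => /(_ isT) h.
rewrite vz_sub mulrBr subr_gt0 lt_neqAle h andbT; apply/eqP => e.
case/eqP: ne; apply/eqP; rewrite -subr_eq0; apply: contraT => /vz_neq0/eqP; case.
apply: (dot_perp0 (dir_neq0 pe)); first exact: act_along pe o0 hm hk.
move/eqP: e; rewrite -subr_eq0 -mulrBr mulf_eq0 vz_sub.
case/orP => /eqP h1; last by rewrite -opprB h1 oppr0.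
by move: h1; rewrite /sgn; case: sg {hmin h} => /eqP; rewrite ?oppr_eq0 oner_eq0.
Qed.

Definition side sg d : int * int := xget 0 [set m | is_side sg d m].

Lemma sideP sg d : piece d.1 -> is_side sg d (side sg d).
Proof.
by move=> /(side_ex sg)[m hm]; rewrite /side; apply: (xgetPex 0); exists m.
Qed.

Lemma is_side_uniq sg d m m' : piece d.1 -> is_side sg d m -> is_side sg d m' -> m = m'.
Proof.
move=> pe h h'; have [h1 h2] := h _ (dart_mid d); have [h3 h4] := h' _ (dart_mid d).
apply/eqP; apply: contraT => ne.
have := h2 _ h3 ltac:(by rewrite eq_sym); have := h4 _ h1 ne.
by rewrite !vz_sub => ? ?; exfalso; lra.
Qed.

Lemma sideE sg d m : piece d.1 -> is_side sg d m -> side sg d = m.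
Proof. by move=> pe h; apply: is_side_uniq pe (sideP sg pe) h. Qed.

Lemma side_flip sg d : piece d.1 -> side sg (flip d) = side (~~ sg) d.
Proof.
move=> pe; apply: sideE => // y oy; have [h1 h2] := sideP (~~ sg) pe oy.
split=> // k hk ne; have := h2 k hk ne; rewrite sgnN.
have -> : dir (flip d) = - dir d by rewrite /dir org_flip dst_flip opprB.
by rewrite /dot /perp /=; lra.
Qed.

Lemma side_act sg d y : piece d.1 -> opens d.1 y -> act y (side sg d).
Proof. by move=> pe /(sideP sg pe)[]. Qed.

Lemma side_org sg d : piece d.1 -> act (org d) (side sg d).
Proof. by move=> pe; apply: act_org pe (dart_mid d) (side_act _ pe (dart_mid d)). Qed.

Lemma side_dst sg d : piece d.1 -> act (dst d) (side sg d).
Proof. by move=> pe; apply: act_dst pe (dart_mid d) (side_act _ pe (dart_mid d)). Qed.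

Lemma piece_two_act d y : piece d.1 -> opens d.1 y -> exists m m', [/\ act y m, act y m' & m != m'].
Proof. by move=> /pieceP[_ h _ _] /h[/cornerP[]]. Qed.

Lemma side_neq d : piece d.1 -> side true d != side false d.
Proof.
move=> pe; apply/eqP => e; have o0 := dart_mid d.
have [h1 h2] := sideP true pe o0; have [_ h4] := sideP false pe o0; rewrite -e in h4.
have [m [m' [hm hm' ne]]] := piece_two_act pe o0.
have [e1|ne1] := eqVneq m (side true d).
  have ne' : m' != side true d by rewrite -e1 eq_sym.
  by have := h2 _ hm' ne'; have := h4 _ hm' ne'; rewrite /sgn mul1r mulN1r; lra.
by have := h2 _ hm ne1; have := h4 _ hm ne1; rewrite /sgn mul1r mulN1r; lra.
Qed.

(** The open region of the linearity cell of gradient [m]. *)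
Definition region m : set (R * R) := [set x | Om° x /\ forall k, act x k = (k == m)].
Definition cell m := region m !=set0.

Lemma region_act m x : region m x -> act x m.
Proof. by move=> [_ ->]. Qed.

Lemma regionP m x : Om° x -> act x m -> (forall k, k \in B -> k != m -> mono m x < mono k x) ->
  region m x.
Proof.
move=> hx hm h; split=> // k; have [->//|ne] := eqVneq k m.
apply/negP => hk; have := h k (actB hk) ne.
by rewrite -(actE hm) -(actE hk) ltxx.
Qed.

Lemma region_lt m x k : region m x -> k \in B -> k != m -> mono m x < mono k x.
Proof.
move=> [hx hr] hk ne; have hm : act x m by rewrite hr.
rewrite lt_neqAle (act_le (Omi_sub hx) hm hk) andbT; apply/eqP => e.
by have := act_eq (Omi_sub hx) hm hk (esym e); rewrite hr (negbTE ne).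
Qed.

Lemma region_towards m x w t : Om x -> act x m -> region m w -> 0 < t <= 1 ->
  region m (ray x (w - x) t).
Proof.
move=> hx hm hw /andP[t0 t1]; have hwi := hw.1.
have -> : ray x (w - x) t = ray w (x - w) (1 - t) by rewrite /ray /=; congr pair; ring.
have hi : Om° (ray w (x - w) (1 - t)) by apply: Omi_convex => //; apply/andP; lra.
have lt k : k \in B -> k != m -> mono m (ray w (x - w) (1 - t)) < mono k (ray w (x - w) (1 - t)).
  move=> hk ne; have h1 := region_lt hw hk ne; have h2 := act_le hx hm hk.
  rewrite !mono_ray !dot_sub; move: h1 h2; rewrite /mono => h1 h2.
  have h3 := mulr_gt0 t0 (_ : 0 < c k + dot (vz k) w - (c m + dot (vz m) w)).
  have h4 := mulr_ge0 (_ : 0 <= 1 - t) (_ : 0 <= c k + dot (vz k) x - (c m + dot (vz m) x)).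
  by have := h3 ltac:(lra); have := h4 ltac:(lra) ltac:(lra); lra.
apply: regionP => //; apply: act_of_le => //; [exact: Omi_sub|exact: actB hm|].
by move=> k hk; have [->|/(lt k hk)/ltW] := eqVneq k m.
Qed.

Lemma region_convex m x y t : region m x -> region m y -> 0 <= t <= 1 ->
  region m (ray x (y - x) t).
Proof.
move=> hx hy /andP[]; rewrite le_eqVlt => /orP[/eqP <-|t0 t1]; first by rewrite ray0.
by apply: region_towards => //; [exact: Omi_sub hx.1|exact: region_act|rewrite t0].
Qed.

Lemma region_beside sg d x : piece d.1 -> opens d.1 x ->
  exists2 q0, 0 < q0 & forall q, 0 < q <= q0 ->
    region (side sg d) (ray x (perp (dir d)) (sgn sg * q)).
Proof.
move=> pe ox; have hx := piece_interior pe ox.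
have [q0 q0p h] := near_ray (perp (dir d)) (near_act hx).
exists q0 => // q /andP[qp qle]; have [|hy hact] := h (sgn sg * q).
  by rewrite normrM (gtr0_norm qp) /sgn; case: (sg); rewrite ?normrN normr1 mul1r.
have [h1 h2] := sideP sg pe ox; set m := side sg d in h1 h2 *.
have [k0 hk0] := act_ex (Omi_sub hy).
have lt k : act x k -> k != m -> mono m (ray x (perp (dir d)) (sgn sg * q)) <
    mono k (ray x (perp (dir d)) (sgn sg * q)).
  move=> hk ne; have := mulr_gt0 qp (h2 k hk ne).
  by rewrite !mono_ray -(actE hk) -(actE h1) vz_sub; lra.
have e0 : k0 = m.
  apply/eqP; apply: contraT => ne; have := lt _ (hact _ hk0) ne.
  by rewrite ltNge (act_le (Omi_sub hy) hk0 (actB h1)).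
split=> // k; rewrite -e0; have [->//|ne] := eqVneq k k0.
apply/negP => hk; have := lt k (hact _ hk); rewrite -e0 ne => /(_ isT).
by rewrite -(actE hk) -(actE hk0) ltxx.
Qed.

Lemma side_cell sg d : piece d.1 -> cell (side sg d).
Proof.
move=> pe; have [q q0 h] := region_beside sg pe (dart_mid d).
by eexists; apply: (h q); rewrite q0 lexx.
Qed.

(** The segment of [ray_end] is a piece, with [x] as an end. *)
Lemma ray_piece x u m m' : cutpt x -> u != 0 -> act x m -> act x m' -> m != m' ->
  dot (vz m') u = dot (vz m) u -> (forall k, act x k -> dot (vz m) u <= dot (vz k) u) ->
  exists d, [/\ piece d.1, org d = x,
    exists2 a, 0 < a & dir d = (a * u.1, a * u.2) &
    forall y, opens d.1 y -> forall k, act y k = act x k && (dot (vz k) u == dot (vz m) u)].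
Proof.
move=> hS u0 hm hm' ne e hmin; have hx := cutpt_in hS.
have [a a0 [_ hz hin]] := ray_end hx u0 hm hm' ne e hmin.
have xz : x != ray x u a.
  by apply/eqP; rewrite -{1}(ray0 x u) => /(ray_inj u0) h; move: a0; rewrite -h ltxx.
have zin y : open_segment x (ray x u a) y -> exists2 t, 0 < t < a & y = ray x u t.
  move=> /open_segmentP[t /andP[h1 h2] ->]; exists (t * a).
    by rewrite mulr_gt0 //= -[ltRHS]mul1r ltr_pM2r.
  by rewrite /ray /=; congr pair; ring.
have [|y /zin[t /hin[h1 h2 h3] ->]|p pp [ep op]] := mk_piece xz _ hz; first by left.
  by split=> //; apply/cornerP; split=> //; exists m, m'; rewrite !h3 hm hm' eqxx e eqxx.
have hd (d : piece_type R * bool) : d.1 = p -> org d = x -> dst d = ray x u a ->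
    exists d, [/\ piece d.1, org d = x,
      exists2 a, 0 < a & dir d = (a * u.1, a * u.2) &
      forall y, opens d.1 y -> forall k, act y k = act x k && (dot (vz k) u == dot (vz m) u)].
  move=> e1 e2 e3; exists d; split=> //; first by rewrite e1.
    exists a => //; rewrite /dir e2 e3 /ray; case: (x) => x1 x2 /=.
    by congr pair => /=; rewrite addrAC subrr add0r.
  by move=> y; rewrite e1 => /op/zin[t /hin[_ _ h3] ->].
by case: ep => ep; [apply: (hd (p, true))|apply: (hd (p, false))]; rewrite // ep.
Qed.

(** Darts leaving a point in the same direction have common inner points. *)
Lemma dart_dir_uniq d d' (a : R) : piece d.1 -> piece d'.1 -> org d = org d' -> 0 < a ->
  dir d = (a * (dir d').1, a * (dir d').2) -> d = d'.
Proof.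
move=> pe pe' eo a0 ed; pose t := Num.min 1 a^-1 / 2.
have t0 : 0 < t by rewrite divr_gt0 // lt_min ltr01 invr_gt0.
have t1 : t <= 1 / 2 by rewrite ler_pM2r ?invr_gt0 // ge_min lexx.
have t2 : t * a <= 1 / 2.
  by rewrite mulrAC ler_pM2r ?invr_gt0 // -ler_pdivlMr // div1r ge_min lexx orbT.
have o1 : opens d.1 (ray (org d) (dir d) t) by apply/dart_opens; exists t => //; apply/andP; lra.
have o2 : opens d'.1 (ray (org d) (dir d) t).
  apply/dart_opens; exists (t * a); first by rewrite mulr_gt0 //=; lra.
  by rewrite ed eo /ray /=; congr pair; ring.
have e1 := piece_uniq pe pe' o1 o2.
have := dart_neq pe; move: eo e1 pe {ed o1 o2}; case: d => e b; case: d' pe' => e' b' /= pe' + e1.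
by rewrite e1 /org /dst /=; case: b; case: b' => //= ->; rewrite eqxx.
Qed.

Lemma cell_dir m w v k : region m w -> Om v -> act v m -> act v k -> k != m ->
  0 < dot (vz (k - m)) (w - v).
Proof.
move=> hw hv hm hk ne; have h1 := region_lt hw (actB hk) ne.
have h2 : mono k v = mono m v by rewrite -(actE hk) -(actE hm).
by rewrite vz_sub !dot_sub; move: h1 h2; rewrite /mono; lra.
Qed.

(** The tangent cone at a vertex of the cell of gradient [m] is pointed, so it
    has one extreme ray on either side; it is found by turning a ray of the
    cone until a second gradient becomes minimal. *)
Lemma star_ex sg v m : graph_vertex Om F v -> cell m -> act v m ->
  exists d, [/\ piece d.1, org d = v & side sg d = m].
Proof.
move=> hv [w hw] hm; have hvO := Omi_sub hv.1; pose y0 := w - v.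
have pos k : act v k -> k != m -> 0 < dot (vz (k - m)) y0.
  by move=> hk ne; apply: cell_dir hw hvO hm hk ne.
have [hvi [a0 [a1 [a2 [h0 h1 h2 ncr]]]]] := (vertexP v).1 hv.
have [k1 [hk1 nk1]] : exists k1, act v k1 /\ k1 != m.
  have [e|ne] := eqVneq a1 m; last by exists a1.
  exists a0; split=> //; apply/eqP => e0; move/eqP: ncr; apply.
  by rewrite e e0 subrr /cross /=; ring.
have [|k] := @seq_argmin R _ [seq k <- B | act v k && (k != m)]
    (fun k => - (sgn sg * dot (vz (k - m)) (perp y0) / dot (vz (k - m)) y0)).
  apply/eqP => e; have := mem_filter (fun k => act v k && (k != m)) k1 B.
  by rewrite e hk1 nk1 (actB hk1).
rewrite mem_filter => /andP[/andP[hk nk] _]; set q := _ / _ => hmin.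
pose r : R * R := (q * y0.1 - sgn sg * (perp y0).1, q * y0.2 - sgn sg * (perp y0).2).
have dr p : dot p r = q * dot p y0 - sgn sg * dot p (perp y0) by rewrite /dot /r /=; ring.
have dr' p : dot p (perp r) = q * dot p (perp y0) + sgn sg * dot p y0.
  by rewrite /dot /r /perp /=; ring.
have ss : sgn sg * sgn sg = 1 by rewrite /sgn; case: (sg); rewrite ?mulrNN mulr1.
have y00 : y0 != 0.
  by apply/eqP => e; have := pos _ hk nk; rewrite e /dot /= !mulr0 addr0 ltxx.
have r0 : r != 0.
  apply/eqP => e; have h : dot (perp y0) r = 0 by rewrite e /dot /= !mulr0 addr0.
  have := dot_gt0 (perp_neq0 y00); move: h; rewrite dr.
  have -> : dot (perp y0) y0 = 0 by rewrite /dot /perp /=; ring.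
  rewrite mulr0 sub0r => /eqP; rewrite oppr_eq0 mulf_eq0 => /orP[/eqP h|/eqP ->]; last by rewrite ltxx.
  by move: ss; rewrite h mul0r => /eqP; rewrite eq_sym oner_eq0.
have rk k' : act v k' -> k' != m -> 0 <= dot (vz (k' - m)) r.
  move=> hk' nk'; have := hmin k'; rewrite mem_filter hk' nk' (actB hk') => /(_ isT).
  rewrite lerN2 ler_pdivrMr ?pos // dr; lra.
have rk0 : dot (vz (k - m)) r = 0.
  by rewrite dr /q divfK ?gt_eqF ?pos // subrr.
have [|||d [pd od [a ap da] hact]] := ray_piece (or_introl hv) r0 hm hk.
- by rewrite eq_sym.
- by apply/eqP; rewrite -subr_eq0 -vz_sub rk0.
- move=> k' hk'; have [->//|ne] := eqVneq k' m.
  by rewrite -subr_ge0 -vz_sub rk.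
exists d; split=> //; apply: sideE => // y oy; split.
  by rewrite hact // hm eqxx.
move=> k'; rewrite hact // => /andP[hk' /eqP e'] ne.
have e0 : dot (vz (k' - m)) r = 0 by rewrite vz_sub e' subrr.
have -> : dot (vz (k' - m)) (perp (dir d)) = a * dot (vz (k' - m)) (perp r).
  by rewrite da /dot /perp /=; ring.
rewrite mulrCA mulr_gt0 // dr'.
have e1 : q * dot (vz (k' - m)) y0 = sgn sg * dot (vz (k' - m)) (perp y0).
  by apply/eqP; rewrite -subr_eq0 -dr e0.
have -> : sgn sg * (q * dot (vz (k' - m)) (perp y0) + sgn sg * dot (vz (k' - m)) y0) =
    q * (sgn sg * dot (vz (k' - m)) (perp y0)) + sgn sg * sgn sg * dot (vz (k' - m)) y0 by ring.
rewrite -e1 ss mul1r mulrA -{2}[dot _ y0]mul1r -mulrDl mulr_gt0 ?pos //.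
by rewrite ltr_wpDl // -expr2 sqr_ge0.
Qed.

(** The other gradients along the dart differ from the one on its side by a normal
    vector of the dart. *)
Lemma side_witness sg d : piece d.1 -> exists k (a : R),
  [/\ act (org d) k, k != side sg d, 0 < a &
    vz (k - side sg d) = (a * (sgn sg * (perp (dir d)).1), a * (sgn sg * (perp (dir d)).2))].
Proof.
move=> pe; have o0 := dart_mid d; have [h1 h2] := sideP sg pe o0.
have [k [hk ne]] : exists k, act (ray (org d) (dir d) (1 / 2)) k /\ k != side sg d.
  have [m [m' [hm hm' ne]]] := piece_two_act pe o0.
  have [e|ne1] := eqVneq m (side sg d); last by exists m.
  by exists m'; rewrite -e eq_sym.
have ss : sgn sg * sgn sg = 1 by rewrite /sgn; case: (sg); rewrite ?mulrNN mulr1.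
have perp0 := perp_neq0 (dir_neq0 pe); have e0 := act_along pe o0 h1 hk.
have [||a ea] := colinear (w := vz (k - side sg d)) (dir_neq0 pe) perp0.
- by rewrite /dot /perp /=; ring.
- by rewrite -e0 /dot; ring.
exists k, (sgn sg * a); split=> //; first exact: act_org pe o0 hk.
  have := h2 k hk ne; rewrite ea.
  rewrite (_ : dot (_, _) _ = a * dot (perp (dir d)) (perp (dir d))); last by rewrite /dot /=; ring.
  by rewrite mulrA (pmulr_lgt0 _ (dot_gt0 perp0)).
by rewrite ea; congr pair; rewrite -[LHS]mul1r -ss; ring.
Qed.

Lemma side_cone sg d k : piece d.1 -> act (org d) k ->
  0 <= dot (vz (k - side sg d)) (dir d).
Proof.
move=> pe hk; have h1 := side_org sg pe; have h2 := side_dst sg pe.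
have h3 := act_le (dst_in pe) h2 (actB hk).
have h4 : mono k (org d) = mono (side sg d) (org d) by rewrite -(actE hk) -(actE h1).
by rewrite /dir vz_sub !dot_sub; move: h3 h4; rewrite /mono; lra.
Qed.

(** Two darts with the same cell on the same side are both extreme rays of its
    tangent cone on that side; each lies in the half-plane of the other. *)
Lemma star_uniq sg d d' : piece d.1 -> piece d'.1 -> org d = org d' ->
  side sg d = side sg d' -> d = d'.
Proof.
move=> pd pd' eo es.
have [k [a [hk nk a0 ek]]] := side_witness sg pd.
have [k' [a' [hk' nk' a0' ek']]] := side_witness sg pd'.
have h1 : 0 <= dot (vz (k - side sg d)) (dir d') by rewrite es side_cone // -eo.
have h2 : 0 <= dot (vz (k' - side sg d')) (dir d) by rewrite -es side_cone // eo.
have [w hw] := side_cell sg pd.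
have p1 := cell_dir hw (org_in pd) (side_org sg pd) hk nk.
have p2 := cell_dir hw (org_in pd) (side_org sg pd).
have {}p2 := p2 k'; rewrite es -eo in hk' p2; have {}p2 := p2 hk' nk'.
rewrite es in p1 ek h1; move: h1 h2 p1 p2; rewrite ek ek'.
have := dot_gt0 (dir_neq0 pd'); have := dot_gt0 (dir_neq0 pd).
have uq := @dart_dir_uniq d d' _ pd pd' eo.
move: (dir d) (dir d') uq (w - org d) => [u1 u2] [v1 v2] uq [w1 w2].
rewrite /dot /perp /= => uu vv h1 h2 p1 p2.
set g := sgn sg in h1 h2 p1 p2; have gg : g * g = 1 by rewrite /g /sgn; case: (sg); rewrite ?mulrNN mulr1.
have {}h1 : 0 <= g * (u1 * v2 - u2 * v1).
  by rewrite -(pmulr_rge0 _ a0); apply: le_trans h1 _; rewrite le_eqVlt; apply/orP; left; apply/eqP; ring.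
have {}h2 : 0 <= - (g * (u1 * v2 - u2 * v1)).
  by rewrite -(pmulr_rge0 _ a0'); apply: le_trans h2 _; rewrite le_eqVlt; apply/orP; left; apply/eqP; ring.
have cr : u1 * v2 - u2 * v1 = 0.
  have h3 : g * (u1 * v2 - u2 * v1) = 0 by apply/eqP; rewrite eq_le; apply/andP; lra.
  by rewrite -[LHS]mul1r -gg -mulrA h3 mulr0.
have [||q [e1 e2]] := @cross0_colinear R (v1, v2) (u1, u2).
- by apply: contraTneq vv => -[-> ->]; rewrite !mulr0 addr0 ltxx.
- by rewrite -oppr0 -cr /cross /=; ring.
rewrite /= in e1 e2.
apply: (uq q); last by rewrite e1 e2.
have {}p1 : 0 < q * (g * (- v2 * w1 + v1 * w2)).
  by rewrite -(pmulr_rgt0 _ a0); apply: lt_le_trans p1 _; rewrite le_eqVlt; apply/orP; left; apply/eqP; rewrite e1 e2; ring.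
have {}p2 : 0 < g * (- v2 * w1 + v1 * w2).
  by rewrite -(pmulr_rgt0 _ a0'); apply: lt_le_trans p2 _; rewrite le_eqVlt; apply/orP; left; apply/eqP; ring.
by move: p1; rewrite pmulr_lgt0.
Qed.

(** * Linearity cells *)

Lemma region_near m x : region m x -> \forall y \near x, region m y.
Proof.
move=> [hx hr]; apply: filterS (near_act hx) => y [hy hact]; split=> // k.
have one k' : act y k' -> k' = m by move=> /hact; rewrite hr => /eqP.
apply/idP/eqP => [/one //|->]; have [k' hk'] := act_ex (Omi_sub hy).
by rewrite -(one _ hk').
Qed.

Lemma region_connected m : connected (region m).
Proof.
have [->|/set0P[x hx]] := eqVneq (region m) set0; first exact: connected0.
have -> : region m = \bigcup_(y in region m) (ray x (y - x) @` `[0, 1]).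
  apply/seteqP; split=> [y hy|_ [y hy [t /= ht <-]]].
    by exists y => //; exists 1; [rewrite /= in_itv /= ler01 lexx|rewrite ray1].
  by apply: region_convex => //; rewrite in_itv in ht.
apply: bigcup_connected.
  by exists x => y _; exists 0; [rewrite /= in_itv /= ler01 lexx|rewrite ray0].
move=> y _; apply: connected_continuous_connected; first exact: segment_connected.
by apply: continuous_subspaceT; apply: continuous_ray.
Qed.

Lemma region_affine m : cell m -> affine_region Om F (region m).
Proof.
move=> cm; split=> //.
- by rewrite openE => x hx; apply: region_near.
- exact: region_connected.
- by move=> x [].
- by exists (vz m), (c m) => x /region_act/actE.
Qed.

(** Over an open set on which [F] is affine its gradient is the only active one. *)
Lemma affine_sub_region W : affine_region Om F W -> exists2 m, cell m & W `<=` region m.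
Proof.
move=> [oW _ [x0 hx0] WO [p [c0 hW]]].
have grad x m : W x -> act x m -> vz m = p.
  move=> hx hm; have hnear : \forall y \near x, W y by apply: open_nbhs_nbhs.
  have key u : dot (vz m - p) u = 0.
    have [q q0 [h1 h2]] := near_ray2 u hnear.
    have := F_le (Omi_sub (WO _ h1)) (actB hm); have := F_le (Omi_sub (WO _ h2)) (actB hm).
    rewrite (hW _ h1) (hW _ h2) !mono_ray !dot_ray -(actE hm) (hW _ hx) => a b.
    apply: (pmul_eq0 q0).
    by rewrite (_ : dot _ u = dot (vz m) u - dot p u); [lra|rewrite /dot /=; ring].
  apply/eqP; rewrite -subr_eq0; apply: contraT => /dot_gt0.
  by rewrite key ltxx.
have [m hm] := act_ex (Omi_sub (WO _ hx0)).
have sub : W `<=` region m.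
  move=> x hx; split; first exact: WO.
  have one k : act x k -> k = m.
    move=> hk; apply/eqP; rewrite -subr_eq0; apply: contraT => /vz_neq0.
    by rewrite vzB (grad _ _ hx hk) (grad _ _ hx0 hm) subrr eqxx.
  move=> k; apply/idP/eqP => [/one //|->]; have [k' hk'] := act_ex (Omi_sub (WO _ hx)).
  by rewrite -(one _ hk').
by exists m => //; exists x0; apply: sub.
Qed.

Lemma cell_regionP W : cell_region Om F W <-> exists2 m, cell m & W = region m.
Proof.
split=> [[aW mW]|[m cm ->]].
  have [m cm sub] := affine_sub_region aW; exists m => //.
  by apply/esym/mW => //; apply: region_affine.
split; first exact: region_affine.
move=> W' aW' sub; have [m' cm' sub'] := affine_sub_region aW'.
have [x hx] := cm; have := (sub' _ (sub _ hx)).2 m; rewrite (region_act hx) => /esym/eqP em.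
by apply/seteqP; split=> // y /sub'; rewrite -em.
Qed.

Lemma region_gradient m m' : cell m -> cell_gradient F (region m) m' <-> m' = m.
Proof.
move=> [x hx]; split=> [[c0 h]|->]; last by exists (c m) => y /region_act/actE.
apply/eqP; rewrite -subr_eq0; apply/eqP/vz_eq0 => u.
have [q q0 [h1 _]] := near_ray2 u (region_near hx).
have := h _ h1; have := h _ hx; rewrite (actE (region_act h1)) (actE (region_act hx)).
by rewrite mono_ray dot_ray => a b; apply: (pmul_eq0 q0); rewrite vz_sub; lra.
Qed.

Lemma closure_region m x : cell m -> Om x -> act x m -> closure (region m) x.
Proof.
move=> [w hw] hx hm V /(near_ray (w - x))[q q0 hq].
pose t := Num.min 1 q; have t0 : 0 < t by rewrite lt_min ltr01.
have t1 : t <= 1 by rewrite ge_min lexx.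
exists (ray x (w - x) t); split; first by apply: region_towards; rewrite ?t0.
by apply: hq; rewrite gtr0_norm // ge_min lexx orbT.
Qed.

Lemma closure_act m x : closure (region m) x -> Om x /\ act x m.
Proof.
move=> hx; have [w [hw _]] := hx setT filterT; have hB := actB (region_act hw).
have neg p (a : R) : a + dot p x < 0 -> \forall y \near x, a + dot p y < 0.
  move=> h; have : 0 < - a + dot (- p.1, - p.2) x by move: h; rewrite /dot /=; lra.
  by move/near_aff; apply: filterS => y; rewrite /dot /=; lra.
have hO : Om x.
  apply/OmP => h hh; rewrite leNgt; apply/negP; rewrite /hp addrC => /neg/hx[y [hy]].
  by have := (OmP y).1 (Omi_sub hy.1) h hh; rewrite /hp addrC leNgt => /negP.
split=> //; apply: act_of_le => // k hk; rewrite leNgt; apply/negP => hlt.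
have : (c k - c m) + dot (vz (k - m)) x < 0 by move: hlt; rewrite /mono vz_sub; lra.
move=> /neg/hx[y [hy]]; have := act_le (Omi_sub hy.1) (region_act hy) hk.
by rewrite /mono vz_sub; lra.
Qed.

(** * Marks and climbing darts *)

Hypothesis ps_reg : forall p, p \in ps -> corner_locus Om F p /\ ~ graph_vertex Om F p.
Hypothesis F_bd : forall x, bd Om x -> F x = 0.
Hypothesis F_pos : forall x, Om° x -> 0 < F x.

Lemma dart_eq d d' : piece d.1 -> d.1 = d'.1 -> org d = org d' -> d = d'.
Proof.
move=> /piece_neq ne; case: d ne => e b; case: d' => e' b' /= ne e1; rewrite -e1 /org /=.
by case: b; case: b' => //= h; move: ne; rewrite h eqxx.
Qed.

(** At a marked point, which is no vertex, the corner locus is locally a line: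
    one dart leaves each way, and what is left of one is right of the other. *)
Lemma mark_darts p : p \in ps -> exists d1 d2, [/\ piece d1.1, piece d2.1,
  org d1 = p /\ org d2 = p, d1.1 != d2.1 &
  [/\ forall d, piece d.1 -> org d = p -> d = d1 \/ d = d2,
     forall y, opens d1.1 y -> forall k, act y k = act p k,
     forall sg, side sg d2 = side (~~ sg) d1 &
     exists2 a, 0 < a & dir d2 = (- a * (dir d1).1, - a * (dir d1).2)]].
Proof.
move=> hp; have [hV nv] := ps_reg hp; have hS : cutpt p by right.
have [u [m [m' [u0 hm hm' ne hu]]]] := regular_dir hV nv.
have nu0 : - u != 0 by rewrite oppr_eq0.
have [||d1 [p1 o1 [a1 a10 e1] h1]] := ray_piece hS u0 hm hm' ne; first exact: hu.
  by move=> k /hu ->.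
have [||d2 [p2 o2 [a2 a20 e2] h2]] := ray_piece hS nu0 hm hm' ne.
- by rewrite !dot_opp hu.
- by move=> k /hu; rewrite !dot_opp => ->.
have {}h1 y : opens d1.1 y -> forall k, act y k = act p k.
  by move=> hy k; rewrite h1 //; case: (boolP (act p k)) => //= /hu ->; rewrite eqxx.
have {}h2 y : opens d2.1 y -> forall k, act y k = act p k.
  by move=> hy k; rewrite h2 // !dot_opp; case: (boolP (act p k)) => //= /hu ->; rewrite eqxx.
have e21 : dir d2 = (- (a2 / a1) * (dir d1).1, - (a2 / a1) * (dir d1).2).
  rewrite e2 e1 /=; have a1n : a1 != 0 by rewrite gt_eqF.
  by congr pair; field.
have a21 : 0 < a2 / a1 by rewrite divr_gt0.
have n12 : d1.1 != d2.1.
  apply/eqP => e12; have ed := dart_eq p1 e12 (etrans o1 (esym o2)).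
  have h3 := dot_gt0 (dir_neq0 p1); have := mulr_gt0 a21 h3.
  have : dot (dir d1) (dir d2) = - (a2 / a1 * dot (dir d1) (dir d1)).
    by rewrite e21 /dot /=; ring.
  by rewrite -ed; lra.
exists d1, d2; split=> //; split=> //; [| |by exists (a2 / a1)].
  move=> d pd od; have [k [k' [hk hk' nk]]] := piece_two_act pd (dart_mid d).
  have k0 : vz (k - k') != 0 by rewrite vz_neq0 // subr_eq0.
  have hd := act_along pd (dart_mid d) hk' hk.
  have hkp := act_org pd (dart_mid d) hk; have hkp' := act_org pd (dart_mid d) hk'.
  rewrite od in hkp hkp'.
  have hu' : dot (vz (k - k')) u = 0 by rewrite vz_sub (hu _ hkp) (hu _ hkp') subrr.
  have [a ea] := colinear k0 u0 hu' hd.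
  case: (ltgtP a 0) => ha.
  - right; apply: (@dart_dir_uniq _ _ (- a / a2)) => //; first by rewrite od o2.
      by rewrite divr_gt0 // oppr_gt0.
    have a2n : a2 != 0 by rewrite gt_eqF.
    by rewrite ea e2 /=; congr pair; field.
  - left; apply: (@dart_dir_uniq _ _ (a / a1)) => //; first by rewrite od o1.
      by rewrite divr_gt0.
    have a1n : a1 != 0 by rewrite gt_eqF.
    by rewrite ea e1 /=; congr pair; field.
  - by have /eqP := dir_neq0 pd; case; rewrite ea ha !mul0r.
move=> sg; apply: sideE => // y hy; have [h3 h4] := sideP (~~ sg) p1 (dart_mid d1).
split; first by rewrite h2 // -(h1 _ (dart_mid d1)).
move=> k; rewrite h2 // -(h1 _ (dart_mid d1)) => hk nk.
have := mulr_gt0 a21 (h4 k hk nk); rewrite sgnN e21 /dot /perp /=; lra.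
Qed.

(** Comparison by height, with ties broken so that no two points are level. *)
Definition keylt x y := F x < F y \/ F x = F y /\ lex_lt x y.

(** For [a] the slope of [F] along the vector [(b, e)]: the key does not grow in
    this direction. *)
Definition lexnonpos (a b e : R) := a < 0 \/ a = 0 /\ (b < 0 \/ b = 0 /\ e <= 0).

Lemma lexnonpos_scale (q a b e : R) : 0 <= q -> lexnonpos a b e -> lexnonpos (q * a) (q * b) (q * e).
Proof.
rewrite le_eqVlt => /orP[/eqP <-|q0]; first by rewrite !mul0r; right; split=> //; right.
case=> [h|[-> h]]; [left|right; rewrite mulr0; split=> //].
  by rewrite pmulr_rlt0.
case: h => [h|[-> h]]; [left|right; rewrite mulr0; split=> //].
  by rewrite pmulr_rlt0.
by rewrite pmulr_rle0.
Qed.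

Lemma lexnonpos_add (a b e a' b' e' : R) : lexnonpos a b e -> lexnonpos a' b' e' ->
  lexnonpos (a + a') (b + b') (e + e').
Proof. by rewrite /lexnonpos; lra. Qed.

(** A dart that climbs cannot end on the boundary, where [F] vanishes. *)
Lemma dart_increases sg d : piece d.1 -> Om° (org d) ->
  ~ lexnonpos (dot (vz (side sg d)) (dir d)) (dir d).1 (dir d).2 ->
  keylt (org d) (dst d) /\ cutpt (dst d).
Proof.
move=> pd hx nl; have h1 := side_org sg pd; have h2 := side_dst sg pd.
have eF : F (dst d) = F (org d) + dot (vz (side sg d)) (dir d).
  by rewrite (actE h1) (actE h2) /mono /dir dot_sub; ring.
have key : keylt (org d) (dst d).
  move: nl; rewrite /keylt eF /lexnonpos /lex_lt.
  have -> : (dst d).1 = (org d).1 + (dir d).1 by rewrite /dir /= subrKC.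
  have -> : (dst d).2 = (org d).2 + (dir d).2 by rewrite /dir /= subrKC.
  by move: (dot _ _) (dir d).1 (dir d).2 (F _) => *; lra.
split=> //; case: (dart_end pd) => // /F_bd h0.
by have := F_pos hx; case: key; rewrite h0; lra.
Qed.

(** A direction lies in the closed tangent cone of some cell: turn it slightly
    if several gradients are minimal along it. *)
Lemma cone_cell x y : Om° x -> y != 0 -> exists m, [/\ act x m, cell m &
  forall k, act x k -> 0 <= dot (vz (k - m)) y].
Proof.
move=> hx y0; have hxO := Omi_sub hx; have [k1 hk1] := act_ex hxO.
have [|k0 + hmin0] := @seq_argmin R _ [seq k <- B | act x k] (fun k => dot (vz k) y).
  by apply/eqP => e; have := mem_filter (act x) k1 B; rewrite e hk1 (actB hk1).
rewrite mem_filter => /andP[hk0 hB0].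
have min0 k : act x k -> dot (vz k0) y <= dot (vz k) y.
  by move=> hk; apply: hmin0; rewrite mem_filter hk (actB hk).
pose T k := act x k && (dot (vz k) y == dot (vz k0) y).
have [|m + hmin1] := @seq_argmin R _ [seq k <- B | T k] (fun k => dot (vz k) (perp y)).
  by apply/eqP => e; have := mem_filter T k0 B; rewrite e /T hk0 eqxx hB0.
rewrite mem_filter => /andP[/andP[hm /eqP em] hB].
have [|q q0 hq] := @seq_eps R _ B (fun k q => act x k -> k != m ->
    0 < dot (vz (k - m)) y + q * dot (vz (k - m)) (perp y)).
  move=> k hk; have [hka|na] := boolP (act x k); last by exists 1 => // *; case/negP: na.
  have [ekm|ne] := eqVneq k m; first by exists 1.
  have := min0 k hka; rewrite -em -subr_ge0 -vz_sub le_eqVlt => /orP[/eqP e0|hp].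
    exists 1 => // q /andP[q0 _] _ _; rewrite -e0 add0r mulr_gt0 //.
    have := hmin1 k; rewrite mem_filter /T hka hk => /(_ _).
    have -> : dot (vz k) y == dot (vz k0) y.
      by rewrite -em -subr_eq0 -vz_sub -e0.
    move=> /(_ isT); rewrite -subr_ge0 -vz_sub le_eqVlt => /orP[/eqP e1|//].
    have := dot_perp0 y0 (esym e0) (esym e1).
    by move/eqP; rewrite (negbTE (vz_neq0 _)) // subr_eq0.
  by have [e ep he] := pos_near (dot (vz (k - m)) (perp y)) hp; exists e => // q hq _ _; apply: he.
pose z : R * R := (y.1 + q * (perp y).1, y.2 + q * (perp y).2).
have zE k : dot (vz (k - m)) z = dot (vz (k - m)) y + q * dot (vz (k - m)) (perp y).
  by rewrite /dot /z /=; ring.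
have [t t0 ht] := near_ray z (near_act hx).
have [|hy hact] := ht t; first by rewrite gtr0_norm.
have lt k : act x k -> k != m -> mono m (ray x z t) < mono k (ray x z t).
  move=> hk ne; have := hq k q (actB hk) ltac:(by rewrite q0 lexx) hk ne.
  by rewrite -zE vz_sub !mono_ray -(actE hk) -(actE hm) => h; have := mulr_gt0 t0 h; lra.
have hmy : act (ray x z t) m.
  have [k hk] := act_ex (Omi_sub hy); have [<- //|ne] := eqVneq k m.
  by have := lt _ (hact _ hk) ne; rewrite ltNge (act_le (Omi_sub hy) hk (actB hm)).
exists m; split=> //.
  exists (ray x z t); split=> // k; have [->//|ne] := eqVneq k m.
  apply/negP => hk; have := lt _ (hact _ hk) ne.
  by rewrite -(actE hk) -(actE hmy) ltxx.
by move=> k /min0; rewrite -em vz_sub subr_ge0.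
Qed.

(** [F] is concave, so its key grows from [x] in the direction of the higher point
    [x']. At a mark, one of the two opposite darts climbs. At a vertex, that direction
    lies in the tangent cone of a cell, hence is a nonnegative combination of its
    two extreme rays, and one of these climbs. *)
Lemma increasing_dart x x' : cutpt x -> Om x' -> keylt x x' ->
  exists d, [/\ piece d.1, org d = x, keylt x (dst d) & cutpt (dst d)].
Proof.
move=> hS hx' hk; have hx := cutpt_in hS.
suff [sg [d [pd od nl]]] : exists sg d, [/\ piece d.1, org d = x &
    ~ lexnonpos (dot (vz (side sg d)) (dir d)) (dir d).1 (dir d).2].
  have hd : Om° (org d) by rewrite od.
  by have [h1 h2] := dart_increases pd hd nl; exists d; rewrite -od.
have [hv|nv] := pselect (graph_vertex Om F x); last first.
  have hp : x \in ps by case: hS.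
  have [d1 [d2 [p1 p2 [o1 o2] n12 [_ _ hs [a a0 e2]]]]] := mark_darts hp.
  have [nl|] := pselect (lexnonpos (dot (vz (side true d1)) (dir d1)) (dir d1).1 (dir d1).2); last first.
    by move=> nl; exists true, d1.
  have hs' : side false d2 = side true d1 := hs false.
  exists false, d2; split=> //; rewrite hs' => nl2; move/eqP: (dir_neq0 p1); apply.
  have e3 : dot (vz (side true d1)) (dir d2) = - a * dot (vz (side true d1)) (dir d1).
    by rewrite e2 /dot /=; ring.
  have := lexnonpos_scale (ltW a0) nl; move: nl2; rewrite e3 e2.
  move: (dot _ _) => b; case: (dir d1) => u1 u2; rewrite /lexnonpos /= => h1 h2.
  have u10 : a * u1 = 0 by lra.
  have u20 : a * u2 = 0 by lra.
  move/eqP: u10; move/eqP: u20; rewrite !mulf_eq0 gt_eqF //= => /eqP -> /eqP ->.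
  by [].
pose y := x' - x.
have y0 : y != 0.
  rewrite subr_eq0; apply/eqP => e; move: hk; rewrite e /keylt /lex_lt.
  by case=> [|[_ [|[_]]]]; rewrite ltxx.
have [m [hm cm hmin]] := cone_cell hx y0.
have nly : ~ lexnonpos (dot (vz m) y) y.1 y.2.
  have h1 := F_le hx' (actB hm).
  have h2 : F x' - F x <= dot (vz m) y.
    by rewrite (actE hm) /y dot_sub; move: h1; rewrite /mono; lra.
  move: hk h2; rewrite /keylt /lex_lt /lexnonpos /y /=.
  by move: (dot _ _) (F _) (F _) x.1 x.2 x'.1 x'.2 => *; lra.
have [d1 [p1 o1 s1]] := star_ex true hv cm hm.
have [d2 [p2 o2 s2]] := star_ex false hv cm hm.
have [nl1|] := pselect (lexnonpos (dot (vz (side true d1)) (dir d1)) (dir d1).1 (dir d1).2); last first.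
  by move=> nl; exists true, d1.
have [nl2|] := pselect (lexnonpos (dot (vz (side false d2)) (dir d2)) (dir d2).1 (dir d2).2); last first.
  by move=> nl; exists false, d2.
case: nly; rewrite s1 in nl1; rewrite s2 in nl2.
have [k1 [a1 [hk1 nk1 a10 e1]]] := side_witness true p1.
have [k2 [a2 [hk2 nk2 a20 e2]]] := side_witness false p2.
rewrite s1 o1 in hk1 nk1 e1; rewrite s2 o2 in hk2 nk2 e2.
have q1 := hmin _ hk1; have q2 := hmin _ hk2.
have q12 : 0 <= dot (vz (k1 - m)) (dir d2) by rewrite -s2 side_cone // o2.
have [w hw] := cm.
have w1 := cell_dir hw (Omi_sub hx) hm hk1 nk1.
have w2 := cell_dir hw (Omi_sub hx) hm hk2 nk2.
have nz : cross (dir d1) (dir d2) != 0.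
  apply/eqP => cr; have hv' := hv.
  have [_ [b0 [b1 [b2 [hb0 hb1 hb2 /eqP]]]]] := (vertexP x).1 hv; apply.
  have d20 := dir_neq0 p2; have p0 := perp_neq0 d20.
  have h1 : dot (perp (dir d2)) (dir d2) = 0 by rewrite /dot /perp /=; ring.
  have h2 : dot (perp (dir d2)) (dir d1) = 0.
    by rewrite /dot /perp; move: cr; rewrite /cross /=; lra.
  have [q eq1] := colinear p0 d20 h1 h2.
  have e21 : dot (vz (k1 - m)) (w - x) * a2 = - q * a1 * dot (vz (k2 - m)) (w - x).
    by rewrite e1 e2 eq1 /sgn /dot /perp /=; ring.
  have qn : q < 0.
    rewrite ltNge; apply/negP => q0; have := mulr_gt0 w1 a20; rewrite e21.
    by have := mulr_ge0 (mulr_ge0 q0 (ltW a10)) (ltW w2); lra.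
  have zero k : act x k -> dot (vz (k - m)) (dir d2) = 0.
    move=> hk'; have h3 : 0 <= dot (vz (k - m)) (dir d1) by rewrite -s1 side_cone // o1.
    have h4 : 0 <= dot (vz (k - m)) (dir d2) by rewrite -s2 side_cone // o2.
    move: h3; rewrite (_ : dot (vz (k - m)) (dir d1) = q * dot (vz (k - m)) (dir d2)).
      by rewrite nmulr_rge0 // => h5; apply/eqP; rewrite eq_le h4 h5.
    by rewrite eq1 /dot /=; ring.
  have z (b : int * int) : act x b -> dot (vz (b - b0)) (dir d2) = 0.
    move=> hb; have := zero _ hb; have := zero _ hb0; rewrite !vz_sub; lra.
  by apply: (dot0_cross d20); apply: z.
have c0 : 0 < cross (dir d1) (dir d2).
  rewrite lt0r nz /=; move: q12; rewrite e1 (_ : dot _ _ = a1 * cross (dir d1) (dir d2)).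
    by rewrite pmulr_rge0.
  by rewrite /sgn /dot /cross /perp /=; ring.
have c1 : 0 <= cross (dir d1) y.
  move: q1; rewrite e1 (_ : dot _ _ = a1 * cross (dir d1) y); first by rewrite pmulr_rge0.
  by rewrite /sgn /dot /cross /perp /=; ring.
have c2 : 0 <= cross y (dir d2).
  move: q2; rewrite e2 (_ : dot _ _ = a2 * cross y (dir d2)); first by rewrite pmulr_rge0.
  by rewrite /sgn /dot /cross /perp /=; ring.
have := lexnonpos_add (lexnonpos_scale c2 nl1) (lexnonpos_scale c1 nl2).
move/(lexnonpos_scale (_ : 0 <= (cross (dir d1) (dir d2))^-1)) => /(_ _).
rewrite invr_ge0 (ltW c0) => /(_ isT).
move: (vz m) nz => mm; case: (dir d1) (dir d2) (y) => u1 u2 [v1 v2] [y1 y2].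
rewrite /cross /dot /= => nz.
have eq0 : (u1 * v2 - u2 * v1)^-1 * (mm.1 * 0) = 0 by rewrite !mulr0.
have E (a b e : R) : e * (u1 * v2 - u2 * v1) = a -> (u1 * v2 - u2 * v1)^-1 * a = e.
  by move=> <-; rewrite mulrC mulfK.
rewrite (E _ 0 (mm.1 * y1 + mm.2 * y2)); last by ring.
by rewrite (E _ 0 y1) ?(E _ 0 y2) //; ring.
Qed.

(** * Finiteness and flows *)

(** A vertex is the only point where three given non-collinear gradients are
    active. *)
Lemma vertices_finite : finite_set (graph_vertex Om F).
Proof.
pose l := [seq (q, m) | q <- [seq (m0, m1) | m0 <- B, m1 <- B], m <- B].
pose code v (q : (int * int) * (int * int) * (int * int)) :=
  [/\ act v q.1.1, act v q.1.2, act v q.2 & cross (vz (q.1.2 - q.1.1)) (vz (q.2 - q.1.1)) != 0].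
apply: (@finite_by_code _ _ _ l code).
  move=> v /vertexP[_ [m0 [m1 [m2 [h0 h1 h2 ne]]]]]; exists (m0, m1, m2) => //.
  by apply: (allpairs_f pair); rewrite ?(actB h2) //; apply: (allpairs_f pair); apply: actB; eassumption.
move=> v v' [[m0 m1] m2] hv hv' [h0 h1 h2 /eqP ne] [h0' h1' h2' _]; rewrite /= in h0 h1 h2 h0' h1' h2' ne.
apply/eqP; rewrite eq_sym -subr_eq0; apply: contraT => n0; case: ne.
by apply: (dot0_cross n0); apply: mono_sub; rewrite -?(actE h0) -?(actE h1) -?(actE h2)
  -?(actE h0') -?(actE h1') -?(actE h2').
Qed.

Lemma lex_dir_scale e e' (a : R) : piece e -> piece e' ->
  dir (e, true) = (a * (dir (e', true)).1, a * (dir (e', true)).2) -> 0 < a.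
Proof.
move=> /pieceP[l _ _ _] /pieceP[l' _ _ _] [h1 h2].
exact: lex_lt_scale l l' h1 h2.
Qed.

(** A piece is determined by two gradients that are active along it together
    with its first end; on the boundary the line meets the interior of [Om] in
    one segment only. *)
Lemma pieces_finite : finite_set piece.
Proof.
pose cuts := [seq Some p | p <- fset_set (graph_vertex Om F) ++ ps].
pose l := [seq (q, o) | q <- [seq (m0, m1) | m0 <- B, m1 <- B], o <- None :: cuts].
pose code e (q : (int * int) * (int * int) * option (R * R)) :=
  [/\ q.1.1 != q.1.2, act (ray (org (e, true)) (dir (e, true)) (1 / 2)) q.1.1,
      act (ray (org (e, true)) (dir (e, true)) (1 / 2)) q.1.2 &
      if q.2 is Some p then e.1 = p else bd Om e.1].
apply: (@finite_by_code _ _ _ l code).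
  move=> e pe; have [m [m' [hm hm' ne]]] := piece_two_act (d := (e, true)) pe (dart_mid (e, true)).
  have hmm : (m, m') \in [seq (m0, m1) | m0 <- B, m1 <- B].
    by apply: (allpairs_f pair); [apply: actB hm|apply: actB hm'].
  case: (piece_end pe (or_introl erefl)) => he; last first.
    by exists (m, m', None); [apply: (allpairs_f pair) => //; rewrite mem_head|].
  exists (m, m', Some e.1) => //; apply: (allpairs_f pair) => //.
  rewrite inE map_f ?orbT // mem_cat; apply/orP; case: he => h; [left|by right].
  by rewrite in_fset_set ?inE //; apply: vertices_finite.
move=> e e' [[m m'] o] pe pe' [/= ne h1 h2 ho] [/= _ h1' h2' ho'].
have p0 : vz (m' - m) != 0 by rewrite vz_neq0 // subr_eq0 eq_sym.
have a1 := act_along (d := (e, true)) pe (dart_mid _) h1 h2.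
have a1' := act_along (d := (e', true)) pe' (dart_mid _) h1' h2'.
have [a ea] := colinear p0 (dir_neq0 (d := (e', true)) pe') a1' a1.
have a0 := lex_dir_scale pe pe' ea.
suff eo : e.1 = e'.1.
  by have := dart_dir_uniq (d := (e, true)) (d' := (e', true)) pe pe' eo a0 ea => -[].
case: o ho ho' => [p -> -> //|b1 b1'].
have mids (e1 : piece_type R) t : piece e1 -> 0 < t < 1 -> Om° (ray e1.1 (dir (e1, true)) t).
  by move=> p1 ht; apply: (piece_interior p1); apply/(dart_opens (e1, true)); exists t.
have noway (e1 e2 : piece_type R) (q1 q2 : R) : piece e1 -> piece e2 -> bd Om e2.1 -> 0 < q1 -> 0 < q2 ->
    e2.1 = ray e1.1 (dir (e1, true)) q1 ->
    dir (e2, true) = (q2 * (dir (e1, true)).1, q2 * (dir (e1, true)).2) -> False.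
  move=> p1 p2 [_ b2] q10 q20 eo ed; apply: b2.
  pose t := Num.min 1 q1 / 2.
  have t0 : 0 < t by rewrite divr_gt0 // lt_min ltr01.
  have t1 : t <= 1 / 2 by rewrite ler_pM2r ?invr_gt0 // ge_min lexx.
  have t2 : t <= q1 / 2 by rewrite ler_pM2r ?invr_gt0 // ge_min lexx orbT.
  have x1 := mids e1 t p1 ltac:(by apply/andP; lra).
  have x2 := mids e2 (1 / 2) p2 ltac:(by apply/andP; lra).
  pose D := q1 - t + q2 / 2; have D0 : D != 0 by rewrite gt_eqF // /D; lra.
  have := Omi_convex x1 (Omi_sub x2) (t := (q1 - t) / D) _.
  have -> : ray (ray e1.1 (dir (e1, true)) t)
      (ray e2.1 (dir (e2, true)) (1 / 2) - ray e1.1 (dir (e1, true)) t) ((q1 - t) / D) = e2.1.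
    rewrite eo ed; case: (dir _) => u1 u2; rewrite /ray /=.
    have e3 : q1 = t + D - q2 / 2 by rewrite /D; ring.
    have e4 : (q1 - t) / D * D = q1 - t by rewrite divfK.
    congr pair.
      transitivity (e1.1.1 + t * u1 + ((q1 - t) / D * D) * u1); last by rewrite e4; ring.
      by rewrite /D; ring.
    transitivity (e1.1.2 + t * u2 + ((q1 - t) / D * D) * u2); last by rewrite e4; ring.
    by rewrite /D; ring.
  apply; apply/andP; split; first by apply: divr_ge0; rewrite /D; lra.
  by rewrite ltr_pdivrMr ?mul1r /D; lra.
have o1 := act_org (d := (e, true)) pe (dart_mid _).
have o1' := act_org (d := (e', true)) pe' (dart_mid _).
have a2 : dot (vz (m' - m)) (e.1 - e'.1) = 0.
  exact: mono_sub (etrans (esym (actE (o1' _ h2'))) (actE (o1' _ h1')))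
                  (etrans (esym (actE (o1 _ h2))) (actE (o1 _ h1))).
have [q eq] := colinear p0 (dir_neq0 (d := (e', true)) pe') a1' a2.
have eqq : e.1 = ray e'.1 (dir (e', true)) q.
  rewrite -[LHS](subrK e'.1) eq /ray addrC; by case: (e'.1).
case: (ltgtP q 0) => q0.
- exfalso; apply: (noway e e' (- q / a) (a^-1)) => //.
  + by rewrite divr_gt0 // oppr_gt0.
  + by rewrite invr_gt0.
  + have an : a != 0 by rewrite gt_eqF.
    by rewrite ea eqq /ray /=; case: (e'.1) => ? ? /=; congr pair; field.
  + by rewrite ea /= !mulKf ?gt_eqF //; case: (dir _).
- exfalso; exact: (noway e' e q a).
- by rewrite eqq q0 ray0.
Qed.

Definition darts := [seq (e, b) | e <- (fset_set piece : seq (piece_type R)), b <- [:: true; false]].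

Lemma mem_darts d : (d \in darts) = `[< piece d.1 >].
Proof.
apply/idP/asboolP => [/allpairsP[[e b] /= [h _ ->]]|h].
  by move: h; rewrite in_fset_set ?inE //; apply: pieces_finite.
case: d h => e b /= h; apply: (allpairs_f pair); last by case: (b).
by rewrite in_fset_set ?inE //; apply: pieces_finite.
Qed.

Lemma uniq_darts : uniq darts.
Proof. by apply: allpairs_uniq => // -[? ?] [? ?] _ _. Qed.

Section Flow.
Variable g : int * int -> R.

Definition flow d := g (side true d) - g (side false d).

Lemma flow_flip d : piece d.1 -> flow (flip d) = - flow d.
Proof. by move=> pd; rewrite /flow !side_flip //= opprB. Qed.

(** Around a vertex every cell lies to the left of one dart and to the right of
    another. *)
Lemma vertex_flow v : graph_vertex Om F v -> \sum_(d <- darts | org d == v) flow d = 0.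
Proof.
move=> hv; rewrite /flow sumrB; apply/eqP; rewrite subr_eq0; apply/eqP.
pose cs := [seq m <- undup B | act v m && `[< cell m >]].
suff H sg : \sum_(d <- darts | org d == v) g (side sg d) = \sum_(m <- cs) g m.
  by rewrite !H.
rewrite -big_filter -(big_map (side sg) predT g); apply: perm_big; apply: uniq_perm.
- rewrite map_inj_in_uniq ?filter_uniq ?uniq_darts // => d d'.
  rewrite !mem_filter !mem_darts => /andP[/eqP o1 /asboolP p1] /andP[/eqP o2 /asboolP p2].
  by apply: star_uniq => //; rewrite o1 o2.
- by rewrite filter_uniq // undup_uniq.
move=> m; apply/mapP/idP => [[d + ->]|].
  rewrite !mem_filter mem_darts => /andP[/eqP o1 /asboolP p1].
  have h := side_org sg p1; rewrite mem_undup (actB h) -o1 h andbT /=.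
  exact/asboolP/side_cell.
rewrite mem_filter => /andP[/andP[hm /asboolP cm] _].
have [d [pd od sd]] := star_ex sg hv cm hm; exists d => //.
by rewrite mem_filter mem_darts od eqxx; apply/asboolP.
Qed.

Definition boundary_cell m := cell m /\ exists2 x, Om x & mono m x = 0.

Lemma boundary_side sg d : piece d.1 -> bd Om (org d) -> boundary_cell (side sg d).
Proof.
move=> pd hb; split; first exact: side_cell.
by exists (org d); [exact: org_in|rewrite -(actE (side_org sg pd)) F_bd].
Qed.

Hypothesis g_bd : forall m, boundary_cell m -> g m = 0.
Hypothesis uniq_ps : uniq ps.

(** The total flow out of a union of components of the cut graph cancels in
    pairs along the edges and at the vertices: what remains is the flow through
    the marked ends. *)
Lemma marks_flow (kappa : piece_type R * bool -> bool) :
  (forall d, piece d.1 -> kappa (flip d) = kappa d) ->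
  (forall d d', piece d.1 -> piece d'.1 -> org d = org d' -> graph_vertex Om F (org d) ->
     kappa d = kappa d') ->
  \sum_(p <- ps) \sum_(d <- darts | org d == p) (kappa d)%:R * flow d = 0.
Proof.
move=> hflip hvert; pose X d := (kappa d)%:R * flow d.
have tot : \sum_(d <- darts) X d = 0.
  rewrite /darts big_allpairs_dep big1_seq // => e /andP[_ he].
  have pe : piece e by move: he; rewrite in_fset_set ?inE //; apply: pieces_finite.
  rewrite big_cons big_seq1 /X.
  by rewrite -[(e, false)]/(flip (e, true)) hflip // flow_flip // mulrN /= subrr.
pose vs : seq (R * R) := fset_set (graph_vertex Om F).
have mvs v : (v \in vs) = `[< graph_vertex Om F v >].
  by rewrite /vs in_fset_set //; apply: vertices_finite.
have vsum : \sum_(d <- darts | org d \in vs) X d = 0.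
  rewrite -(sum_fibres _ _ _ (fset_uniq _)) big1_seq // => v /andP[_].
  rewrite mvs => /asboolP hv.
  have [d0|nd] := pselect (exists2 d, piece d.1 & org d = v); last first.
    rewrite big1_seq // => d /andP[/eqP od]; rewrite mem_darts => /asboolP pd.
    by case: nd; exists d.
  have [d pd od] := d0; transitivity ((kappa d)%:R * \sum_(d' <- darts | org d' == v) flow d').
    rewrite big_distrr /= big_seq_cond [RHS]big_seq_cond; apply: eq_bigr => d' /andP[+ /eqP od'].
    rewrite mem_darts => /asboolP pd'; rewrite /X (hvert d d') //; first by rewrite od od'.
    by rewrite od.
  by rewrite vertex_flow // mulr0.
rewrite -[LHS]/(\sum_(p <- ps) \sum_(d <- darts | org d == p) X d).
rewrite (sum_fibres darts org X uniq_ps) -[RHS]tot [RHS](bigID (fun d => org d \in ps)) /= -[LHS]addr0.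
congr (_ + _); symmetry; rewrite -[RHS]vsum.
rewrite big_seq_cond [RHS]big_seq_cond [LHS]big_mkcond [RHS]big_mkcond /=.
apply: eq_bigr => d _; have [hd|//] := boolP (d \in darts).
move: hd; rewrite mem_darts => /asboolP pd /=; rewrite mvs.
have [hp|np] := boolP (org d \in ps).
  by have [_ nv] := ps_reg hp; case: asboolP.
case: asboolP => //= nv; case: (dart_start pd) => [[//|h]|hb]; first by rewrite h in np.
by rewrite /X /flow !g_bd ?subrr ?mulr0 //; apply: boundary_side.
Qed.

End Flow.

Lemma sum_mark (X : piece_type R * bool -> R) p d1 d2 : d1.1 != d2.1 -> piece d1.1 -> piece d2.1 ->
  org d1 = p -> org d2 = p -> (forall d, piece d.1 -> org d = p -> d = d1 \/ d = d2) ->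
  \sum_(d <- darts | org d == p) X d = X d1 + X d2.
Proof.
move=> n12 p1 p2 o1 o2 hd; have ne : d2 != d1 by apply: contra n12 => /eqP ->.
have h1 : d1 \in darts by rewrite mem_darts; apply/asboolP.
have h2 : d2 \in darts by rewrite mem_darts; apply/asboolP.
suff pe : perm_eq [seq d <- darts | org d == p] [:: d1; d2].
  by rewrite -big_filter (perm_big _ pe) /= big_cons big_seq1.
apply: uniq_perm; [by rewrite filter_uniq // uniq_darts|by rewrite /= inE eq_sym ne|].
move=> d; rewrite mem_filter !inE; apply/andP/orP.
  by rewrite mem_darts => -[/eqP od /asboolP pd]; case: (hd d pd od) => ->; rewrite eqxx; auto.
by case=> /eqP ->; rewrite ?o1 ?o2 eqxx.
Qed.

(** * Minimality of the relaxation *)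

Hypothesis F_min : forall G, tropical_series Om G ->
  (forall p, p \in ps -> corner_locus Om G p) -> forall x, Om x -> F x <= G x.

Lemma F_ge0 x : Om x -> 0 <= F x.
Proof.
move=> hx; have [/F_pos/ltW //|nx] := pselect (Om° x).
by rewrite F_bd.
Qed.

(** The gradient of a third cell at the mark would lie strictly between those of the
    two sides on a line, so that its affine function would be nowhere strictly the
    smallest of the three. *)
Lemma mark_cell p d m : p \in ps -> piece d.1 -> org d = p -> cell m -> act p m ->
  m = side true d \/ m = side false d.
Proof.
move=> hp pd od cm hm; have [d1 [d2 [p1 p2 [o1 o2] n12 [hd ha hs _]]]] := mark_darts hp.
suff [->|->] : m = side true d1 \/ m = side false d1.
- by case: (hd d pd od) => ->; rewrite ?hs /=; auto.
- by case: (hd d pd od) => ->; rewrite ?hs /=; auto.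
have o0 := dart_mid d1; have [h1 h2] := sideP true p1 o0; have [h3 h4] := sideP false p1 o0.
have [->|nL] := eqVneq m (side true d1); first by left.
have [->|nR] := eqVneq m (side false d1); first by right.
exfalso; have hm1 : act (ray (org d1) (dir d1) (1 / 2)) m by rewrite ha.
have l1 := h2 _ hm1 nL; have l2 := h4 _ hm1 nR; have [w hw] := cm.
have hpi : Om° p by apply: ps_in.
have hL : act p (side true d1) by rewrite -o1 side_org.
have hR : act p (side false d1) by rewrite -o1 side_org.
have c1 := cell_dir hw (Omi_sub hpi) hm hL; rewrite eq_sym in nL; have {}c1 := c1 nL.
have c2 := cell_dir hw (Omi_sub hpi) hm hR; rewrite eq_sym in nR; have {}c2 := c2 nR.
have key k : act (ray (org d1) (dir d1) (1 / 2)) k ->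
    dot (dir d1) (dir d1) * dot (vz (k - m)) (w - p) =
    - (dot (vz (m - k)) (perp (dir d1)) * cross (dir d1) (w - p)).
  move=> hk; rewrite dot_cross dot_perp (_ : dot (dir d1) _ = 0).
    by rewrite !vzB mul0r add0r /cross /=; ring.
  by rewrite -(act_along p1 o0 hm1 hk) /dot; ring.
have dd := dot_gt0 (dir_neq0 p1).
have {}c1 := mulr_gt0 dd c1; rewrite (key _ h1) oppr_gt0 in c1.
have {}c2 := mulr_gt0 dd c2; rewrite (key _ h3) oppr_gt0 in c2.
rewrite /sgn mul1r in l1; rewrite /sgn mulN1r oppr_gt0 in l2.
rewrite (pmulr_rlt0 _ l1) in c1; rewrite (nmulr_rlt0 _ l2) in c2.
by move: c1; rewrite (lt_gtF c2).
Qed.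

(** Minimality: lowering the coefficients of a set of cells that misses the
    boundary and contains both or none of the cells next to each mark would give
    a smaller series with the same corners at the marks. *)
Lemma no_lowering (U : int * int -> bool) : (forall m, boundary_cell m -> ~~ U m) ->
  (forall d, org d \in ps -> piece d.1 -> U (side true d) = U (side false d)) ->
  forall m, cell m -> ~~ U m.
Proof.
move=> Ubd Ups m0 cm0; apply/negP => Um0.
pose V m := U m && `[< cell m >].
have [m hm|e e0 he] := @seq_eps R _ B (fun m (e : R) =>
    (V m -> forall x, Om x -> e <= mono m x) /\
    (forall p, p \in ps -> ~~ act p m -> F p + e < mono m p)).
  have [|e1 e10 h1] := @seq_eps R _ ps (fun p (e : R) => ~~ act p m -> F p + e < mono m p).
    move=> p hp; have hpO := Omi_sub (ps_in hp); have hle := F_le hpO hm.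
    exists ((mono m p - F p) / 2 + (if act p m then 1 else 0)).
      case: ifP => [_|nact]; first by lra.
      rewrite addr0 divr_gt0 // subr_gt0 lt_neqAle hle andbT; apply/eqP => e.
      by move: nact; rewrite /act hm e eqxx.
    move=> e' /andP[p0 p1] nact; rewrite (negbTE nact) addr0 in p1.
    suff : F p < mono m p by lra.
    rewrite lt_neqAle hle andbT; apply: contra nact => /eqP e.
    by rewrite /act hm e eqxx.
  have [e2 e20 h2] : exists2 e2, 0 < e2 & V m -> forall x, Om x -> e2 <= mono m x.
    have [/andP[Um /asboolP cm]|_] := boolP (V m); last by exists 1.
    have [y hy] := cm; have Omn : Om !=set0 by exists y; apply: Omi_sub hy.1.
    have cont : {within Om, continuous (mono m)}.
      by apply: continuous_subspaceT; apply: continuous_aff.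
    have [z /set_mem hz hmin] := compact_EVT_min Omn cOm cont.
    exists (mono m z); last by move=> _ x hx; apply: hmin; apply/mem_set.
    rewrite lt0r (le_trans (F_ge0 hz) (F_le hz hm)) andbT; apply/eqP => ez.
    by have := Ubd m; rewrite Um => /(_ _)/negP; apply=> //; split=> //; exists z.
  exists (Num.min e1 e2); first by rewrite lt_min e10.
  move=> e' /andP[p0]; rewrite le_min => /andP[l1 l2]; split.
    by move=> hV x hx; apply: le_trans l2 (h2 hV x hx).
  by move=> p hp; apply: h1; rewrite // p0.
have {}he m : m \in B -> (V m -> forall x, Om x -> e <= mono m x) /\
    (forall p, p \in ps -> ~~ act p m -> F p + e < mono m p).
  by move=> hm; apply: he; rewrite // e0 lexx.
pose lower m : R := if V m then e else 0.
have lower0 m : 0 <= lower m by rewrite /lower; case: ifP => // _; apply: ltW.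
have lowere m : lower m <= e by rewrite /lower; case: ifP => // _; apply: ltW.
pose K := [seq (m, c m - lower m) | m <- B].
have KE m x : hp (m, c m - lower m) x = mono m x - lower m by rewrite /hp /mono /=; ring.
have [w0 hw0] := cm0; have w0O := Omi_sub hw0.1.
have hm0 := region_act hw0.
have [|G hG] := @lmin_ex R K.
  by apply/eqP => eK; have := map_f (fun m => (m, c m - lower m)) (actB hm0); rewrite -/K eK.
have GleK m x : m \in B -> G x <= mono m x - lower m.
  by move=> hm; have [h _] := hG x; rewrite -KE; apply: h; apply: map_f.
have Gat x : exists2 m, m \in B & G x = mono m x - lower m.
  by have [_ [k /mapP[m hm ->] ->]] := hG x; exists m => //; rewrite KE.
have GleF x : Om x -> G x <= F x.
  move=> hx; have [m hm] := act_ex hx; rewrite (actE hm).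
  by apply: le_trans (GleK m x (actB hm)) _; rewrite gerBl.
have G0 x : Om x -> 0 <= G x.
  move=> hx; have [m hm ->] := Gat x; rewrite subr_ge0 /lower; case: ifP => hV.
    by have [h _] := he m hm; apply: h.
  exact: le_trans (F_ge0 hx) (F_le hx hm).
have sG : tropical_series Om G.
  apply: (lmin_series hG G0) => x hx; have [hxO _] := hx.
  by apply/eqP; rewrite eq_le G0 // andbT -(F_bd hx) GleF.
have cG p : p \in ps -> corner_locus Om G p.
  move=> hp; have [d1 [d2 [p1 p2 [o1 o2] _ _]]] := mark_darts hp.
  have hpO := Omi_sub (ps_in hp).
  apply: (lmin_corner hG); first exact: ps_in.
  pose L := side true d1; pose Rr := side false d1.
  have hL : act p L by rewrite -o1 side_org.
  have hR : act p Rr by rewrite -o1 side_org.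
  have VLR : V L = V Rr.
    rewrite /V /L /Rr Ups ?o1 //; congr (_ && _).
    by apply/asboolP/asboolP => _; apply: side_cell.
  have Gp : G p = F p - lower L.
    apply/eqP; rewrite eq_le; apply/andP; split; first by rewrite (actE hL) GleK ?(actB hL).
    have [m hm ->] := Gat p.
    have [hmp|nmp] := boolP (act p m); last first.
      have [_ h] := he m hm; have := h p hp nmp; have := lower0 L; have := lowere m; lra.
    rewrite -(actE hmp) lerD2l lerN2 /lower; case: ifP => hV; last by case: ifP => // _; apply: ltW.
    have /andP[_ /asboolP cm] := hV.
    by case: (mark_cell hp p1 o1 cm hmp) => em; rewrite em -?/L -?/Rr -?VLR in hV; rewrite hV.
  exists (L, c L - lower L), (Rr, c Rr - lower Rr); rewrite !KE; split.
  - exact: (map_f (fun m => (m, c m - lower m)) (actB hL)).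
  - exact: (map_f (fun m => (m, c m - lower m)) (actB hR)).
  - exact: side_neq.
  - by rewrite -(actE hL).
  - by rewrite -(actE hR) Gp /lower VLR.
have := F_min sG cG w0O; have := GleK m0 w0 (actB hm0).
rewrite -(actE hm0) /lower /V Um0 /= (_ : `[< cell m0 >] = true); last exact/asboolP.
lra.
Qed.

(** * Winding numbers *)

(** A closed walk through vertices along pieces, each used at most once; by
    [w_closed] it is known only through its boundary. *)
Section Winding.
Variable w : seq (piece_type R * bool).
Hypothesis w_piece : forall d, d \in w -> piece d.1.
Hypothesis w_vertex : forall d, d \in w -> graph_vertex Om F (org d) /\ graph_vertex Om F (dst d).
Hypothesis w_closed : forall phi : R * R -> R, \sum_(d <- w) (phi (dst d) - phi (org d)) = 0.
Hypothesis w_uniq : uniq (map fst w).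

Definition on_edge e x := [\/ opens e x, x = e.1 | x = e.2].
Definition off x := forall d, d \in w -> ~ on_edge d.1 x.

(** The slope [eta] tilts the level lines so that every edge of the walk climbs. *)
Variable eta : R.
Definition lev x : R := x.1 + eta * x.2.
Hypothesis eta_ok : forall d, d \in w -> lev d.1.1 < lev d.1.2.

(** Does the ray from [x] on which [lev] is constant, upwards, cross [e]? The
    half-open condition makes each vertex count for one of its two sides. *)
Definition crosses e x : bool :=
  (lev e.1 <= lev x < lev e.2) && (cross (e.2 - e.1) (x - e.1) < 0).

Definition winding x : R := \sum_(d <- w) sgn d.2 * (crosses d.1 x)%:R.

Definition above x v : bool := (lev v == lev x) && (x.2 < v.2).

Lemma near_lev x (a : R) : a < lev x -> \forall y \near x, a < lev y.
Proof.
have E z : lev z = 0 + dot (1, eta) z by rewrite /lev /dot /=; ring.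
move=> h; have : 0 < (- a) + dot (1, eta) x by rewrite E in h; lra.
by move/near_aff; apply: filterS => y; rewrite E; lra.
Qed.

Lemma near_lev' x (a : R) : lev x < a -> \forall y \near x, lev y < a.
Proof.
have E z : lev z = 0 + dot (1, eta) z by rewrite /lev /dot /=; ring.
move=> h; have : 0 < a + dot (- 1, - eta) x by rewrite /dot /=; move: h; rewrite /lev; lra.
by move/near_aff; apply: filterS => y; rewrite /dot /lev /=; lra.
Qed.

Lemma near_cross (u a : R * R) x : cross u (x - a) != 0 ->
  \forall y \near x, (cross u (y - a) < 0) = (cross u (x - a) < 0).
Proof.
have E z : cross u (z - a) = - cross u a + dot (- u.2, u.1) z by rewrite /cross /dot /=; ring.
have E' z : - cross u (z - a) = cross u a + dot (u.2, - u.1) z by rewrite /cross /dot /=; ring.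
case: (ltgtP (cross u (x - a)) 0) => [h|h|//] _.
  have : 0 < cross u a + dot (u.2, - u.1) x by rewrite -E'; lra.
  by move/near_aff; apply: filterS => y; rewrite -E' => h'; apply/idP; lra.
have : 0 < - cross u a + dot (- u.2, u.1) x by rewrite -E.
by move/near_aff; apply: filterS => y; rewrite -E => h'; apply/negbTE; rewrite -leNgt ltW.
Qed.

Lemma on_edge_line e x : lev e.1 < lev e.2 -> lev e.1 < lev x < lev e.2 ->
  cross (e.2 - e.1) (x - e.1) = 0 -> opens e x.
Proof.
move=> h /andP[h1 h2] cr; pose D := lev e.2 - lev e.1; have D0 : 0 < D by rewrite subr_gt0.
have Dn : D != 0 by rewrite gt_eqF.
apply/open_segmentP; exists ((lev x - lev e.1) / D).
  by rewrite divr_gt0 ?subr_gt0 //= ltr_pdivrMr // mul1r /D; lra.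
rewrite [LHS]surjective_pairing /ray; congr pair; apply: (mulIf Dn).
  transitivity (e.1.1 * D + (lev x - lev e.1) * (e.2 - e.1).1); last first.
    by rewrite [RHS]mulrDl; congr (_ + _); rewrite [RHS]mulrAC divfK.
  apply/eqP; rewrite -subr_eq0 -(mulr0 (- eta)) -cr /D /lev /cross /=; apply/eqP; ring.
transitivity (e.1.2 * D + (lev x - lev e.1) * (e.2 - e.1).2); last first.
  by rewrite [RHS]mulrDl; congr (_ + _); rewrite [RHS]mulrAC divfK.
by apply/eqP; rewrite -subr_eq0 -cr /D /lev /cross /=; apply/eqP; ring.
Qed.

(** Off the edge, the crossing number changes only when the ray sweeps over an
    end of the edge lying above [x]. *)
Lemma near_crosses e x : lev e.1 < lev e.2 -> ~ on_edge e x ->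
  \forall y \near x, (crosses e y)%:R - (crosses e x)%:R =
    (lev y < lev x)%R%:R * ((above x e.2)%:R - (above x e.1)%:R) :> R.
Proof.
move=> he no.
have crE (v : R * R) : lev v = lev x -> cross (e.2 - e.1) (x - v) = (x.2 - v.2) * (lev e.2 - lev e.1).
  move=> h; have e1 : x.1 - v.1 = eta * v.2 - eta * x.2 by move: h; rewrite /lev; lra.
  by rewrite /cross /= e1 /lev; ring.
have D0 : 0 < lev e.2 - lev e.1 by rewrite subr_gt0.
have ne v : lev v = lev x -> x != v -> x.2 - v.2 != 0.
  move=> h; apply: contra; rewrite subr_eq0 => /eqP h2; apply/eqP.
  by move: h; rewrite /lev [x]surjective_pairing [v]surjective_pairing /= h2 => /addIr ->.
case: (ltgtP (lev x) (lev e.1)) => c1.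
- have h := near_lev' c1; apply: filterS h => y hy.
  rewrite /crosses /above !leNgt c1 hy /= (gt_eqF c1) (gt_eqF (lt_trans c1 he)) /=.
  by rewrite !subrr mulr0.
- case: (ltgtP (lev x) (lev e.2)) => c2.
  + have nz : cross (e.2 - e.1) (x - e.1) != 0.
      by apply/eqP => cr; apply: no; apply: Or31; apply: on_edge_line; rewrite // c1.
    apply: filterS3 (near_lev c1) (near_lev' c2) (near_cross nz) => y h1 h2 h3.
    rewrite /crosses /above (ltW c1) c2 (ltW h1) h2 h3 /= (lt_eqF c1) (gt_eqF c2) /=.
    by rewrite !subrr mulr0.
  + apply: filterS (near_lev c2) => y hy.
    rewrite /crosses /above !(ltNge _ (lev e.2)) (ltW c2) (ltW hy) !andbF /=.
    by rewrite (lt_eqF c1) (lt_eqF c2) /= !subrr mulr0.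
  + have xn : x != e.2 by apply/eqP => h; apply: no; apply: Or33.
    have cE : cross (e.2 - e.1) (x - e.1) = (x.2 - e.2.2) * (lev e.2 - lev e.1).
      by rewrite -crE //; rewrite /cross /=; ring.
    have nz : cross (e.2 - e.1) (x - e.1) != 0.
      by rewrite cE mulf_neq0 ?ne // gt_eqF.
    apply: filterS2 (near_lev c1) (near_cross nz) => y h1 h2.
    rewrite /crosses /above h2 cE pmulr_llt0 // subr_lt0 (ltW h1) -c2 ltxx andbF eqxx (lt_eqF c1) /= !subr0.
    by do 2!case: (_ < _); rewrite /= ?mulr1 ?mulr0 ?mul0r.
- have xn : x != e.1 by apply/eqP => h; apply: no; apply: Or32.
  have nz : cross (e.2 - e.1) (x - e.1) != 0.
    by rewrite crE // mulf_neq0 ?ne // gt_eqF.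
  have c2 : lev x < lev e.2 by rewrite c1.
  apply: filterS2 (near_lev' c2) (near_cross nz) => y h1 h2.
  rewrite /crosses /above h2 crE // pmulr_llt0 // subr_lt0 h1 -c1 c2 lexx eqxx (gt_eqF c2) /= sub0r leNgt.
  by case: (lev y < lev x) => /=; case: (x.2 < e.1.2); rewrite /=; ring.
Qed.

Lemma sum_above x : \sum_(d <- w) sgn d.2 * ((above x d.1.2)%:R - (above x d.1.1)%:R) = 0 :> R.
Proof.
rewrite -[RHS](w_closed (fun v => (above x v)%:R)); apply: eq_bigr => d _.
by rewrite /sgn /org /dst; case: (d.2); rewrite ?mul1r // mulN1r opprB.
Qed.

Lemma winding_near x : off x -> \forall y \near x, winding y = winding x.
Proof.
move=> ox; have : \forall y \near x, forall d, d \in w -> (crosses d.1 y)%:R - (crosses d.1 x)%:R =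
    (lev y < lev x)%R%:R * ((above x d.1.2)%:R - (above x d.1.1)%:R) :> R.
  by apply: near_seq => d hd; apply: near_crosses; [exact: eta_ok|exact: ox].
apply: filterS => y hy; apply/eqP; rewrite -subr_eq0 /winding -sumrB.
rewrite big_seq (eq_bigr (fun d => (lev y < lev x)%R%:R *
  (sgn d.2 * ((above x d.1.2)%:R - (above x d.1.1)%:R)))); last first.
  by move=> d hd; rewrite -mulrBr hy // mulrCA.
by rewrite -big_seq -big_distrr /= sum_above mulr0.
Qed.

(** The crossing number of the edge itself changes by one, and the other edges
    contribute the same on both sides. *)
Lemma winding_jump d x : d \in w -> opens d.1 x ->
  (forall d', d' \in w -> d'.1 != d.1 -> ~ on_edge d'.1 x) ->
  exists2 q0, 0 < q0 & forall q, 0 < q <= q0 ->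
    winding (ray x (perp (dir d)) q) != winding (ray x (perp (dir d)) (- q)).
Proof.
move=> hd ox hoff; have pd := w_piece hd; have he := eta_ok hd.
have [t /andP[t0 t1] ex] := (open_segmentP _ _ _).1 ox.
have levx : lev d.1.1 < lev x < lev d.1.2.
  have e1 : lev x - lev d.1.1 = t * (lev d.1.2 - lev d.1.1) by rewrite ex /lev /ray /=; ring.
  have e2 : lev d.1.2 - lev x = (1 - t) * (lev d.1.2 - lev d.1.1) by rewrite ex /lev /ray /=; ring.
  by rewrite -subr_gt0 e1 -[X in _ && X]subr_gt0 e2 !mulr_gt0 // subr_gt0.
have cr0 : cross (d.1.2 - d.1.1) (x - d.1.1) = 0.
  by rewrite ex /cross /ray /=; ring.
have h1 : \forall y \near x, forall d', d' \in [seq d' <- w | d'.1 != d.1] ->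
    (crosses d'.1 y)%:R - (crosses d'.1 x)%:R =
    (lev y < lev x)%R%:R * ((above x d'.1.2)%:R - (above x d'.1.1)%:R) :> R.
  apply: near_seq => d'; rewrite mem_filter => /andP[ne hd'].
  by apply: near_crosses; [exact: eta_ok|exact: hoff].
case/andP: levx => l1 l2.
have [q0 q0p h] := near_ray (perp (dir d)) (filterI h1 (filterI (near_lev l1) (near_lev' l2))).
exists q0 => // q /andP[qp qle].
have wE y : (forall d', d' \in [seq d' <- w | d'.1 != d.1] ->
      (crosses d'.1 y)%:R - (crosses d'.1 x)%:R =
      (lev y < lev x)%R%:R * ((above x d'.1.2)%:R - (above x d'.1.1)%:R) :> R) ->
    winding y - winding x = sgn d.2 * ((crosses d.1 y)%:R - (crosses d.1 x)%:R).
  move=> hy; rewrite /winding -sumrB (bigD1_seq d) //=; last exact: map_uniq w_uniq.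
  rewrite -mulrBr -[RHS]addr0; congr (_ + _).
  have A0 : (above x d.1.2)%:R - (above x d.1.1)%:R = 0 :> R.
    by rewrite /above (lt_eqF l1) (gt_eqF l2) /= subrr.
  transitivity ((lev y < lev x)%R%:R * \sum_(d' <- w | d' != d)
      (sgn d'.2 * ((above x d'.1.2)%:R - (above x d'.1.1)%:R)) : R); last first.
    have := sum_above x; rewrite (bigD1_seq d) //=; last exact: map_uniq w_uniq.
    by rewrite A0 mulr0 add0r => ->; rewrite mulr0.
  rewrite big_distrr /= big_seq_cond [RHS]big_seq_cond; apply: eq_bigr => d' /andP[hd' ne].
  rewrite -mulrBr hy 1?mulrCA // mem_filter hd' andbT.
  apply: contra ne => /eqP e1; apply/eqP.
  exact: uniq_map_inj w_uniq hd' hd e1.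
have dd := dot_gt0 (dir_neq0 pd).
have cE r : `|r| <= q0 -> crosses d.1 (ray x (perp (dir d)) r) = (r * sgn d.2 < 0).
  move=> /h[_ [h2 h3]]; rewrite /crosses (ltW h2) h3 /=.
  have -> : cross (d.1.2 - d.1.1) (ray x (perp (dir d)) r - d.1.1) =
      r * sgn d.2 * dot (dir d) (dir d).
    transitivity (cross (d.1.2 - d.1.1) (x - d.1.1) + r * cross (d.1.2 - d.1.1) (perp (dir d))).
      by rewrite /cross /ray /=; ring.
    by rewrite cr0 add0r /sgn /dir /dst /org; case: (d.2); rewrite /cross /perp /dot /=; ring.
  by rewrite pmulr_llt0.
have nq : `|q| <= q0 by rewrite gtr0_norm.
have nq' : `|- q| <= q0 by rewrite normrN gtr0_norm.
have [h4 _] := h _ nq; have [h5 _] := h _ nq'.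
have := wE _ h4; have := wE _ h5; rewrite !cE // /sgn.
case: (d.2); rewrite ?mulr1 ?mulrN1 ?opprK ?oppr_lt0 qp (lt_gtF qp) /= => e1 e2; apply/eqP => e3.
  by move: e2; rewrite e3 e1; lra.
by move: e2; rewrite e3 e1; lra.
Qed.

Lemma winding_segment x y : (forall t, 0 <= t <= 1 -> off (ray x (y - x) t)) -> winding x = winding y.
Proof.
move=> hoff; rewrite -{1}(ray0 x (y - x)) -{2}(ray1 x y).
apply: (locally_constant (f := fun t => winding (ray x (y - x) t))) => t ht.
have [q q0 hq] := near_ray (y - x) (winding_near (hoff t ht)).
exists q => // t' ht'; rewrite -(hq (t' - t)) ?(ltW ht') //; congr winding.
by rewrite /ray /=; congr pair; ring.
Qed.

Lemma on_edge_act d x : d \in w -> on_edge d.1 x -> Om° x /\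
  exists m m', [/\ act x m, act x m' & m != m'].
Proof.
move=> hd; have pd := w_piece hd; have [hv1 hv2] := w_vertex hd.
have [m [m' [hm hm' ne]]] := piece_two_act pd (dart_mid d).
have ends : (x = org d \/ x = dst d) -> Om° x /\ exists m m', [/\ act x m, act x m' & m != m'].
  case=> ->; split; [by case: hv1| |by case: hv2|]; exists m, m'; split=> //.
  - exact: act_org pd (dart_mid d) hm.
  - exact: act_org pd (dart_mid d) hm'.
  - exact: act_dst pd (dart_mid d) hm.
  - exact: act_dst pd (dart_mid d) hm'.
case=> [ox|ex|ex]; [|apply: ends; rewrite ex /org /dst; case: (d.2); auto..].
by split; [exact: piece_interior pd ox|exact: piece_two_act pd ox].
Qed.

Lemma region_off m x : region m x -> off x.
Proof.
move=> [_ hr] d hd /(on_edge_act hd)[_ [k [k' []]]].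
by rewrite !hr => /eqP -> /eqP ->; rewrite eqxx.
Qed.

Lemma winding_region m x y : region m x -> region m y -> winding x = winding y.
Proof.
by move=> hx hy; apply: winding_segment => t ht; apply: (@region_off m); apply: region_convex.
Qed.

Lemma winding_closure m x y : Om x -> act x m -> off x -> region m y -> winding y = winding x.
Proof.
move=> hx hm ox hy; have [q q0 hq] := near_ray (y - x) (winding_near ox).
pose t := Num.min 1 q; have t0 : 0 < t by rewrite lt_min ltr01.
have t1 : t <= 1 by rewrite ge_min lexx.
have tq : `|t| <= q by rewrite gtr0_norm // ge_min lexx orbT.
rewrite -(hq t tq); apply: (@winding_region m) => //.
by apply: region_towards; rewrite ?t0.
Qed.

(** A boundary point is joined to infinity within the complement of [Om°]. *)
Lemma winding_bd x : bd Om x -> winding x = 0.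
Proof.
move=> /bdP[hx [h hh h0]].
pose l0 : R * R := (1, eta).
have levE y : lev y = dot l0 y by rewrite /lev /dot /=; ring.
have l00 : l0 != 0 by apply/eqP => -[/eqP]; rewrite oner_eq0.
pose n := vz h.1; have n0 : n != 0.
  by have := hp_normal prim_s hh; apply: contraTneq; rewrite -/n => ->; rewrite /dot /= mul0r addr0 ltxx.
have [z hz lz] : exists2 z, dot n z <= 0 & lev z != 0.
  have [e|ne] := eqVneq (lev (perp n)) 0; last first.
    by exists (perp n) => //; rewrite (_ : dot _ _ = 0) //; rewrite /dot /perp /=; ring.
  exists (- n); first by rewrite dot_opp oppr_le0 ltW // dot_gt0.
  rewrite levE dot_opp oppr_eq0; apply/eqP => e2; move/eqP: l00; apply.
  by apply: (dot_perp0 n0 e2); rewrite -levE.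
have [D D0 hD] := seq_bound w (fun d => `|lev d.1.1| + `|lev d.1.2|).
pose T := (D + `|lev x| + 1) / `|lev z|.
have lz0 : 0 < `|lev z| by rewrite normr_gt0.
have T0 : 0 <= T by rewrite divr_ge0 // !addr_ge0.
pose y := ray x z T.
have levy : lev y = lev x + T * lev z by rewrite /y !levE dot_ray.
have far : D < `|lev y|.
  have e : `|T * lev z| = D + `|lev x| + 1.
    by rewrite normrM (ger0_norm T0) /T divfK // gt_eqF.
  rewrite levy; have := ler_normB (lev x + T * lev z) (lev x).
  by rewrite [_ - lev x]addrAC subrr add0r e; lra.
have y0 : winding y = 0.
  rewrite /winding big1_seq // => d /andP[_ hd].
  have : crosses d.1 y = false.
    apply/negbTE/negP => /andP[/andP[h1 h2] _]; have := hD d hd.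
    have := ler_norm (lev d.1.2); have := ler_norm (- lev d.1.1); rewrite normrN.
    have := normr_ge0 (lev d.1.1); have := normr_ge0 (lev d.1.2).
    by case: (ger0P (lev y)) far => _ far *; lra.
  by move=> ->; rewrite mulr0.
rewrite -y0; apply: winding_segment => t /andP[t0 t1] d hd /(on_edge_act hd)[/OmiP/(_ h hh) + _].
rewrite hp_ray h0 add0r /y (_ : dot (vecz R h.1) _ = T * dot n z); last first.
  by rewrite dot_sub dot_ray -/n; ring.
by apply/negP; rewrite -leNgt !mulr_ge0_le0.
Qed.

Lemma mark_off p : p \in ps -> off p.
Proof.
move=> hp d hd; have pd := w_piece hd; have [h1 h2] := w_vertex hd; have [_ nv] := ps_reg hp.
have ends : (p = org d \/ p = dst d) -> False by case=> e; apply: nv; rewrite e.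
case=> [op|e|e]; [|apply: ends; rewrite e /org /dst; case: (d.2); auto..].
by have [_ h _ _] := (pieceP _).1 pd; have [_] := h _ op; apply; right.
Qed.

(** The winding number vanishes at the boundary and is the same on both sides of a
    mark, which the walk avoids. Hence the cells of nonzero winding number could be
    lowered, so there are none; but the winding number jumps across each edge. *)
Lemma closed_walk_nil : w = [::].
Proof.
case ew : w => [//|d w']; exfalso; have hd : d \in w by rewrite ew mem_head.
pose U m := `[< exists2 x, region m x & winding x != 0 >].
have UE m x : Om x -> act x m -> off x -> cell m -> U m = (winding x != 0).
  move=> hx hm ox [y hy]; apply/asboolP/idP => [[z hz]|h].
    by rewrite (winding_closure hx hm ox hz).
  by exists y => //; rewrite (winding_closure hx hm ox hy).
have all0 m : cell m -> ~~ U m.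
  apply: no_lowering => {}m.
    move=> [cm [x hx m0]].
    have bx : bd Om x.
      split=> // hi; have [y hy] := cm; have hB := actB (region_act hy).
      by have := F_le hx hB; have := F_pos hi; rewrite m0; lra.
    have hm : act x m.
      have [y hy] := cm; have hB := actB (region_act hy).
      by rewrite /act hB m0 F_bd // eqxx.
    rewrite (UE m x) // ?winding_bd ?eqxx // => d' hd' /(on_edge_act hd')[hi _].
    by case: bx.
  move=> hp pm; have hO := Omi_sub (ps_in hp); have ho := mark_off hp.
  by rewrite !(UE _ _ hO _ ho) ?side_org //; apply: side_cell.
have pd := w_piece hd; have o0 := dart_mid d.
have [|q1 q10 jump] := winding_jump hd o0.
  move=> d2 hd2 ne [o2|e|e].
  - by move/eqP: ne; apply; apply: piece_uniq o2 o0 => //; apply: w_piece.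
  - have [_ h _ _] := (pieceP _).1 pd; have [_] := h _ o0; apply.
    by case: (piece_end (w_piece hd2) (or_introl e)) => // -[_]; case; apply: piece_interior o0.
  - have [_ h _ _] := (pieceP _).1 pd; have [_] := h _ o0; apply.
    by case: (piece_end (w_piece hd2) (or_intror e)) => // -[_]; case; apply: piece_interior o0.
have [q2 q20 b2] := region_beside true pd o0; have [q3 q30 b3] := region_beside false pd o0.
pose q := Num.min q1 (Num.min q2 q3).
have q0 : 0 < q by rewrite !lt_min q10 q20.
have l1 : q <= q1 by rewrite ge_min lexx.
have l2 : q <= q2 by rewrite !ge_min lexx orbT.
have l3 : q <= q3 by rewrite !ge_min lexx !orbT.
have := jump q ltac:(by rewrite q0); have := b2 q ltac:(by rewrite q0); have := b3 q ltac:(by rewrite q0).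
have e1 : sgn true * q = q := mul1r q; have e2 : sgn false * q = - q := mulN1r q.
rewrite e1 e2 => r3 r2.
have z m x : region m x -> winding x = 0.
  move=> hr; apply/eqP; have := all0 m (ex_intro _ x hr); apply: contraNT => h.
  by apply/asboolP; exists x.
by rewrite (z _ _ r2) (z _ _ r3) eqxx.
Qed.

End Winding.

(** * The cut graph is a tree *)

Hypothesis uniq_ps : uniq ps.
Hypothesis ps_neq0 : ps != [::].

(** One of the two darts leaving a mark orients the edge that carries it. *)
Definition mark_dart p : piece_type R * bool :=
  xget ((0, 0), true) [set d | piece d.1 /\ org d = p].

Lemma mark_dartP p : p \in ps -> exists d', [/\ piece (mark_dart p).1, org (mark_dart p) = p,
  piece d'.1, org d' = p & [/\ (mark_dart p).1 != d'.1,
    forall d, piece d.1 -> org d = p -> d = mark_dart p \/ d = d' &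
    forall sg, side sg d' = side (~~ sg) (mark_dart p)]].
Proof.
move=> hp; have [d1 [d2 [p1 p2 [o1 o2] n12 [hd _ hs _]]]] := mark_darts hp.
have [pm om] : piece (mark_dart p).1 /\ org (mark_dart p) = p.
  by rewrite /mark_dart; apply: (@xgetPex _ _ [set d | piece d.1 /\ org d = p]); exists d1.
case: (hd _ pm om) => em.
  by exists d2; rewrite em; split=> //; split=> // d pd od; case: (hd d pd od); auto.
exists d1; rewrite em; split=> //; split=> //; first by rewrite eq_sym.
  by move=> d pd od; case: (hd d pd od); auto.
by move=> sg; rewrite hs negbK.
Qed.

Hypothesis indep : forall sc : R * R -> R,
  (forall g : int * int -> R, (forall m, boundary_cell m -> g m = 0) ->
     \sum_(p <- ps) sc p * flow g (mark_dart p) = 0) ->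
  forall p, p \in ps -> sc p = 0.

Let Mk : set (R * R) := [set` ps].
Let T := cut_graph Om F Mk.

Lemma cut_node1 x e : (cut_node Om F x e).1 = x.
Proof. by rewrite /cut_node; case: ifP. Qed.

Lemma cut_node_vertex v e : graph_vertex Om F v -> cut_node Om F v e = (v, None).
Proof. by move=> hv; rewrite /cut_node; case: asboolP. Qed.

Lemma cut_node_end x e : ~ graph_vertex Om F x -> cut_node Om F x e = (x, Some e).
Proof. by move=> hv; rewrite /cut_node; case: asboolP. Qed.

Lemma dart_fromE d : dart_from T d = cut_node Om F (org d) d.1.
Proof. by rewrite /dart_from /org; case: (d.2). Qed.

Lemma dart_toE d : dart_to T d = cut_node Om F (dst d) d.1.
Proof. by rewrite /dart_to /dst; case: (d.2). Qed.

Lemma end_not_vertex x : (Mk `|` bd Om) x -> ~ graph_vertex Om F x.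
Proof. by move=> [/ps_reg[]|[_ nx] []]. Qed.

Lemma dart_from_node d : piece d.1 -> gnodes T (dart_from T d).
Proof.
move=> pd; rewrite dart_fromE; have [hv|nv] := pselect (graph_vertex Om F (org d)).
  by rewrite cut_node_vertex //; left; exists (org d).
rewrite cut_node_end //; right; exists d.1 => //; exists (org d); split=> //.
  by rewrite /org; case: (d.2); auto.
by case: (dart_start pd) => [[//|h]|h]; [left|right].
Qed.

Lemma dart_from_end d x e : dart_from T d = (x, Some e) -> org d = x /\ d.1 = e.
Proof. by rewrite dart_fromE /cut_node; case: ifP => _ [] // -> ->. Qed.

Lemma end_dart x e : gnodes T (x, Some e) -> exists d, [/\ piece d.1, dart_from T d = (x, Some e),
  d.1 = e, org d = x & (Mk `|` bd Om) x].
Proof.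
move=> [[v _ []//]|[e' pe' [x' [hx hb [ex ee]]]]]; subst x' e'.
have nv := end_not_vertex hb.
by case: hx => ex; [exists (e, true)|exists (e, false)]; split; rewrite // dart_fromE /org /= -ex cut_node_end.
Qed.

Lemma end_leaf x e : gnodes T (x, Some e) -> leaf T (x, Some e).
Proof.
move=> hn; have [d [pd fd d1 od _]] := end_dart hn; split=> //; exists d; split=> // d' [pd' fd'].
have [od' d1'] := dart_from_end fd'.
by apply: dart_eq pd _ _; rewrite ?d1 ?d1' ?od ?od'.
Qed.

Lemma vertex_darts v : graph_vertex Om F v -> exists d1 d2, [/\ piece d1.1, piece d2.1, org d1 = v,
  org d2 = v & d1 != d2].
Proof.
move=> hv; have y0 : (1, 0) != 0 :> R * R by apply/eqP => -[/eqP]; rewrite oner_eq0.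
have [m [hm cm _]] := cone_cell hv.1 y0.
have [d1 [p1 o1 s1]] := star_ex true hv cm hm; have [d2 [p2 o2 s2]] := star_ex false hv cm hm.
exists d1, d2; split=> //; apply/eqP => e; have /eqP := side_neq p1; apply.
by rewrite {2}e s1 s2.
Qed.

(** Any cell at a vertex has a dart on either side. *)
Lemma vertex_not_leaf v : graph_vertex Om F v -> ~ leaf T (v, None).
Proof.
move=> hv [_ [d [_ ud]]]; have [d1 [d2 [p1 p2 o1 o2 /eqP]]] := vertex_darts hv; apply.
have e1 : d = d1 by apply: ud; split=> //; rewrite dart_fromE o1 cut_node_vertex.
have e2 : d = d2 by apply: ud; split=> //; rewrite dart_fromE o2 cut_node_vertex.
by rewrite -e1 -e2.
Qed.

Lemma node_dart n : gnodes T n -> exists2 d, piece d.1 & dart_from T d = n.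
Proof.
case: n => x [e|] hn; first by have [d [pd fd _ _ _]] := end_dart hn; exists d.
case: hn => [[v hv [->]]|[e _ [x' [_ _ []//]]]].
have [d [_ [pd _ od _ _]]] := vertex_darts hv; exists d => //.
by rewrite dart_fromE od cut_node_vertex.
Qed.

Lemma cut_graph_is_graph : is_graph T.
Proof.
by move=> e he; split; [apply: (@dart_from_node (e, true))|apply: (@dart_from_node (e, false))].
Qed.

Lemma cut_graph_finite : finite_graph T.
Proof.
split; [exact: cut_graph_is_graph| |exact: pieces_finite].
apply: (@sub_finite_set _ _ ((dart_from T) @` [set` darts])); last exact/finite_image/finite_seq.
by move=> n /node_dart[d pd <-]; exists d => //=; rewrite mem_darts; apply/asboolP.
Qed.

(** A cycle of the cut graph meets no end, so it is a closed polygon of the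
    corner locus missing the marks. *)
Lemma cut_graph_acyclic : acyclic T.
Proof.
move=> w [wn uw _ [x hw]]; have hp d : d \in w -> piece d.1 := walk_edges hw.
have hv d : d \in w -> graph_vertex Om F (org d).
  move=> hd; apply: contrapT => nv; have [d' hd' e] := closed_pred hw hd.
  have : dart_from T (flip d') = (org d, Some d.1).
    by rewrite dart_from_flip e dart_fromE cut_node_end.
  move=> /dart_from_end[o1 e1]; rewrite /= in e1.
  have ed := uniq_map_inj uw hd' hd e1; rewrite ed org_flip in o1.
  by have := dart_neq (hp d hd); rewrite o1 eqxx.
have hv' d : d \in w -> graph_vertex Om F (dst d).
  move=> hd; apply: contrapT => nv; have [d' hd' e] := closed_succ hw hd.
  move: e; rewrite dart_toE cut_node_end // => /dart_from_end[o1 _].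
  by apply: nv; rewrite -o1; apply: hv.
have [eta eta0 heta] : exists2 eta, 0 < eta & forall d, d \in w ->
    d.1.1.1 + eta * d.1.1.2 < d.1.2.1 + eta * d.1.2.2.
  have [d hd|q q0 hq] := @seq_eps R _ w (fun d q => d.1.1.1 + q * d.1.1.2 < d.1.2.1 + q * d.1.2.2).
    have [[l|[l1 l2]] _ _ _] := (pieceP _).1 (hp d hd).
      have h0 : 0 < d.1.2.1 - d.1.1.1 by lra.
      have [q q0 h] := pos_near (d.1.2.2 - d.1.1.2) h0.
      by exists q => // q' /h; lra.
    by exists 1 => // q /andP[q0 _]; rewrite l1 ltrD2l ltr_pM2l.
  by exists q => // d hd; apply: hq; rewrite // q0 lexx.
apply/negP: wn; rewrite negbK; apply/eqP.
apply: (closed_walk_nil (w := w) hp (fun d hd => conj (hv d hd) (hv' d hd)) _ uw heta).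
move=> phi; have := walk_telescope (fun nd => phi nd.1) hw; rewrite subrr => {2}<-.
by apply: eq_bigr => d _; rewrite dart_fromE dart_toE !cut_node1.
Qed.

Lemma seq_keymax (l : seq (R * R)) : l != [::] ->
  exists2 x, x \in l & forall y, y \in l -> ~ keylt x y.
Proof.
move=> l0; have [x hx mx] := seq_argmin (fun y => - F y) l0.
have [|y + my] := @seq_argmin R _ [seq y <- l | F y == F x] (fun y => - y.1).
  by apply/eqP => e; have := mem_filter (fun y => F y == F x) x l; rewrite e hx eqxx.
rewrite mem_filter => /andP[/eqP ey hy].
have [|z + mz] := @seq_argmin R _ [seq z <- l | (F z == F x) && (z.1 == y.1)] (fun y => - y.2).
  by apply/eqP => e; have := mem_filter (fun z => (F z == F x) && (z.1 == y.1)) y l; rewrite e hy ey !eqxx.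
rewrite mem_filter => /andP[/andP[/eqP ez /eqP ez1] hz]; exists z => // t ht.
have h1 := mx t ht; rewrite lerN2 in h1; rewrite /keylt ez; case=> [|[eF]]; first by rewrite ltNge h1.
have h2 := my t; rewrite mem_filter -eF eqxx ht lerN2 in h2; have {}h2 := h2 isT.
case=> [|[e1 h]]; first by rewrite ez1 ltNge h2.
have := mz t; rewrite mem_filter -eF eqxx -e1 ez1 eqxx ht lerN2 => /(_ isT).
by rewrite leNgt h.
Qed.

Lemma keylt_total x y : ~ keylt x y -> ~ keylt y x -> x = y.
Proof.
move=> h1 h2; apply/eqP; apply: contraT => /lex_ltP h.
case: (ltgtP (F x) (F y)) => e; [by case: h1; left|by case: h2; left|].
by case: h => h; [case: h1|case: h2]; right.
Qed.

(** [F] vanishes on the boundary and is positive inside, so it is not affine on a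
    chord. *)
Lemma dart_cut d : piece d.1 -> cutpt (org d) \/ cutpt (dst d).
Proof.
move=> pd; case: (dart_start pd) => h1; first by left.
case: (dart_end pd) => h2; first by right.
have o0 := dart_mid d; have [m [_ [hm _ _]]] := piece_two_act pd o0.
have e1 := actE (act_org pd o0 hm); have e2 := actE (act_dst pd o0 hm); have e0 := actE hm.
have := F_pos (piece_interior pd o0); rewrite e0 mono_ray.
move: e1 e2; rewrite !F_bd // /dir dot_sub /mono; lra.
Qed.

Let cuts : seq (R * R) := fset_set (graph_vertex Om F) ++ ps.

Lemma mem_cuts x : cutpt x -> x \in cuts.
Proof.
rewrite mem_cat => -[hv|->]; last by rewrite orbT.
by apply/orP; left; rewrite in_fset_set; [exact/mem_set|exact: vertices_finite].
Qed.

(** Independence of the marks shows that the component contains both or none of the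
    ends at a mark. So a dart climbing from a cut point of the component stays in
    the component, whose highest cut point is then the highest of all. *)
Lemma component_top n : gnodes T n ->
  [/\ forall d d', piece d.1 -> piece d'.1 -> org d = org d' -> cutpt (org d) ->
     reach T n (dart_from T d) -> reach T n (dart_from T d') &
    exists d, [/\ piece d.1, cutpt (org d), reach T n (dart_from T d) &
      forall x, cutpt x -> ~ keylt (org d) x]].
Proof.
move=> hn; pose kap d := `[< reach T n (dart_from T d) >].
have kflip d : piece d.1 -> kap (flip d) = kap d.
  move=> pd; have h : reach T (dart_from T d) (dart_to T d) by apply: reach_dart.
  rewrite /kap dart_from_flip; apply/asboolP/asboolP => h'; apply: reach_trans h' _ => //.
  exact: reach_sym.
have kvert d d' : piece d.1 -> piece d'.1 -> org d = org d' -> graph_vertex Om F (org d) ->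
    kap d = kap d'.
  by move=> _ _ eo hv; rewrite /kap !dart_fromE -eo !cut_node_vertex.
(* This is nonzero iff the component contains one end at [p] but not the other. *)
pose sc p : R := \sum_(d <- darts | org d == p) (kap d)%:R * (if d == mark_dart p then 1 else - 1).
have sc0 : forall p, p \in ps -> sc p = 0.
  apply: indep => g hg; rewrite -[RHS](marks_flow hg uniq_ps kflip kvert).
  rewrite big_seq_cond [RHS]big_seq_cond; apply: eq_bigr => p /andP[hp _].
  have [d' [p1 o1 p2 o2 [n12 hd hs]]] := mark_dartP hp.
  rewrite /sc !(sum_mark _ n12 p1 p2 o1 o2 hd) eqxx.
  have -> : (d' == mark_dart p) = false by apply/negbTE; apply: contra n12 => /eqP ->.
  have -> : flow g d' = - flow g (mark_dart p) by rewrite /flow !hs opprB.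
  by rewrite mulr1 mulrN1 mulrDl mulrN mulNr.
have kcut d d' : piece d.1 -> piece d'.1 -> org d = org d' -> cutpt (org d) -> kap d = kap d'.
  move=> pd pd' eo [hv|hp]; first exact: kvert.
  have [d2 [p1 o1 p2 o2 [n12 hd hs]]] := mark_dartP hp.
  have := sc0 _ hp; rewrite /sc (sum_mark _ n12 p1 p2 o1 o2 hd) eqxx.
  have -> : (d2 == mark_dart (org d)) = false by apply/negbTE; apply: contra n12 => /eqP ->.
  rewrite mulr1 mulrN1 => /eqP; rewrite subr_eq0 eqr_nat => /eqP ek.
  have {}ek : kap (mark_dart (org d)) = kap d2 by move: ek; case: (kap _); case: (kap _).
  by case: (hd d pd erefl) => ->; case: (hd d' pd' (esym eo)) => ->; rewrite ?ek.
split.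
  move=> d d' pd pd' eo hc hk; have : kap d by apply/asboolP.
  by rewrite (kcut _ _ pd pd' eo hc) => /asboolP.
pose good x := `[< exists d, [/\ piece d.1, org d = x & kap d] >].
have [|x + mx] := @seq_keymax [seq x <- cuts | good x].
  have [d pd fd] := node_dart hn.
  have kd : kap d by apply/asboolP; rewrite fd; apply: reach_refl.
  have aux d' : piece d'.1 -> kap d' -> cutpt (org d') -> [seq x <- cuts | good x] != [::].
    move=> pd' kd' hc; apply/eqP => e; have := mem_filter good (org d') cuts.
    rewrite e mem_cuts //= => /esym/negbT; rewrite andbT => /asboolP; apply.
    by exists d'.
  case: (dart_cut pd) => hc; first exact: aux pd kd hc.
  by apply: (aux (flip d)); rewrite ?kflip // org_flip.
rewrite mem_filter => /andP[/asboolP[d [pd od kd]] hx].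
have hc : cutpt x.
  move: hx; rewrite mem_cat => /orP[|h]; last by right.
  by rewrite in_fset_set; [move=> /set_mem; left|exact: vertices_finite].
exists d; rewrite od; split=> //; first exact/asboolP.
move=> x' hc' hlt; have [d1 [p1 o1 lt1 c1]] := increasing_dart hc (Omi_sub (cutpt_in hc')) hlt.
apply: (mx (dst d1)) lt1; rewrite mem_filter (mem_cuts c1) andbT; apply/asboolP.
exists (flip d1); rewrite kflip // org_flip; split=> //.
by rewrite -(kcut d d1) // ?od.
Qed.

(** Every component contains the darts at the highest cut point. *)
Lemma cut_graph_connected : graph_connected T.
Proof.
split.
  case eps : ps ps_neq0 => [//|p ps'] _; have hp : p \in ps by rewrite eps mem_head.
  by have [_ [pm _ _ _ _]] := mark_dartP hp; exists (dart_from T (mark_dart p)); apply: dart_from_node.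
move=> x y hx hy; have [_ [d [pd cd rd md]]] := component_top hx.
have [ky [d' [pd' cd' rd' md']]] := component_top hy.
have eo : org d = org d' by apply: keylt_total; [apply: md|apply: md'].
have ryd : reach T y (dart_from T d) by apply: ky rd' => //; rewrite eo.
exact: reach_trans rd (reach_sym ryd).
Qed.

Lemma cut_graph_tree : is_tree T.
Proof.
by split; [exact: cut_graph_is_graph|exact: cut_graph_connected|exact: cut_graph_acyclic].
Qed.

(** * The core *)

Let S : set (node_type R) := marked_ends Om F Mk.
Let f := @glue_ends R Mk.

Lemma marked_end_some nd : S nd -> exists e, nd = (nd.1, Some e) /\ gnodes T (nd.1, Some e).
Proof.
case: nd => x [e|] [hn hx]; first by exists e.
case: hn => [[v hv [exv]]|[e _ [x' [_ _ []//]]]].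
by have [_] := ps_reg (hx : x \in ps); rewrite exv.
Qed.

Lemma marked_ends_leaf nd : S nd -> leaf T nd.
Proof. by move=> /marked_end_some[e [-> /end_leaf]]. Qed.

Lemma marked_dart d : piece d.1 -> org d \in ps -> S (dart_from T d) /\
  dart_from T d = (org d, Some d.1).
Proof.
move=> pd hp; have [_ nv] := ps_reg hp.
have e : dart_from T d = (org d, Some d.1) by rewrite dart_fromE cut_node_end.
by split=> //; split; [exact: dart_from_node|rewrite e].
Qed.

Lemma glue_inj (x y : node_type R) : gnodes T x -> gnodes T y -> f x = f y -> x = y \/ S x /\ S y.
Proof.
move=> hx hy; rewrite /f /glue_ends; case: asboolP => mx; case: asboolP => my.
- by move=> [_]; right.
- by move=> e; case: my; rewrite -e.
- by move=> e; case: mx; rewrite e.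
- by move=> ->; left.
Qed.

Lemma card_marked_ends : #|` fset_set S| = (size ps + size ps)%N.
Proof.
pose l := [seq d <- darts | org d \in ps].
have lP d : d \in l -> piece d.1 /\ org d \in ps.
  by rewrite mem_filter mem_darts => /andP[h /asboolP].
rewrite (@card_seq _ (map (dart_from T) l)); last first.
- apply/seteqP; split=> [nd hS|_ /mapP[d /lP[pd hp] ->]]; last by have [] := marked_dart pd hp.
  have [e [en hn]] := marked_end_some hS; have [d [pd fd d1 od _]] := end_dart hn.
  rewrite en -fd; apply: map_f; rewrite mem_filter mem_darts od; apply/andP; split; last exact/asboolP.
  by case: hS.
- rewrite map_inj_in_uniq ?filter_uniq ?uniq_darts // => d d' /lP[pd hp] /lP[pd' hp'].
  have [_ ->] := marked_dart pd hp; have [_ ->] := marked_dart pd' hp' => -[eo e1].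
  exact: dart_eq.
rewrite size_map; apply/eqP; rewrite -(eqr_nat R) -sum1_size natr_sum big_filter.
rewrite -(sum_fibres _ _ _ uniq_ps) natrD; apply/eqP.
rewrite (eq_big_seq (fun=> 1 + 1)); last first.
  move=> p hp; have [d' [p1 o1 p2 o2 [n12 hd _]]] := mark_dartP hp.
  by rewrite (sum_mark _ n12 p1 p2 o1 o2 hd).
by rewrite big_split /= -sum1_size natr_sum.
Qed.

Lemma card_glued_ends : #|` fset_set (f @` S)| = size ps.
Proof.
rewrite (@card_seq _ [seq (p, None) | p <- ps]) ?size_map //; last first.
  apply/seteqP; split=> [_ [nd hS <-]|_ /mapP[p hp ->]].
    have [_ hm] := hS; rewrite /f /glue_ends; case: asboolP => // _.
    exact: (map_f (fun p => (p, None))).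
  have [_ [pm om _ _ _]] := mark_dartP hp; rewrite -om in hp.
  have [hS e] := marked_dart pm hp; exists (dart_from T (mark_dart p)) => //.
  by rewrite e /f /glue_ends /= ; case: asboolP => [_|[]//]; rewrite om.
by rewrite map_inj_uniq // => p p' [].
Qed.

Let H := steiner T S.

(** A boundary end is an unmarked leaf, hence not in the hull of the marked
    ends. *)
Lemma core_node_interior nd : gnodes H nd -> Om° nd.1.
Proof.
have SG : S `<=` gnodes T by move=> x [].
move=> hH; have [_ sub _ _ _] := steiner_subgraph cut_graph_is_graph SG.
have hn := sub _ hH; case: nd hH hn => x [e|] hH hn; last first.
  by case: hn => [[v [hv _] [->]]|[e _ [x' [_ _ []//]]]].
have [d [_ _ _ _ [hp|hb]]] := end_dart hn; first exact: ps_in.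
exfalso; apply: (leaf_outside_steiner cut_graph_tree SG (end_leaf hn) _ hH).
by move=> [_ hp]; case: hb => _; apply; apply: ps_in hp.
Qed.

(** Nodes of the hull stay at a positive distance from all sides, and so do, by
    convexity, its edges. *)
Lemma core_compact : compactly_contained (realization H) Om°.
Proof.
have SG : S `<=` gnodes T by move=> x [].
have sH := steiner_subgraph cut_graph_is_graph SG.
have [gH fN _] := steiner_finite cut_graph_tree SG cut_graph_finite.
pose l : seq (node_type R) := fset_set (gnodes H).
have lP nd : gnodes H nd -> nd \in l by move=> h; rewrite in_fset_set //; apply/mem_set.
have lP' nd : nd \in l -> gnodes H nd by rewrite in_fset_set // => /set_mem.
have [h hh|q q0 hq] := @seq_eps R _ s (fun h q => forall nd, nd \in l -> q <= hp h nd.1).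
  have [nd hnd|q q0 hq] := @seq_eps R _ l (fun nd q => q <= hp h nd.1).
    have := core_node_interior (lP' _ hnd) => /OmiP/(_ h hh) p.
    by exists (hp h nd.1) => // q /andP[].
  by exists q => // q' /andP[p1 p2] nd hnd; apply: hq; rewrite // p1.
have {}hq h nd : h \in s -> gnodes H nd -> q <= hp h nd.1.
  by move=> hh hn; apply: hq (lP _ hn); rewrite // q0 lexx.
have hr x h : realization H x -> h \in s -> q <= hp h x.
  move=> [[nd hn ->]|[e he /open_segmentP[t /andP[t0 t1] ->]]] hh; first exact: hq.
  have [h1 h2] := gH _ he; have := hq h _ hh h1; have := hq h _ hh h2.
  rewrite /= !cut_node1 hp_ray dot_sub => q2 q1.
  have e0 : hp h e.1 + t * (dot (vz h.1) e.2 - dot (vz h.1) e.1) =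
      (1 - t) * hp h e.1 + t * hp h e.2 by rewrite /hp; ring.
  have t1' : 0 <= 1 - t by lra.
  have := ler_wpM2l t1' q1; have := ler_wpM2l (ltW t0) q2; rewrite e0; lra.
have hc x h : closure (realization H) x -> h \in s -> q <= hp h x.
  move=> hx hh; rewrite leNgt; apply/negP => hlt.
  have : 0 < (q - h.2) + dot (- (vz h.1).1, - (vz h.1).2) x.
    by move: hlt; rewrite /hp /dot /=; lra.
  move=> /near_aff/hx[y [hy]]; have := hr y h hy hh.
  by rewrite /hp /dot /=; lra.
have hi : closure (realization H) `<=` Om°.
  by move=> x hx; apply/OmiP => h hh; apply: lt_le_trans q0 (hc x h hx hh).
split=> //; apply: subclosed_compact cOm _; first exact: closed_closure.
by move=> x /hi/Omi_sub.
Qed.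

(** A node outside the core that is a leaf is no vertex and no marked end, so it
    lies on the boundary. *)
Theorem core_structure : (finite_graph T /\ is_tree T) /\
  exists H, minimal_subtree T S H /\
  let Gamma := quotient_graph f T in
  let core := quotient_graph f H in
  [/\ compactly_contained (realization H) Om°,
      [/\ finite_graph core, graph_connected core & betti1 core = size ps],
      forall w, graph_cycle Gamma w -> forall d, d \in w -> gedges core d.1
    & forall C, outside_component Gamma core C ->
        exists a, [/\ gnodes core `&` gnodes C = [set a],
                      is_tree C,
                      forall nd, gnodes C nd -> ~ Mk nd.1
                    & forall nd, leaf C nd -> nd <> a -> bd Om nd.1]].
Proof.
have fT := cut_graph_finite; have tT := cut_graph_tree.
have SG : S `<=` gnodes T by move=> x [].
have [p hp] : exists p, p \in ps.
  by case eps : ps ps_neq0 => [//|p ps'] _; exists p; rewrite mem_head.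
have [d' [p1 o1 p2 o2 [n12 _ _]]] := mark_dartP hp.
have [s0S e0] := marked_dart p1 (etrans (congr1 (mem ps) o1) hp : org _ \in ps).
have [s1S e1] := marked_dart p2 (etrans (congr1 (mem ps) o2) hp : org _ \in ps).
have s01 : dart_from T (mark_dart p) <> dart_from T d'.
  by rewrite e0 e1 => -[_ e]; move: n12; rewrite e eqxx.
split=> //; exists H; split.
  by apply: steiner_minimal => //; exists (dart_from T d').
split.
- exact: core_compact.
- split; [exact: (core_finite f tT SG fT)|exact: (core_connected f tT SG s0S)|].
  exact: (core_betti tT SG s0S glue_inj fT card_marked_ends card_glued_ends).
- move=> w hw d hd; exact: (cycle_in_core tT SG s0S glue_inj hw hd).
- move=> C [c0 hc ->].
  have [a0 [h1 h2 h3 h4]] := outside_component_tree tT SG marked_ends_leaf s0S s1S s01 glue_inj hc.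
  have node (x : node_type R) : gnodes T x -> ~ S x -> f x = x /\ ~ Mk x.1.
    move=> hx nS; have nm : ~ Mk x.1 by move=> hm; apply: nS.
    by split=> //; rewrite /f /glue_ends; case: asboolP.
  exists (f a0); split=> //.
    by move=> nd /h3[x [-> hx /(node x hx)[-> //]]].
  move=> nd hl ne; have [x [-> lx nS]] := h4 nd hl ne; have [hx _] := lx.
  have [-> nm] := node x hx nS; case: x lx hx nS nm {ne hl} => y [e|] lx hx nS nm.
    by have [_ [_ _ _ _ []]] := end_dart hx.
  by case: hx => [[v hv [ev]]|[e _ [x' [_ _ []//]]]]; case: (vertex_not_leaf hv); rewrite -ev.
Qed.

End TropicalPolynomial.

(** * Strong genericity *)

Section Genericity.
Variable R : realType.
Local Notation vz := (@vecz R).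
Variables (s : seq ((int * int) * R)) (Om : set (R * R)).
Hypothesis prim_s : all (fun h => primitive h.1) s.
Hypothesis OmE : Om = [set x | forall h, h \in s -> 0 <= dot (vz h.1) x + h.2].
Hypothesis cOm : compact Om.
Hypothesis Om0 : Om° !=set0.
Implicit Types (x y u p : R * R) (m : int * int).

(** The function of a half-plane that vanishes at a point inside a segment of [Om]
    vanishes on the whole segment. *)
Lemma bd_face x : bd Om x ->
  polygon_vertex Om x \/ exists2 S, polygon_side Om S & S x.
Proof.
move=> /(bdP prim_s OmE)[hx [h hh h0]].
have [|nv] := pselect (polygon_vertex Om x); [by left|right].
have [y [z [hy hz yz hyz]]] : exists y z, [/\ Om y, Om z, y <> z & open_segment y z x].
  apply: contrapT => hn; apply: nv; split=> // y z hy hz yz hyz.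
  by apply: hn; exists y, z.
have hge w : Om w -> 0 <= hp h w by move=> hw; apply: ((OmP OmE w).1 hw).
have [t /andP[t0 t1] ex] := (open_segmentP _ _ _).1 hyz.
have e0 : (1 - t) * hp h y + t * hp h z = 0.
  by rewrite -[RHS]h0 ex hp_ray dot_sub /hp; ring.
have t1' : 0 < 1 - t by lra.
have e1 := mulr_ge0 (ltW t1') (hge _ hy); have e2 := mulr_ge0 (ltW t0) (hge _ hz).
have hy0 : (1 - t) * hp h y = 0 by lra.
have hz0 : t * hp h z = 0 by lra.
exists [set w | Om w /\ dot (vz h.1) w + h.2 = 0] => //.
exists h.1, h.2; split=> //; first exact: (allP prim_s h hh).
exists y, z; split=> //; split=> //.
  exact: pmul_eq0 hy0.
exact: pmul_eq0 hz0.
Qed.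

Lemma side_bd S x : polygon_side Om S -> S x -> bd Om x.
Proof.
move=> [n [a [pn hge -> _]]] [hx e]; split=> // hi.
have n0 : n != 0 by apply: contraL pn => /eqP ->.
have [q q0 [_ /hge]] := near_ray2 (vz n) hi.
rewrite dot_ray; have := mulr_gt0 q0 (dot_gt0 (vz_neq0 R n0)); lra.
Qed.

(** A nonnegative concave function vanishing inside is zero, and zero has only
    one active gradient. *)
Lemma positive_inside (B : seq (int * int)) (c : int * int -> R) (F : R * R -> R) p m1 m2 :
  (forall x m, Om x -> m \in B -> F x <= mono c m x) ->
  (forall x, Om x -> exists2 m, m \in B & F x = mono c m x) ->
  (forall x, Om x -> 0 <= F x) ->
  Om° p -> m1 \in B -> m2 \in B -> m1 != m2 -> F p = mono c m1 p -> F p = mono c m2 p ->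
  forall x, Om° x -> 0 < F x.
Proof.
move=> F_le F_at F_ge0 hp h1 h2 ne e1 e2 x hx.
have zero y m : Om° y -> m \in B -> mono c m y = 0 -> m = 0.
  move=> hy hm e; apply/(@vz_eq0 R) => u; have [q q0 [r1 r2]] := near_ray2 u hy.
  have := le_trans (F_ge0 _ r1) (F_le _ _ r1 hm); have := le_trans (F_ge0 _ r2) (F_le _ _ r2 hm).
  by rewrite !mono_ray e => a b; apply: (pmul_eq0 q0); lra.
rewrite lt0r F_ge0 ?andbT; last exact: Omi_sub.
apply/eqP => F0; have [m hm em] := F_at _ (Omi_sub hx).
have m0 := zero _ _ hx hm (etrans (esym em) F0).
have cst y : mono c m y = 0.
  by rewrite -F0 em m0 /mono /dot /vecz /=; ring.
have Fp : F p = 0.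
  have hO := Omi_sub hp; have := F_ge0 _ hO; have := F_le _ _ hO hm.
  by rewrite cst => ? ?; lra.
move/eqP: ne; apply.
by rewrite (zero _ _ hp h1 (etrans (esym e1) Fp)) (zero _ _ hp h2 (etrans (esym e2) Fp)).
Qed.

Variables (N : nat) (P : 'I_N -> R * R).
Hypothesis hP : forall i, Om° (P i).
Hypothesis injP : injective P.
Hypothesis genP : strongly_generic Om P.
Variables (B : seq (int * int)) (c : int * int -> R).
Let F := relaxation_at Om P.
Hypothesis F_le : forall x m, Om x -> m \in B -> F x <= mono c m x.
Hypothesis F_at : forall x, Om x -> exists2 m, m \in B & F x = mono c m x.
Hypothesis F_bd : forall x, bd Om x -> F x = 0.
Hypothesis F_ge0 : forall x, Om x -> 0 <= F x.
Hypothesis F_pos : forall x, Om° x -> 0 < F x.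

Let ps := [seq P i | i <- enum 'I_N].

Lemma psP p : p \in ps -> exists i, p = P i.
Proof. by move=> /mapP[i _ ->]; exists i. Qed.

Lemma mem_ps i : P i \in ps.
Proof. by apply: map_f; rewrite mem_enum. Qed.

Lemma ps_in p : p \in ps -> Om° p.
Proof. by move=> /psP[i ->]. Qed.

Lemma generic_regular p : p \in ps -> corner_locus Om F p /\ ~ graph_vertex Om F p.
Proof.
move=> /psP[i ->]; have [h _ _] := genP; have [e [_ sub _ _] ox] := h i.
exact: sub.
Qed.

Let markP p (hp : p \in ps) := mark_dartP prim_s OmE cOm F_le F_at ps_in generic_regular hp.

(** A cell that touches the boundary has the constant for which its affine function
    has minimum zero on [Om], so the constant depends only on the gradient. The
    cells beside the edge that carries a mark have the same gradients in all
    configurations of the same type. *)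
Lemma perturbed_marks (P' : 'I_N -> R * R) (B' : seq (int * int)) (c' : int * int -> R) :
  let F' := relaxation_at Om P' in
  (forall x m, Om x -> m \in B' -> F' x <= mono c' m x) ->
  (forall x, Om x -> exists2 m, m \in B' & F' x = mono c' m x) ->
  (forall x, bd Om x -> F' x = 0) -> (forall x, Om x -> 0 <= F' x) ->
  same_marked_type Om P P' ->
  (forall m, boundary_cell Om B c F m -> c m = c' m) /\
  (forall i sg, act B' c' F' (P' i) (side B c F sg (mark_dart Om F ps (P i)))).
Proof.
move=> F' F'_le F'_at F'_bd F'_ge0 [f2 [f1 [f0 iso]]].
have reg m : cell Om B c F m -> cell Om B' c' F' m /\
    f2 (region Om B c F m) = region Om B' c' F' m.
  move=> cm; have hW : cell_region Om F (region Om B c F m).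
    by apply/(cell_regionP prim_s OmE F_le F_at); exists m.
  have [fW _ _] := iso_cells iso; have := fW _ hW.
  move=> /(cell_regionP prim_s OmE F'_le F'_at)[m' cm' e].
  have /(iso_gradient iso m hW) : cell_gradient F (region Om B c F m) m.
    exact/(region_gradient F_le F_at).
  by rewrite e => /(region_gradient F'_le F'_at _ cm') em; rewrite em in cm' e *.
have cellW m : cell Om B c F m -> cell_region Om F (region Om B c F m).
  by move=> cm; apply/(cell_regionP prim_s OmE F_le F_at); exists m.
split=> [m [cm [x hx m0]]|i sg].
  have [w hw] := cm; have hmB := actB (region_act hw).
  have [[w' hw'] e2] := reg _ cm; have hmB' := actB (region_act hw').
  have bx : bd Om x.
    apply: contrapT => nb; have hi : Om° x by apply: contrapT => ni; apply: nb.
    by have := F_le hx hmB; have := F_pos hi; rewrite m0; lra.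
  have hmx : act B c F x m by rewrite /act hmB m0 F_bd ?eqxx.
  have clx := closure_region prim_s OmE F_le F_at cm hx hmx.
  have [x' [hx' m0']] : exists x', Om x' /\ mono c' m x' = 0.
    case: (bd_face bx) => [vx|[S sS Sx]].
      have := (iso_cell_corner iso (cellW _ cm) vx).1 clx; rewrite e2.
      move=> /(closure_act OmE F'_le F'_at)[_ hm']; exists x; split=> //.
      by rewrite -(actE hm') F'_bd.
    have [|x' [+ Sx']] := (iso_cell_side iso (cellW _ cm) sS).1; first by exists x.
    rewrite e2 => /(closure_act OmE F'_le F'_at)[hx' hm']; exists x'; split=> //.
    by rewrite -(actE hm') F'_bd //; apply: side_bd sS Sx'.
  have := le_trans (F_ge0 hx') (F_le hx' hmB); have := le_trans (F'_ge0 _ hx) (F'_le _ _ hx hmB').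
  by move: m0 m0'; rewrite /mono; lra.
have hp := mem_ps i; have [d' [p1 o1 _ _ _]] := markP hp.
set d := mark_dart Om F ps (P i) in p1 o1 *; set m := side B c F sg d.
have cm : cell Om B c F m by apply: (side_cell prim_s OmE cOm F_le F_at ps_in).
have hm : act B c F (P i) m.
  by rewrite -o1; apply: (side_org prim_s OmE cOm F_le F_at ps_in).
have [h _ _] := genP; have [e he oe] := h i.
have pe : piece Om F [::] e.
  move: he; rewrite /graph_edge /piece; congr (segments_cut_by _ _ _ _).
  by apply/seteqP; split=> [x|x []//]; left.
have noin p : p \in [::] -> Om° p by [].
have in_cl x : closed_segment e.1 e.2 x -> closure (region Om B c F m) x.
  move=> hx; have [hO ha] : Om x /\ act B c F x m.
    case: hx => [ox|].
      split; first exact: Omi_sub (piece_interior pe ox).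
      by rewrite (piece_act prim_s OmE cOm F_le F_at m pe ox oe).
    have hd := act_dst prim_s OmE cOm F_le F_at noin (d := (e, true)) pe oe hm.
    have ho := act_org prim_s OmE cOm F_le F_at noin (d := (e, true)) pe oe hm.
    case=> ->; split=> //; first exact: (org_in noin (d := (e, true)) pe).
    exact: (dst_in noin (d := (e, true)) pe).
  exact: (closure_region prim_s OmE F_le F_at).
have [_ e2] := reg _ cm.
have := (iso_edge_cell iso he (cellW _ cm)).1 in_cl; rewrite e2 => sub.
have := (iso_mark_edge iso i he).1 oe => o'.
by have [] := closure_act OmE F'_le F'_at (sub _ (or_introl o')).
Qed.

(** Strong genericity makes the marks independent: a relation between the jumps
    of the coefficients at the marks, valid whenever the boundary cells are
    fixed, would fail after moving one mark across its edge. *)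
Lemma marks_independent (sc : R * R -> R) :
  (forall g : int * int -> R, (forall m, boundary_cell Om B c F m -> g m = 0) ->
     \sum_(p <- ps) sc p * flow B c F g (mark_dart Om F ps p) = 0) ->
  forall p, p \in ps -> sc p = 0.
Proof.
move=> hsc p hp; apply/eqP/negPn/negP => sp.
have [j ep] := psP hp; subst p.
pose md i := mark_dart Om F ps (P i); pose gap i := side B c F false (md i) - side B c F true (md i).
have [_ _ [eps eps0 hgen]] := genP.
have hnear : \forall y \near P j, ball (P j) eps y /\ Om° y.
  apply: filterI; first exact: nbhsx_ballx.
  by apply: open_nbhs_nbhs; split; [exact: open_interior|exact: hP].
have [q q0 [[hball hin] _]] := near_ray2 (vz (gap j)) hnear.
(* The mark [P j] moves along the normal of its edge. *)
pose P' i := if i == j then ray (P j) (vz (gap j)) q else P i.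
have hP' i : Om° (P' i) by rewrite /P'; case: ifP.
have same : same_marked_type Om P P'.
  apply: hgen => i; rewrite /P'; case: eqP => [-> //|_]; exact: ballxx.
have [B' [c' [F'_le F'_at [F'_bd F'_ge0] _ _]]] := relaxation_poly prim_s OmE cOm Om0 hP'.
have [hbd hmk] := perturbed_marks F'_le F'_at F'_bd F'_ge0 same.
have hg m : boundary_cell Om B c F m -> c m - c' m = 0 by move=> /hbd ->; rewrite subrr.
have := hsc _ hg; rewrite (bigD1_seq (P j)) //=; last first.
  by rewrite map_inj_uniq // enum_uniq.
have flowE i : flow B c F (fun m => c m - c' m) (md i) =
    dot (vz (gap i)) (P i) - dot (vz (gap i)) (P' i).
  have [d' [p1 o1 _ _ _]] := markP (mem_ps i).
  have h1 := side_org prim_s OmE cOm F_le F_at ps_in true p1.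
  have h2 := side_org prim_s OmE cOm F_le F_at ps_in false p1.
  have h3 := hmk i true; have h4 := hmk i false; rewrite o1 in h1 h2.
  have e1 := etrans (esym (actE h1)) (actE h2); have e2 := etrans (esym (actE h3)) (actE h4).
  by rewrite /flow /gap !vz_sub; move: e1 e2; rewrite /mono -/(md i); lra.
rewrite big1_seq ?addr0; last first.
  move=> p' /andP[np /psP[i ei]]; subst p'; rewrite flowE /P'.
  by case: eqP => [e|_]; [rewrite e eqxx in np|rewrite subrr mulr0].
rewrite flowE /P' eqxx dot_ray opprD addrA subrr sub0r mulrN => /eqP.
rewrite oppr_eq0 !mulf_eq0 (negbTE sp) gt_eqF //= gt_eqF // dot_gt0 // vz_neq0 // subr_eq0 eq_sym.
have [d' [p1 _ _ _ _]] := markP (mem_ps j).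
exact: (side_neq prim_s OmE cOm F_le F_at ps_in).
Qed.

End Genericity.

Theorem theorem4p32 (R : realType) (Omega : set (R * R)) (N : nat)
    (P : 'I_N -> R * R)
    (hOmega : rational_polygon Omega)
    (hN : (1 <= N)%N)
    (hP : forall i, Omega° (P i))
    (injP : injective P)
    (genP : strongly_generic Omega P) :
  let F := relaxation_at Omega P in
  let marks := range P in
  let T := cut_graph Omega F marks in
  (finite_graph T /\ is_tree T) /\
  exists H, minimal_subtree T (marked_ends Omega F marks) H /\
  let Gamma := quotient_graph (glue_ends marks) T in
  let core := quotient_graph (glue_ends marks) H in
  [/\ compactly_contained (realization H) Omega°,
      [/\ finite_graph core, graph_connected core & betti1 core = N],
      forall w, graph_cycle Gamma w -> forall d, d \in w -> gedges core d.1
    & forall C, outside_component Gamma core C ->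
        exists a, [/\ gnodes core `&` gnodes C = [set a],
                      is_tree C,
                      forall nd, gnodes C nd -> ~ marks nd.1
                    & forall nd, leaf C nd -> nd <> a -> bd Omega nd.1]].
Proof.
have [cOm Om0 [s prim_s OmE]] := hOmega.
have [B [c [F_le F_at [F_bd F_ge0] hmk hmin]]] := relaxation_poly prim_s OmE cOm Om0 hP.
have [m1 [m2 [h1 h2 ne e1 e2]]] := hmk (Ordinal hN).
have F_pos := positive_inside F_le F_at F_ge0 (hP _) h1 h2 ne e1 e2.
pose ps := [seq P i | i <- enum 'I_N].
have ePs : range P = [set` ps].
  apply/seteqP; split=> [_ [i _ <-]|_ /mapP[i _ ->]]; last by exists i.
  by apply: map_f; rewrite mem_enum.
have sN : size ps = N by rewrite size_map size_enum_ord.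
have ups : uniq ps by rewrite map_inj_uniq // enum_uniq.
have ps0 : ps != [::] by rewrite -size_eq0 sN -lt0n.
have hmin' G : tropical_series Omega G ->
    (forall p, p \in ps -> corner_locus Omega G p) ->
    forall x, Omega x -> relaxation_at Omega P x <= G x.
  by move=> sG cG; apply: hmin => // p; rewrite ePs; apply: cG.
have ind := marks_independent prim_s OmE cOm Om0 hP injP genP F_le F_at F_bd F_ge0 F_pos.
have := core_structure prim_s OmE cOm F_le F_at (ps_in hP) (generic_regular genP)
  F_bd F_pos hmin' ups ps0 ind.
by rewrite sN -ePs.
Qed.
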